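(* Fix $h$. Then the problem $(\mathrm{McC}_h)$ has a convex feasible set that is bounded in $U\times H\times\mathbb{R}^{N_h}$, and $(\mathrm{McC}_h)$ admits a minimizer. Let $(u,w)$ be feasible for $(\mathrm{OCP})$. Let $w_h:=w$, let $u_h\in U$ be the unique solution of $Au_h+(P_hu_h)(P_hw)=f$ in $U^*$, and let $z_h:=(P_hu_h)(P_hw_h)$ (a function that is constant on each cell and is identified with the vector of its cell values). Then $(u_h,w_h,z_h)$ is feasible for $(\mathrm{McC}_h)$ and $$|j(u_h,w_h)+\alpha\,\mathrm{TV}(w_h)-j(u,w)-\alpha\,\mathrm{TV}(w)|\le L_u\|u-u_h\|_U ,$$ where $L_u$ is the Lipschitz constant of $j$ with respect to its first argument on the feasible set of $(\mathrm{McC}_h)$. Moreover, if $m_{\mathrm{OCP}}$ and $m_{\mathrm{McC}_h}$ denote the infima of $(\mathrm{OCP})$ and $(\mathrm{McC}_h)$, $(\bar u,\bar w)$ denotes the minimizer of $(\mathrm{OCP})$, and $\bar u_h\in U$ is the corresponding solution of $A\bar u_h+(P_h\bar u_h)(P_h\bar w)=f$, then $$m_{\mathrm{OCP}}\ \ge\ m_{\mathrm{McC}_h}-L_u\|\bar u-\bar u_h\|_U .$$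
   Context: Setting. $\Omega\subset\mathbb{R}^d$ is a bounded domain, $H:=L^2(\Omega)$, and the control space is $W:=BV(\Omega)$; $\mathrm{TV}$ is the total variation seminorm, with $\mathrm{TV}(w)=+\infty$ if $w\in L^1(\Omega)\setminus BV(\Omega)$. $U$ is a reflexive Banach space compactly embedded into $H$; identifying $H\cong H^*$ one has compact embeddings $U\hookrightarrow H\cong H^*\hookrightarrow U^*$. $A:U\to U^*$ is linear and bounded with bounded inverse, $f\in U^*$, $\alpha>0$, $j:U\times H\to\mathbb{R}$ is Lipschitz continuous on bounded sets, and $C\subset H$ is nonempty, bounded, closed and convex. For all $(u,w)\in U\times W$ the product $uw$ is a measurable function that is also an element of $U^*$. The state equation $Au+uw=f$ is assumed to have a unique solution $u\in U$ for a given control $w\in C\cap W$. $(\mathrm{OCP})$: minimize $j(u,w)+\alpha\,\mathrm{TV}(w)$ over states $u\in U$ and controls $w\in C$ (the control space being $W$) subject to $Au+uw=f$ in $U^*$. Bounds. There are $u_\ell,u_u\in H$ and $w_\ell,w_u\in L^\infty(\Omega)$ such that $u_\ell\le u\le u_u$ and $w_\ell\le w\le w_u$ a.e. for all $(u,w)\in U\times W$ with $Au+uw=f$ and $w\in C$. Partitions and averaging. For each $h$ from a sequence of mesh sizes, $\mathcal{Q}_h=\{Q_h^1,\dots,Q_h^{N_h}\}$ is a partition of $\Omega$ into intervals ($d=1$), squares ($d=2$), cubes ($d=3$), and so on, with mesh size $h$, and $P_hg:=\sum_{i=1}^{N_h}\frac{1}{|Q_h^i|}\int_{Q_h^i}g\,dx\;\chi_{Q_h^i}$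 for $g\in L^1(\Omega)$. It is assumed that: (a) for every $w\in BV(\Omega)$ with $w_\ell\le w\le w_u$ a.e. the equation $Au+(P_hu)(P_hw)=f$ has a unique solution $u\in U$; (b) there are real numbers $u_\ell^i,u_u^i,w_\ell^i,w_u^i$ (depending on $h$ and $i$) such that $u_\ell^i\le(P_hu)|_{Q_h^i}\le u_u^i$ and $w_\ell^i\le(P_hw)|_{Q_h^i}\le w_u^i$ for all $i$ and for all $w\in C$ with $w_\ell\le w\le w_u$ a.e. and $u\in U$ that solve $Au+(P_hu)(P_hw)=f$. $(\mathrm{McC}_h)$: minimize $j(u,w)+\alpha\,\mathrm{TV}(w)$ over $u\in U$, $w\in C$ with $w_\ell\le w\le w_u$ a.e., and $(z_1,\dots,z_{N_h})\in\mathbb{R}^{N_h}$, subject to $Au+\sum_{i=1}^{N_h}z_i\chi_{Q_h^i}=f$ in $U^*$ and, for every $i\in\{1,\dots,N_h\}$, on $Q_h^i$ (where $P_hu,P_hw$ are constant): $z_i\ge u_\ell^iP_hw+(P_hu)w_\ell^i-u_\ell^iw_\ell^i$, $z_i\ge u_u^iP_hw+(P_hu)w_u^i-u_u^iw_u^i$, $z_i\le u_u^iP_hw+(P_hu)w_\ell^i-u_u^iw_\ell^i$, $z_i\le u_\ell^iP_hw+(P_hu)w_u^i-u_\ell^iw_u^i$, $u_\ell^i\le P_hu\le u_u^i$.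
   Formalization: L_u is taken as a Lipschitz constant of j in its first argument on the feasible sets of (McC_h) and (OCP) together, since the OCP state need not be feasible for (McC_h); existence of a minimizer of (McC_h) is stated assuming C contains some control in BV(Ω). *)

(* Defs.v *)
From HB Require Import structures.
From mathcomp Require Import all_boot all_order all_algebra.
From mathcomp Require Import all_classical all_reals all_analysis.
From mathcomp Require Import measurable_realfun.

Set Implicit Arguments.
Unset Strict Implicit.
Unset Printing Implicit Defensive.

Import Order.TTheory GRing.Theory Num.Theory.
Import numFieldNormedType.Exports.

Local Open Scope classical_set_scope.
Local Open Scope ring_scope.

Definition rV_display : measure_display. Proof. exact: default_measure_display. Qed.

Section borel_rV.
Context {R : realType} {n : nat}.
Implicit Types A : set 'rV[R]_n.

Let borel : set (set 'rV[R]_n) := <<s [set A | open A] >>.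

Let borel0 : borel set0. Proof. exact: sigma_algebra0. Qed.

Let borelC A : borel A -> borel (~` A). Proof. exact: sigma_algebraC. Qed.

Let borel_bigcup (F : (set 'rV[R]_n)^nat) :
  (forall i, borel (F i)) -> borel (\bigcup_i F i).
Proof. exact: sigma_algebra_bigcup. Qed.

HB.instance Definition _ := @isMeasurable.Build rV_display 'rV[R]_n
  borel borel0 borelC borel_bigcup.

Lemma open_measurable_rV A : open A -> measurable A.
Proof. exact: sub_sigma_algebra. Qed.

End borel_rV.

Section measurable_rV.
Context {R : realType} {n : nat}.
Lemma measurable_rVP d (T : measurableType d) (f : T -> 'rV[R]_n) :
  (forall i, measurable_fun setT (fun t => f t 0 i)) -> measurable_fun setT f.
Proof.
move=> mf.
apply: (@measurability _ _ _ _ _ _ [set A : set 'rV[R]_n | open A]) => //.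
move=> _ [A oA <-]; rewrite setTI.
pose qv (q : 'rV[rat]_n) : 'rV[R]_n := map_mx ratr q.
pose B (q : 'rV[rat]_n * rat) : set 'rV[R]_n :=
  [set x | forall i, `|x 0 i - qv q.1 0 i| < ratr q.2].
have -> : f @^-1` A = \bigcup_(q in [set q | B q `<=` A]) (f @^-1` B q).
  apply/seteqP; split => [t Aft|t [q /= BA Bt]]; last exact: BA.
  have /nbhs_ballP[e /= e0 eA] := open_nbhs_nbhs (conj oA Aft).
  have [r /andP[r0 re]] : exists r : rat, 0 < (ratr r : R) < e / 2.
    have [r] := @rat_in_itvoo R 0 (e / 2) ltac:(by rewrite divr_gt0).
    by rewrite in_itv /=; exists r.
  have cq i : exists q : rat, `|f t 0 i - (ratr q : R)| < ratr r.
    have [q] := @rat_in_itvoo R (f t 0 i - ratr r) (f t 0 i + ratr r)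
      ltac:(by rewrite ltrD2l gtrN).
    by rewrite in_itv/= => qfr; exists q; rewrite distrC ltr_distl.
  have [q hq] := choice cq.
  exists (\row_i q i, r); last by move=> i; rewrite /qv !mxE.
  move=> y By; apply: eA.
  rewrite -ball_normE /ball_ /= /Num.Def.normr /= mx_normrE.
  apply/bigmax_ltP; split => // -[i0 i] _; rewrite !mxE ord1 /=.
  have := By i; rewrite /qv !mxE /= => yq.
  rewrite (le_lt_trans (ler_distD (ratr (q i)) _ _))//.
  by rewrite (splitr e) ltrD// ?(lt_trans (hq i))// distrC (lt_trans yq).
rewrite bigcup_mkcond; apply: countable_bigcupT_measurable => // q.
case: ifPn => // _.
have -> : f @^-1` B q = \bigcap_(i in [set: 'I_n])
    ((fun t => `|f t 0 i - qv q.1 0 i|) @^-1` `]-oo, ratr q.2[).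
  apply/seteqP; split=> [t Bt i _|t Bt i]; first by rewrite /= in_itv /=.
  by have := Bt i I; rewrite /= in_itv.
apply: fin_bigcap_measurable => // i _.
have mg : measurable_fun setT (fun t => `|f t 0 i - qv q.1 0 i| : R).
  by apply: measurableT_comp => //; exact: measurable_funB.
by rewrite -[X in measurable X]setTI; exact: mg.
Qed.

Lemma measurable_coord (i : 'I_n) :
  measurable_fun setT (fun x : 'rV[R]_n => x 0 i).
Proof.
apply: (measurability _ (RGenOpens.measurableE R)).
move=> _ [_ [a [b ->] <-]]; rewrite setTI; apply: open_measurable_rV.
by apply: open_comp; [move=> x _; exact: coord_continuous|exact: interval_open].
Qed.
End measurable_rV.
Arguments measurable_coord {R n} i.

Section rV_cons.
Context {R : realType} {n : nat}.

Definition rV_cons (p : R * 'rV[R]_n) : 'rV[R]_n.+1 :=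
  \row_i if unlift ord0 i is Some j then p.2 0 j else p.1.

Lemma rV_cons0 p : rV_cons p 0 ord0 = p.1.
Proof. by rewrite mxE unlift_none. Qed.

Lemma rV_consS p j : rV_cons p 0 (lift ord0 j) = p.2 0 j.
Proof. by rewrite mxE liftK. Qed.

Lemma measurable_rV_cons : measurable_fun setT rV_cons.
Proof.
apply: measurable_rVP => i; have [j|] := unliftP ord0 i => ->.
  rewrite (_ : (fun _ => _) = (fun x : 'rV[R]_n => x 0 j) \o snd).
    by apply: measurableT_comp; [exact: measurable_coord|exact: measurable_snd].
  by apply/funext => p; exact: rV_consS.
rewrite (_ : (fun _ => _) = fst); first exact: measurable_fst.
by apply/funext => p; exact: rV_cons0.
Qed.

End rV_cons.

(* Product of the one-dimensional Lebesgue measures, transported to row vectors.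
   The measure structure of a pushforward depends on a measurability proof that
   is not inferred, so its canonical instance is applied by name. *)
Fixpoint lebesgue_rV (R : realType) (n : nat) :
    {measure set 'rV[R]_n -> \bar R} :=
  if n is m.+1 then
    measure_function_pushforward__canonical__measure_function_Measure
      (@lebesgue_measure R \x^ lebesgue_rV R m)%E (@measurable_rV_cons R m)
  else dirac (0 : 'rV[R]_0).

Lemma lebesgue_rV_box (R : realType) n (a b : 'rV[R]_n) :
  (forall i, a 0 i <= b 0 i) ->
  lebesgue_rV R n [set x | forall i, a 0 i <= x 0 i <= b 0 i] =
  (\prod_(i < n) (b 0 i - a 0 i))%:E.
Proof.
elim: n => [|n IHn] in a b *.
  by move=> _; rewrite big_ord0 /= diracE mem_set//; case.
move=> ab.
pose a' : 'rV[R]_n := \row_i a 0 (lift ord0 i).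
pose b' : 'rV[R]_n := \row_i b 0 (lift ord0 i).
pose B : set 'rV[R]_n := [set x | forall i, a' 0 i <= x 0 i <= b' 0 i].
have mB : measurable B.
  have -> : B = \bigcap_(i in [set: 'I_n])
      ((fun x => x 0 i) @^-1` `[a' 0 i, b' 0 i]).
    apply/seteqP; split=> [t Bt i _|t Bt i]; first by rewrite /= in_itv /=.
    by have := Bt i I; rewrite /= in_itv.
  apply: fin_bigcap_measurable => // i _.
  rewrite -[X in measurable X]setTI.
  exact: (measurable_coord i).
have -> : lebesgue_rV R n.+1 [set x | forall i, a 0 i <= x 0 i <= b 0 i] =
    (@lebesgue_measure R \x^ lebesgue_rV R n)%E (`[a 0 0, b 0 0] `*` B).
  rewrite /= /pushforward; congr (_ _).
  apply/seteqP; split => [[t x] /= h|[t x] /= [t0 xB] i].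
    split=> [|i]; first by have := h ord0; rewrite rV_cons0 in_itv.
    by have := h (lift ord0 i); rewrite rV_consS !mxE.
  have [j|] := unliftP ord0 i => ->; last by rewrite rV_cons0; move: t0; rewrite in_itv.
  by rewrite rV_consS; have := xB j; rewrite !mxE.
rewrite product_measure2E//.
rewrite IHn; last by move=> i; rewrite !mxE.
rewrite big_ord_recl EFinM; congr (_ * _)%E; last first.
  by congr EFin; apply: eq_bigr => i _; rewrite !mxE.
apply: etrans (lebesgue_measure_itv `[a 0 ord0, b 0 ord0]) _.
rewrite /= lte_fin; case: ltgtP (ab ord0) => [_ _|//|-> _].
  by rewrite -EFinB.
by rewrite subrr.
Qed.

Section L2.
Context d (T : measurableType d) (R : realType).
Variable mu : {measure set T -> \bar R}.

Let F := LfunType mu (lee1n 2).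

Definition L2_eq (f g : F) := `[< f = g %[ae mu] >].

Let L2_eq_refl : reflexive L2_eq.
Proof. by move=> f; apply/asboolP; exact: filterE. Qed.

Let L2_eq_sym : symmetric L2_eq.
Proof.
by move=> f g; apply/asboolP/asboolP; apply: filterS => x /[apply].
Qed.

Let L2_eq_trans : transitive L2_eq.
Proof.
move=> f g h /asboolP gf /asboolP fh; apply/asboolP.
by apply: filterS2 gf fh => x gf fh xT; rewrite gf ?fh.
Qed.

Canonical L2_eq_equiv := EquivRel L2_eq L2_eq_refl L2_eq_sym L2_eq_trans.

Local Open Scope quotient_scope.

Definition L2 : Type := {eq_quot L2_eq}.
HB.instance Definition _ := Choice.on L2.
HB.instance Definition _ := EqQuotient.on L2.

Definition L2_fun (f : L2) : T -> R := repr f.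
Coercion L2_fun : L2 >-> Funclass.

Definition L2_class (f : F) : L2 := \pi f.

Lemma L2P (f g : L2) : f = g %[ae mu] <-> f = g :> L2.
Proof.
split=> [fg|->]; last exact: filterE.
by rewrite -[f]reprK -[g]reprK; apply/eqmodP/asboolP.
Qed.

Lemma L2_classE (f : F) : L2_class f = f %[ae mu].
Proof.
by have /eqmodP/asboolP : repr (\pi f : L2) = f %[mod L2] by rewrite reprK.
Qed.

Lemma L2_classK (f : L2) : L2_class (repr f) = f. Proof. exact: reprK. Qed.

Lemma eq_L2_class (f g : F) : f = g %[ae mu] -> L2_class f = L2_class g.
Proof. by move=> fg; apply/eqmodP/asboolP. Qed.

Let zero : L2 := L2_class 0.
Let opp (f : L2) : L2 := L2_class (- repr f).
Let add (f g : L2) : L2 := L2_class (repr f + repr g).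
Let scale (a : R) (f : L2) : L2 := L2_class (a *: repr f).

Let oppE f : opp (L2_class f) = L2_class (- f).
Proof.
by apply: eq_L2_class; apply: filterS (L2_classE f) => x /(_ I) h _; congr (- _).
Qed.

Let addE f g : add (L2_class f) (L2_class g) = L2_class (f + g).
Proof.
apply: eq_L2_class; apply: filterS2 (L2_classE f) (L2_classE g).
by move=> x /(_ I) hf /(_ I) hg _; congr (_ + _).
Qed.

Let scaleE a f : scale a (L2_class f) = L2_class (a *: f).
Proof.
by apply: eq_L2_class; apply: filterS (L2_classE f) => x /(_ I) h _; congr (_ * _).
Qed.

Let addA : associative add.
Proof.
move=> f g h; rewrite -[f]L2_classK -[g]L2_classK -[h]L2_classK.
by rewrite !addE addrA.
Qed.

Let addC : commutative add.
Proof. by move=> f g; rewrite -[f]L2_classK -[g]L2_classK !addE addrC. Qed.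

Let add0 : left_id zero add.
Proof. by move=> f; rewrite -[f]L2_classK addE add0r. Qed.

Let addN : left_inverse zero opp add.
Proof. by move=> f; rewrite -[f]L2_classK oppE addE addNr. Qed.

HB.instance Definition _ := GRing.isZmodule.Build L2 addA addC add0 addN.

Let scaleA a b f : scale a (scale b f) = scale (a * b) f.
Proof. by rewrite -[f]L2_classK !scaleE scalerA. Qed.

Let scale1 : left_id 1 scale.
Proof. by move=> f; rewrite -[f]L2_classK scaleE scale1r. Qed.

Let scaleDr : right_distributive scale +%R.
Proof.
move=> a f g; rewrite -[f]L2_classK -[g]L2_classK.
transitivity (scale a (L2_class (repr f + repr g))); first by congr scale; exact: addE.
by rewrite !scaleE scalerDr; symmetry; exact: addE.
Qed.

Let scaleDl f : {morph scale^~ f : a b / a + b}.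
Proof.
move=> a b; rewrite -[f]L2_classK !scaleE scalerDl.
by symmetry; exact: addE.
Qed.

HB.instance Definition _ := GRing.Zmodule_isLmodule.Build R L2
  scaleA scale1 scaleDr scaleDl.

Lemma L2_addE (f g : L2) : (f + g : L2) = (fun x => f x + g x) %[ae mu].
Proof. exact: L2_classE. Qed.

Lemma L2_scaleE a (f : L2) : (a *: f : L2) = (fun x => a * f x) %[ae mu].
Proof. exact: L2_classE. Qed.

Definition L2_norm (f : L2) : R := fine ('N[mu]_2%:E [EFin \o f])%E.

Let L2_norm_class (f : F) : L2_norm (L2_class f) = fine ('N[mu]_2%:E [EFin \o f])%E.
Proof.
rewrite /L2_norm unlock; congr (fine (_ `^ _)%E).
have mp (g : F) : measurable_fun setT (fun x => `|(EFin \o g) x| `^ 2)%E.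
  apply: (measurableT_comp (measurable_poweR _)).
  by apply: measurableT_comp => //; exact: measurableT_comp.
apply: ge0_ae_eq_integral => //; try by move=> x _; exact: poweR_ge0.
  exact: (mp (repr (L2_class f))).
by apply: filterS (L2_classE f) => x /[apply] /= ->.
Qed.

Let L2_norm_triangle (f g : L2) : L2_norm (f + g) <= L2_norm f + L2_norm g.
Proof. by rewrite L2_norm_class; exact: ler_LnormD. Qed.

Let L2_normZ a (f : L2) : L2_norm (a *: f) = `|a| * L2_norm f.
Proof.
rewrite L2_norm_class; apply: EFin_inj.
rewrite EFinM.
rewrite -[X in (_ * X)%E]/((fine ('N[mu]_2%:E [EFin \o (repr f)])%E)%:E).
by rewrite !finite_norm_fine -LnormZ.
Qed.

Let L2_norm0_eq0 (f : L2) : L2_norm f = 0 -> f = 0.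
Proof.
move=> /fine_Lnormr_eq0 f0; rewrite -[f]L2_classK.
by apply: eq_L2_class.
Qed.

HB.instance Definition _ := Lmodule_isNormed.Build R L2
  L2_norm_triangle L2_normZ L2_norm0_eq0.

Lemma L2_normE (f : L2) : `|f| = fine ('N[mu]_2%:E [EFin \o f])%E.
Proof. by []. Qed.

End L2.

Section dual.
Context {R : realType} (U : normedModType R).

Definition dual_pred : {pred U -> R^o} :=
  [pred f | `[< linear (f : U -> R^o) /\ continuous (f : U -> R^o) >]].

Fact dual_submod_closed : submod_closed dual_pred.
Proof.
split.
  apply/asboolP; split; last by move=> x; exact: cst_continuous.
  by move=> a u v; rewrite /= scaler0 addr0.
move=> a f g /asboolP[lf cf] /asboolP[lg cg]; apply/asboolP.
split.
  move=> k u v; rewrite /GRing.add /GRing.scale /= lf lg.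
  by rewrite /GRing.scale /= !mulrDr addrACA mulrCA.
move=> x; apply: continuousD; last exact: cg.
by apply: continuousM; [exact: cst_continuous|exact: cf].
Qed.

HB.instance Definition _ :=
  GRing.isSubmodClosed.Build R (U -> R^o) dual_pred dual_submod_closed.

Record dual_space := Dual { dual_fun :> U -> R^o ; _ : dual_fun \in dual_pred }.

HB.instance Definition _ := [isSub for dual_fun].
HB.instance Definition _ := [Choice of dual_space by <:].
HB.instance Definition _ := [SubChoice_isSubLmodule of dual_space by <:].

Implicit Types f g : dual_space.

Lemma dual_linear f : linear f.
Proof. by case: f => f /= /asboolP[]. Qed.

Lemma dual_continuous f : continuous f.
Proof. by case: f => f /= /asboolP[]. Qed.

Definition dual_norm f : R := sup [set `|f u| | u in [set u : U | `|u| <= 1]].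

Let lin f : {linear U -> R^o} :=
  HB.pack (f : U -> R^o) (GRing.isLinear.Build R U R^o *:%R f (@dual_linear f)).

Let norm_has_sup f : has_sup [set `|f u| | u in [set u : U | `|u| <= 1]].
Proof.
split; first by exists `|f 0|, 0 => //=; rewrite normr0.
have /linear_boundedP[M [Mr fM]] := @continuous_linear_bounded _ _ _ 0 (lin f) (@dual_continuous f 0).
exists (`|M| + 1) => _ [u /= u1 <-].
rewrite (le_trans (fM (`|M| + 1) _ u))//.
  by rewrite (le_lt_trans (ler_norm _))// ltrDl.
by rewrite ler_piMr.
Qed.

Lemma le_dual_norm f u : `|f u| <= dual_norm f * `|u|.
Proof.
have [->|u0] := eqVneq u 0.
  have -> : f 0 = 0 by exact: (linear0 (lin f)).
  by rewrite !normr0 mulr0.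
rewrite -ler_pdivrMr ?normr_gt0//.
apply: sup_upper_bound (norm_has_sup f) _ _; exists (`|u|^-1 *: u) => /=.
  by rewrite normrZ normfV normr_id mulVf// normr_eq0.
have -> : f (`|u|^-1 *: u) = `|u|^-1 * f u by exact: (linearZ_LR (lin f)).
by rewrite normrM normfV normr_id mulrC.
Qed.

Let dual_norm_le f k : 0 <= k -> (forall u, `|f u| <= k * `|u|) -> dual_norm f <= k.
Proof.
move=> k0 fk; apply: sup_le_ub; first by case: (norm_has_sup f).
by move=> _ [u /= u1 <-]; rewrite (le_trans (fk u))// ler_piMr.
Qed.

Let dual_norm_ge0 f : 0 <= dual_norm f.
Proof.
apply: (le_trans (normr_ge0 (f 0))).
apply: sup_upper_bound (norm_has_sup f) _ _; exists 0 => //=; by rewrite normr0.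
Qed.

Let dual_normD f g : dual_norm (f + g) <= dual_norm f + dual_norm g.
Proof.
apply: dual_norm_le; first exact: addr_ge0.
by move=> u; rewrite mulrDl (le_trans (ler_normD _ _))// lerD// le_dual_norm.
Qed.

Let dual_normZ_le a f : dual_norm (a *: f) <= `|a| * dual_norm f.
Proof.
apply: dual_norm_le; first exact: mulr_ge0.
by move=> u; rewrite [leLHS]normrM -mulrA ler_wpM2l// le_dual_norm.
Qed.

Let dual_normZ a f : dual_norm (a *: f) = `|a| * dual_norm f.
Proof.
apply/eqP; rewrite eq_le dual_normZ_le /=.
have [->|a0] := eqVneq a 0; first by rewrite normr0 mul0r.
rewrite mulrC -ler_pdivlMr ?normr_gt0// mulrC -normfV.
by rewrite -[in leLHS](scalerK a0 f) dual_normZ_le.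
Qed.

Let dual_norm0_eq0 f : dual_norm f = 0 -> f = 0.
Proof.
move=> f0; apply/val_inj/funext => u /=; apply/normr0_eq0/eqP.
by rewrite eq_le normr_ge0 andbT (le_trans (le_dual_norm f u))// f0 mul0r.
Qed.

HB.instance Definition _ := Lmodule_isNormed.Build R dual_space
  dual_normD dual_normZ dual_norm0_eq0.

End dual.

Definition reflexive_space (R : realType) (U : normedModType R) :=
  forall Phi : dual_space (dual_space U), exists u : U, forall phi : dual_space U, Phi phi = phi u.

Definition compact_map (R : realType) (U V : normedModType R) (f : U -> V) :=
  forall B : set U, bounded_set B -> compact (closure (f @` B)).

Definition is_minimizer (R : realType) (T : Type) (F : set T) (J : T -> \bar R)
    (x : T) :=
  F x /\ forall y, F y -> (J x <= J y)%E.

Definition inf_value (R : realType) (T : Type) (F : set T) (J : T -> \bar R) :=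
  ereal_inf (J @` F).

Section BV.
Context {R : realType} {d : nat}.
Local Notation leb := (lebesgue_rV R d).
Implicit Types (Omega : set 'rV[R]_d) (w : 'rV[R]_d -> R).

Definition bounded_domain Omega :=
  [/\ open Omega, connected Omega, Omega !=set0 & bounded_set Omega].

Definition ae_le Omega (f g : 'rV[R]_d -> R) :=
  {ae leb, forall x, Omega x -> f x <= g x}.

Definition divergence (phi : 'rV[R]_d -> 'rV[R]_d) (x : 'rV[R]_d) : R :=
  \sum_(i < d) ('D_(delta_mx 0 i) phi x) 0 i.

(* phi in C^1_c(Omega; R^d) with |phi(x)|_2 <= 1 everywhere; the norm carried by
   'rV is the maximum norm, hence the explicit sum of squares. *)
Definition test_field Omega (phi : 'rV[R]_d -> 'rV[R]_d) :=
  [/\ forall x, differentiable phi x,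
      forall v, continuous ('D_v phi),
      exists K, [/\ compact K, K `<=` Omega & forall x, ~ K x -> phi x = 0] &
      forall x, \sum_(i < d) phi x 0 i ^+ 2 <= 1].

Definition TV Omega w : \bar R :=
  ereal_sup [set (\int[leb]_(x in Omega) (w x * divergence phi x))%:E
            | phi in test_field Omega].

Definition BV Omega w :=
  leb.-integrable Omega (EFin \o w) /\ (TV Omega w < +oo)%E.

Definition lebesgue_on Omega (oO : open Omega) : {measure set 'rV[R]_d -> \bar R} :=
  mrestr leb (open_measurable_rV oO).

(* An axis-parallel cube of side s; which part of its boundary belongs to Q is
   left free, so that an open Omega can be partitioned exactly. *)
Definition is_cube (s : R) (Q : set 'rV[R]_d) :=
  exists a : 'rV[R]_d,
    [set x : 'rV[R]_d | forall i, a 0 i < x 0 i < a 0 i + s] `<=` Q /\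
    Q `<=` [set x : 'rV[R]_d | forall i, a 0 i <= x 0 i <= a 0 i + s].

(* Cubes of possibly different sizes are allowed, h being the largest side. *)
Definition cube_partition Omega (h : R) (N : nat) (Q : 'I_N -> set 'rV[R]_d) :=
  [/\ forall i, measurable (Q i),
      trivIset [set: 'I_N] Q,
      \bigcup_(i in [set: 'I_N]) Q i = Omega &
      exists s : 'I_N -> R, [/\ forall i, 0 < s i <= h,
        exists i, s i = h & forall i, is_cube (s i) (Q i)]].

Definition cell_mean (Q : set 'rV[R]_d) (g : 'rV[R]_d -> R) : R :=
  (fine (leb Q))^-1 * \int[leb]_(x in Q) g x.

Definition cell_average N (Q : 'I_N -> set 'rV[R]_d) (g : 'rV[R]_d -> R) :
    'rV[R]_d -> R :=
  fun x => \sum_(i < N) cell_mean (Q i) g * \1_(Q i) x.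

End BV.

Section problems.
Context {R : realType} {d : nat} {Omega : set 'rV[R]_d} {oO : open Omega}.
Local Notation leb := (lebesgue_rV R d).
Local Notation H := (L2 (lebesgue_on oO)).
Context {U : normedModType R}.
Variables (emb : U -> H) (A : U -> dual_space U) (f : dual_space U).
Variables (C : set H) (j : U * H -> R^o) (alpha : R).

(* The function g on Omega, as an element of the dual of U, is
   v |-> \int_Omega g v; for g in H this is the embedding of H = H^* into U^*. *)
Definition represents (g : 'rV[R]_d -> R) (phi : dual_space U) :=
  forall v : U, leb.-integrable Omega (EFin \o (fun x => g x * emb v x)) /\
    phi v = \int[leb]_(x in Omega) (g x * emb v x).

Definition solves (u : U) (g : 'rV[R]_d -> R) :=
  exists2 phi : dual_space U, represents g phi & A u + phi = f.

Definition state_eq (u : U) (w : 'rV[R]_d -> R) :=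
  solves u (fun x => emb u x * w x).

Definition objective (p : U * H) : \bar R :=
  ((j p)%:E + alpha%:E * TV Omega p.2)%E.

Definition ocp_feasible : set (U * H) :=
  [set p | [/\ C p.2, BV Omega p.2 & state_eq p.1 p.2]].

Variables (wl wu : 'rV[R]_d -> R) (N : nat) (Q : 'I_N -> set 'rV[R]_d).

Definition averaged_eq (u : U) (w : 'rV[R]_d -> R) :=
  solves u (fun x => cell_average Q (emb u) x * cell_average Q w x).

Variables (ulc uuc wlc wuc : 'I_N -> R).

Definition mccormick_feasible : set (U * H * 'rV[R]_N) :=
  [set p : U * H * 'rV[R]_N | let: (u, w, z) := p in
    let Pu := cell_average Q (emb u) in
    let Pw := cell_average Q w in
    [/\ C w, ae_le Omega wl w, ae_le Omega w wu,
        solves u (fun x => \sum_(i < N) z 0 i * \1_(Q i) x) &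
        forall i x, Q i x ->
          [/\ ulc i * Pw x + Pu x * wlc i - ulc i * wlc i <= z 0 i,
              uuc i * Pw x + Pu x * wuc i - uuc i * wuc i <= z 0 i,
              z 0 i <= uuc i * Pw x + Pu x * wlc i - uuc i * wlc i,
              z 0 i <= ulc i * Pw x + Pu x * wuc i - ulc i * wuc i &
              ulc i <= Pu x <= uuc i]]].

Definition mccormick_objective (p : U * H * 'rV[R]_N) : \bar R := objective p.1.

End problems.

Definition lipschitz_fst (R : realType) (U H : normedModType R)
    (j : U * H -> R^o) (S : set (U * H)) (L : R) :=
  0 <= L /\ forall u1 u2 w, S (u1, w) -> S (u2, w) ->
    `|j (u1, w) - j (u2, w)| <= L * `|u1 - u2|.

(* Main.v *)
Require Import Defs.
From HB Require Import structures.
From mathcomp Require Import all_boot all_order all_algebra.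
From mathcomp Require Import all_classical all_reals all_analysis.
From mathcomp Require Import measurable_realfun ess_sup_inf.
From mathcomp Require Import ring lra.

Set Implicit Arguments.
Unset Strict Implicit.
Unset Printing Implicit Defensive.

Import Order.TTheory GRing.Theory Num.Theory.
Import numFieldNormedType.Exports.

Local Open Scope classical_set_scope.
Local Open Scope ring_scope.


(** The relaxed problem is convex because the bilinear term, the only nonlinear
    expression in the constraints, is replaced by free numbers [z], one per
    cell. The equation then determines the state as an affine function of [z]
    ([relaxed_state]), and what remains are affine inequalities and [C w].
    The inequalities squeeze [z] between affine expressions in the mean values
    of state and control, and these means are bounded, so that the feasible set
    is bounded ([mccormick_norm_le]).

    A pair that is feasible for the original problem yields a point that is
    feasible for the relaxation: the control is kept, the state is replaced by
    the solution of the averaged equation, and [z] is the vector of products of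
    the means. Each inequality expands a product of two nonnegative distances
    to the bounds ([envelope_mul]). As the control is the same, the variations
    cancel in the difference of the objectives and only the Lipschitz estimate
    of [j] is left ([objective_diff]); the inequality between the infima
    follows. A Lipschitz constant exists as both feasible sets are bounded; the
    states of the original problem are bounded because the product of state and
    control is dominated by a fixed square-integrable function
    ([ocp_norm_le]).

    A minimizer is found by the direct method ([mccormick_minimizer]). Along a
    minimizing sequence the controls are bounded almost everywhere and have
    bounded variation. The heart of the matter is that such controls have a
    subsequence that converges strongly in [L^2] ([BV_compact]): then the means
    converge, [C] and the bounds pass to the limit, [j] is continuous, and the
    variation is lower semicontinuous as a supremum of continuous functionals.

    The compactness is proved by hand on boxes. Testing the variation with a
    field along direction [i], whose divergence approximates opposite
    constants on the two halves of a box, shows that the integrals over the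
    halves differ by at most [2 * s_i] times the variation on the box, where
    [s_i] is the length of the side that is cut ([diff_halves_le_TV]). Iterated
    halvings keep the sum of the variations below the variation on the initial
    box, while the sides shrink geometrically; the sum of the absolute
    integrals over the cells therefore exceeds the absolute integral over the
    box by at most four times the sum of the sides times the variation
    ([sum_cells_le_TV]). Since the sign of a function is approximated by step
    functions on fine cells, the same bound holds for the norm in [L^1]
    ([poincare_box]). Applied on every cell of a fine subdivision, it bounds
    this norm by finitely many integrals plus a small multiple of the variation
    ([L1_le_integrals_TV]). Finitely many integrals for each of countably many
    accuracies converge along a common subsequence, which is thus Cauchy in
    [L^1]; a further subsequence converges almost everywhere, and the uniform
    bound upgrades this to [L^2] by dominated convergence. *)

(** * Boxes *)

Section boxes.
Context {R : realType} {d : nat}.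
Local Notation V := 'rV[R]_d.
Local Notation leb := (lebesgue_rV R d).
Implicit Types (a s : V) (i : 'I_d).

Definition open_box (a s : V) : set V :=
  [set x | forall l, a 0 l < x 0 l < a 0 l + s 0 l].

Definition closed_box (a s : V) : set V :=
  [set x | forall l, a 0 l <= x 0 l <= a 0 l + s 0 l].

Definition halve (i : 'I_d) (s : V) : V :=
  \row_l (if l == i then s 0 l / 2 else s 0 l).

Definition midpoint (i : 'I_d) (a s : V) : V :=
  \row_l (if l == i then a 0 l + s 0 l / 2 else a 0 l).

Lemma open_boxE a s : open_box a s =
  \bigcap_(l in [set: 'I_d]) ((fun x : V => x 0 l) @^-1` `]a 0 l, a 0 l + s 0 l[).
Proof.
apply/seteqP; split=> [t Bt i _|t Bt i]; first by rewrite /= in_itv /=.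
by have := Bt i I; rewrite /= in_itv.
Qed.

Lemma closed_boxE a s : closed_box a s =
  \bigcap_(l in [set: 'I_d]) ((fun x : V => x 0 l) @^-1` `[a 0 l, a 0 l + s 0 l]).
Proof.
apply/seteqP; split=> [t Bt i _|t Bt i]; first by rewrite /= in_itv /=.
by have := Bt i I; rewrite /= in_itv.
Qed.

Lemma sub_open_closed_box a s : open_box a s `<=` closed_box a s.
Proof. by move=> x xB l; have /andP[/ltW -> /ltW ->] := xB l. Qed.

Lemma measurable_open_box a s : measurable (open_box a s).
Proof.
rewrite open_boxE; apply: fin_bigcap_measurable => // i _.
by rewrite -[X in measurable X]setTI; exact: (measurable_coord i).
Qed.

Lemma measurable_closed_box a s : measurable (closed_box a s).
Proof.
rewrite closed_boxE; apply: fin_bigcap_measurable => // i _.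
by rewrite -[X in measurable X]setTI; exact: (measurable_coord i).
Qed.
Hint Resolve measurable_open_box measurable_closed_box : core.

Lemma lebesgue_closed_box (a s : V) : (forall l, 0 <= s 0 l) ->
  leb (closed_box a s) = (\prod_(l < d) s 0 l)%:E.
Proof.
move=> s0.
have -> : closed_box a s = [set x | forall l, a 0 l <= x 0 l <= (a + s) 0 l].
  by apply/seteqP; split=> x /= xB l; have := xB l; rewrite !mxE.
rewrite lebesgue_rV_box => [|l]; last by rewrite !mxE lerDl.
by congr EFin; apply: eq_bigr => l _; rewrite !mxE; ring.
Qed.

Lemma lebesgue_open_box_lty a s : (forall l, 0 <= s 0 l) ->
  (leb (open_box a s) < +oo)%E.
Proof.
move=> s0; apply: (@le_lt_trans _ _ (leb (closed_box a s))).
  by apply: le_measure; rewrite ?inE//; exact: sub_open_closed_box.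
by rewrite lebesgue_closed_box// ltry.
Qed.

Lemma bounded_lebesgue_lty (A : set V) : measurable A -> bounded_set A ->
  (leb A < +oo)%E.
Proof.
move=> mA [M [Mr AM]].
pose r := `|M| + 1.
have rM : M < r by rewrite /r (le_lt_trans (ler_norm _))// ltrDl.
have r0 : 0 <= r by rewrite /r addr_ge0.
pose B := closed_box (\row__ (- r)) (\row__ (2 * r)).
apply: (@le_lt_trans _ _ (leb B)); last first.
  by rewrite lebesgue_closed_box ?ltry// => l; rewrite mxE mulr_ge0.
apply: le_measure; rewrite ?inE//; first exact: measurable_closed_box.
move=> x /(AM _ rM) xr l; rewrite !mxE.
have : `|x 0 l| <= r.
  apply: le_trans xr; rewrite /Num.Def.normr /= mx_normrE.
  exact: (le_bigmax _ (fun ij => `|x ij.1 ij.2|) (0, l)).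
by rewrite ler_norml; lra.
Qed.

(** The face is contained in a closed box with one side of length zero. *)
Lemma null_face (a s : V) i c : (forall l, 0 <= s 0 l) ->
  leb.-negligible (closed_box a s `&` [set x | x 0 i = c]).
Proof.
move=> s0.
pose a' : V := \row_l (if l == i then c else a 0 l).
pose s' : V := \row_l (if l == i then 0 else s 0 l).
apply: (@negligibleS _ _ _ _ (closed_box a' s')).
  move=> x [xB /= xc] l; rewrite !mxE; case: eqP => [->|_]; last exact: xB.
  by rewrite xc addr0 lexx.
apply/negligibleP => //; apply: etrans (lebesgue_closed_box _ _) _.
  by move=> l; rewrite mxE; case: ifP.
by rewrite (bigD1 i)//= mxE eqxx mul0r.
Qed.

Lemma negligible_bigcup_fin (I : finType) (F : I -> set V) :
  (forall k, leb.-negligible (F k)) -> leb.-negligible (\bigcup_k F k).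
Proof.
move=> F0; have -> : \bigcup_k F k = \big[setU/set0]_(k <- enum I) F k.
  rewrite -bigcup_seq; apply/seteqP; split=> x [k _ Fk]; exists k => //=.
  by rewrite mem_enum.
by elim/big_ind: _ => //; [exact: negligible_set0|exact: negligibleU].
Qed.

Lemma null_box_boundary (a s : V) : (forall l, 0 <= s 0 l) ->
  leb.-negligible (closed_box a s `\` open_box a s).
Proof.
move=> s0; pose F (l : 'I_d) := closed_box a s `&` [set x | x 0 l = a 0 l] `|`
   closed_box a s `&` [set x | x 0 l = a 0 l + s 0 l].
apply: (@negligibleS _ _ _ _ (\bigcup_l F l)); last first.
  by apply: negligible_bigcup_fin => l; apply: negligibleU; exact: null_face.
move=> x [xB nB].
have [l /negP] : exists l, ~ (a 0 l < x 0 l < a 0 l + s 0 l) by exact/existsNP.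
rewrite negb_and -!leNgt => xl; exists l => //; have /andP[l1 l2] := xB l.
case/orP: xl => xl; [left|right]; split=> //=; apply/eqP; rewrite eq_le.
  by rewrite l1 xl.
by rewrite l2 xl.
Qed.

(** A partition up to a null set is enough: halving an open box loses the
    hyperplane between the halves. *)
Lemma Rintegral_split (D A B : set V) (g : V -> R) :
  measurable D -> measurable A -> measurable B ->
  A `<=` D -> B `<=` D -> A `&` B = set0 ->
  leb.-negligible (D `\` (A `|` B)) -> leb.-integrable D (EFin \o g) ->
  \int[leb]_(x in D) g x = \int[leb]_(x in A) g x + \int[leb]_(x in B) g x.
Proof.
move=> mD mA mB AD BD AB0 N0 ig.
have mN : measurable (D `\` (A `|` B)) by apply: measurableD => //; exact: measurableU.
have DE : D `\` (D `\` (A `|` B)) = A `|` B.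
  by rewrite setDD setIidr// => x [/AD|/BD].
rewrite {1}/Rintegral (negligible_integral mN mD ig (measure_negligible mN N0)) DE.
rewrite -/(Rintegral _ _ _) Rintegral_setU//.
  by apply: integrableS ig => //; [exact: measurableU|move=> x [/AD|/BD]].
by apply/disj_setPS; rewrite AB0.
Qed.

Section halving.
Variables (i : 'I_d) (a s : V).
Hypothesis s0 : forall l, 0 <= s 0 l.

Lemma sub_lower_half : open_box a (halve i s) `<=` open_box a s.
Proof.
move=> x xB l; have := xB l; have := s0 l; rewrite !mxE; case: ifP => // _.
by lra.
Qed.

Lemma sub_upper_half : open_box (midpoint i a s) (halve i s) `<=` open_box a s.
Proof.
move=> x xB l; have := xB l; have := s0 l; rewrite !mxE; case: ifP => // _.
by lra.
Qed.

Lemma disjoint_halves :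
  open_box a (halve i s) `&` open_box (midpoint i a s) (halve i s) = set0.
Proof.
apply/seteqP; split=> // x [/(_ i) + /(_ i)]; rewrite !mxE eqxx.
by move=> /andP[_ h1] /andP[h2 _]; have := lt_trans h1 h2; rewrite ltxx.
Qed.

Lemma null_between_halves : leb.-negligible (open_box a s `\`
  (open_box a (halve i s) `|` open_box (midpoint i a s) (halve i s))).
Proof.
apply: (negligibleS _ (null_face a i (a 0 i + s 0 i / 2) s0)) => x [xB nx].
split; first exact: sub_open_closed_box.
apply: contrapT => /= /eqP; rewrite neq_lt => /orP[xi|xi]; apply: nx.
  left=> l; have := xB l; rewrite !mxE; case: eqP => // ->.
  by rewrite xi andbT => /andP[].
right=> l; have := xB l; rewrite !mxE; case: eqP => // ->.
by rewrite xi /=; lra.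
Qed.

Lemma Rintegral_halves (g : V -> R) :
  leb.-integrable (open_box a s) (EFin \o g) ->
  \int[leb]_(x in open_box a s) g x =
  \int[leb]_(x in open_box a (halve i s)) g x +
  \int[leb]_(x in open_box (midpoint i a s) (halve i s)) g x.
Proof.
move=> ig; apply: Rintegral_split => //; [exact: sub_lower_half|
  exact: sub_upper_half|exact: disjoint_halves|exact: null_between_halves].
Qed.

End halving.

End boxes.
#[global] Hint Resolve measurable_open_box measurable_closed_box : core.

(** * Continuously differentiable functions *)

Section continuously_differentiable.
Context {R : realType} {V : normedModType R}.
Implicit Types f g : V -> R.

Definition C1 (W : normedModType R) (f : V -> W) :=
  (forall x, differentiable f x) /\ forall v, continuous ('D_v f).

Lemma C1_cst (c : R) : C1 (fun=> c : R).
Proof.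
split=> [x|v]; first exact: differentiable_cst.
have -> : 'D_v (fun=> c : R) = (fun _ : V => 0 : R).
  by apply/funext => x; exact: derive_cst.
by move=> x; exact: cst_continuous.
Qed.

Lemma C1_id : C1 (id : V -> V).
Proof.
split=> [x|v]; first by have [] := is_diff_id x.
by rewrite (_ : 'D_v id = cst v)//; first exact: cst_continuous;
  apply/funext => x; exact: derive_id.
Qed.

Lemma C1_add f g : C1 f -> C1 g -> C1 (fun x => f x + g x).
Proof.
move=> [df cf] [dg cg]; split=> [x|v]; first exact: differentiableD.
have -> : 'D_v (fun x => f x + g x) = (fun x => 'D_v f x + 'D_v g x).
  by apply/funext => x; apply: deriveD; exact: diff_derivable.
by move=> x; apply: cvgD; [exact: cf|exact: cg].
Qed.

Lemma C1_mul f g : C1 f -> C1 g -> C1 (fun x => f x * g x).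
Proof.
move=> [df cf] [dg cg]; split=> [x|v]; first exact: differentiableM.
have -> : 'D_v (fun x => f x * g x) = (fun x => f x * 'D_v g x + g x * 'D_v f x).
  by apply/funext => x; apply: deriveM; exact: diff_derivable.
move=> x; apply: cvgD; apply: cvgM; [|exact: cg| |exact: cf];
  exact: differentiable_continuous.
Qed.

Lemma C1_prod (I : Type) (s : seq I) (F : I -> V -> R) :
  (forall i, C1 (F i)) -> C1 (fun x => \prod_(i <- s) F i x).
Proof.
move=> CF; elim: s => [|i s IHs].
  by under eq_fun do rewrite big_nil; exact: C1_cst.
by under eq_fun do rewrite big_cons; exact: C1_mul.
Qed.

Lemma diff_realE (phi : R -> R) y u : 'd phi y u = u * 'd phi y 1.
Proof.
transitivity ('d phi y (u *: (1 : R))); last exact: linearZ.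
by congr ('d _ _ _); rewrite /GRing.scale/= mulr1.
Qed.

Lemma derive_comp_real f (phi : R -> R) x v : differentiable f x ->
  differentiable phi (f x) ->
  'D_v (fun y => phi (f y)) x = 'D_1 phi (f x) * 'D_v f x.
Proof.
move=> df dphi.
rewrite deriveE; last exact: (differentiable_comp df dphi).
rewrite (diff_comp df dphi) /=.
by rewrite diff_realE mulrC (deriveE _ dphi) (deriveE _ df).
Qed.

Lemma C1_scale f (W : normedModType R) (c : W) : C1 f ->
  C1 (fun x => f x *: c) /\ forall v x, 'D_v (fun x => f x *: c) x = 'D_v f x *: c.
Proof.
move=> [df cf].
have dfc x : differentiable (fun x => f x *: c) x by exact: differentiableZl.
have E v x : 'D_v (fun x => f x *: c) x = 'D_v f x *: c.
  by rewrite !deriveE// diffZl.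
split=> //; split=> // v; rewrite (funext (E v)) => x.
by apply: cvgZr_tmp; exact: cf.
Qed.

End continuously_differentiable.

Lemma C1_comp {R : realType} {V : normedModType R} (f : V -> R) (phi : R -> R) :
  C1 f -> C1 phi -> C1 (fun x => phi (f x)).
Proof.
move=> [df cf] [dphi cphi]; split=> [x|v]; first exact: differentiable_comp.
have -> : 'D_v (fun x => phi (f x)) = (fun x => 'D_1 phi (f x) * 'D_v f x).
  by apply/funext => x; exact: derive_comp_real.
move=> x; apply: cvgM; last exact: cf.
have cfx : {for x, continuous f} := differentiable_continuous (df x).
by have := @continuous_comp _ _ _ f ('D_1 phi) x cfx (@cphi 1 (f x)); apply.
Qed.

Section positive_square.
Context {R : realType}.
Implicit Types x t : R.

(** The positive part squared: continuously differentiable, it is the brick of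
    all the cut-off functions below. *)
Definition possq x : R := Num.max 0 x ^+ 2.

(** A second-order remainder that is uniform across the kink of the positive
    part; it gives the derivative without a case distinction at the origin. *)
Lemma possq_taylor x t :
  `|possq (t + x) - possq x - 2 * Num.max 0 x * t| <= t ^+ 2.
Proof.
rewrite /possq ler_norml.
by have [h1|h1] := leP 0 (t + x); have [h2|h2] := leP 0 x;
  apply/andP; split; nra.
Qed.

Lemma is_derive_possq x : is_derive x 1 possq (2 * Num.max 0 x).
Proof.
suff cv : t^-1 *: (possq (t *: 1 + x) - possq x) @[t --> (0:R)^'] --> 2 * Num.max 0 x.
  by split; [apply/cvg_ex; eexists; exact: cv|exact: cvg_lim cv].
apply/cvgrPdist_le => e e0; near=> t.
have t0 : t != 0 by near: t; exact: nbhs_dnbhs_neq.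
have te : `|t| <= e.
  by near: t; apply: dnbhs0_le.
rewrite distrC (le_trans _ te)//.
rewrite -(ler_pM2l (x := `|t|)) ?normr_gt0// -normrM -expr2 real_normK ?num_real//.
apply: le_trans (possq_taylor x t); rewrite le_eqVlt; apply/orP; left; apply/eqP.
by rewrite /GRing.scale/= mulr1; congr `| _ |; field.
Unshelve. all: by end_near. Qed.

Lemma derive_possq : 'D_1 possq = (fun x => 2 * Num.max 0 x).
Proof. by apply/funext => x; have [_] := is_derive_possq x. Qed.

Lemma continuous_max0 : continuous (Num.max 0 : R -> R).
Proof. by move=> x; apply: continuous_max; [exact: cst_continuous|]. Qed.

Lemma C1_possq : C1 possq.
Proof.
split=> [x|v]; first by apply/derivable1_diffP; have [] := is_derive_possq x.
have -> : 'D_v possq = (fun x => v * (2 * Num.max 0 x)).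
  apply/funext => x; have dp : differentiable possq x.
    by apply/derivable1_diffP; have [] := is_derive_possq x.
  rewrite (deriveE _ dp) diff_realE; congr (_ * _).
  by have := derive_possq; rewrite funeqE => /(_ x) <-; rewrite (deriveE _ dp).
move=> x; apply: cvgM; first exact: cvg_cst.
by apply: cvgM; [exact: cvg_cst|exact: continuous_max0].
Qed.

End positive_square.

(** * One-dimensional cut-off functions *)

Section cutoffs.
Context {R : realType}.
Implicit Types x y e : R.

Lemma possq_ge0 x : 0 <= possq x. Proof. exact: sqr_ge0. Qed.

Lemma possq_neg x : x <= 0 -> possq x = 0.
Proof. by move=> x0; rewrite /possq max_l// expr0n. Qed.

Lemma possq_pos x : 0 <= x -> possq x = x ^+ 2.
Proof. by move=> x0; rewrite /possq max_r. Qed.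

(** The inner positive part makes the step flat at [1], the outer one at [0]. *)
Definition smooth_step x : R := possq (1 - possq (1 - x)).

Lemma smooth_step_ge0 x : 0 <= smooth_step x. Proof. exact: possq_ge0. Qed.

Lemma smooth_step_le1 x : smooth_step x <= 1.
Proof.
rewrite /smooth_step; have := possq_ge0 (1 - x); set p := possq (1 - x) => p0.
have [p1|p1] := leP p 1; last by rewrite possq_neg// subr_le0 ltW.
by rewrite possq_pos ?subr_ge0// expr_le1// ?subr_ge0// gerBl.
Qed.

Lemma smooth_step_neg x : x <= 0 -> smooth_step x = 0.
Proof.
by move=> x0; rewrite /smooth_step possq_neg// possq_pos; nra.
Qed.

Lemma smooth_step1 x : 1 <= x -> smooth_step x = 1.
Proof.
move=> x1; rewrite /smooth_step (@possq_neg (1 - x)) ?subr_le0//.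
by rewrite subr0 possq_pos// expr1n.
Qed.

Lemma C1_affine (c b : R) : C1 (fun x : R => c * x + b).
Proof.
apply: C1_add; last exact: C1_cst.
by apply: C1_mul; [exact: C1_cst|exact: C1_id].
Qed.

Lemma C1_smooth_step : C1 smooth_step.
Proof.
apply: (C1_comp (f := fun x => 1 - possq (1 - x)) _ C1_possq).
have -> : (fun x => 1 - possq (1 - x)) = (fun x => 1 + -1 * possq ((-1) * x + 1)).
  by apply/funext => x; rewrite mulN1r (mulN1r x) (addrC (- x)).
apply: C1_add; first exact: C1_cst.
apply: C1_mul; first exact: C1_cst.
by apply: C1_comp C1_possq; exact: C1_affine.
Qed.

(** A plateau over the unit interval, vanishing near both ends. *)
Definition bump e y : R := smooth_step (y / e - 1) * smooth_step ((1 - y) / e - 1).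

Lemma C1_bump e : C1 (bump e).
Proof.
apply: C1_mul.
  have -> : (fun y => smooth_step (y / e - 1)) =
      (fun y => smooth_step (e^-1 * y + - 1)).
    by apply/funext => y; rewrite mulrC.
  by apply: C1_comp C1_smooth_step; exact: C1_affine.
have -> : (fun y => smooth_step ((1 - y) / e - 1)) =
    (fun y => smooth_step ((- e^-1) * y + (e^-1 - 1))).
  by apply/funext => y; congr smooth_step; ring.
by apply: C1_comp C1_smooth_step; exact: C1_affine.
Qed.

Lemma bump_ge0 e y : 0 <= bump e y.
Proof. by rewrite mulr_ge0// smooth_step_ge0. Qed.

Lemma bump_le1 e y : bump e y <= 1.
Proof. by rewrite mulr_ile1// ?smooth_step_ge0// smooth_step_le1. Qed.

Lemma bump_support e y : 0 < e -> ~~ (e < y < 1 - e) -> bump e y = 0.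
Proof.
move=> e0; rewrite negb_and -!leNgt => /orP[ye|ye]; rewrite /bump.
  rewrite smooth_step_neg ?mul0r// subr_le0.
  by rewrite ler_pdivrMr// mul1r.
rewrite (@smooth_step_neg ((1 - y) / e - 1)) ?mulr0// subr_le0.
by rewrite ler_pdivrMr// mul1r; lra.
Qed.

Lemma bump_plateau e y : 0 < e -> 2 * e <= y <= 1 - 2 * e -> bump e y = 1.
Proof.
move=> e0 /andP[h1 h2]; rewrite /bump !smooth_step1 ?mulr1//.
  by rewrite lerBrDr ler_pdivlMr//; lra.
by rewrite lerBrDr ler_pdivlMr//; lra.
Qed.

(** A convex ramp: zero on the left, of slope one from [e] on, where the
    quadratic terms cancel. *)
Definition ramp e x : R := e / 2 * (possq (x / e) - possq (x / e - 1)).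

Definition ramp_slope e x : R := Num.max 0 (x / e) - Num.max 0 (x / e - 1).

Lemma ramp_neg e x : 0 < e -> x <= 0 -> ramp e x = 0.
Proof.
move=> e0 x0; have xe : x / e <= 0 by rewrite ler_pdivrMr// mul0r.
by rewrite /ramp !possq_neg ?subrr ?mulr0//; lra.
Qed.

Lemma ramp_pos e x : 0 < e -> e <= x -> ramp e x = x - e / 2.
Proof.
move=> e0 ex; have xe : 1 <= x / e by rewrite ler_pdivlMr// mul1r.
rewrite /ramp !possq_pos; [|lra|lra].
by field; rewrite gt_eqF.
Qed.

Lemma ramp_ge0 e x : 0 < e -> 0 <= ramp e x.
Proof.
move=> e0; rewrite /ramp mulr_ge0//; first by rewrite divr_ge0// ltW.
rewrite subr_ge0.
set y := x / e; have [y1|y1] := leP y 1.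
  by rewrite (@possq_neg (y - 1)) ?possq_ge0// subr_le0.
by rewrite !possq_pos; nra.
Qed.

Lemma ramp_le e x : 0 < e -> 0 <= x -> ramp e x <= x.
Proof.
move=> e0 x0; have [ex|xe] := leP e x; first by rewrite ramp_pos//; lra.
rewrite /ramp (@possq_neg (x / e - 1)) ?subr0; last first.
  by rewrite subr_le0 ler_pdivrMr// mul1r ltW.
rewrite possq_pos; last by rewrite divr_ge0// ltW.
have -> : e / 2 * (x / e) ^+ 2 = x * (x / e / 2) by field; rewrite gt_eqF.
rewrite ler_piMr// ler_pdivrMr// ler_pdivrMr//; nra.
Qed.

Lemma ramp_slope_ge0 e x : 0 <= ramp_slope e x.
Proof.
by rewrite /ramp_slope; set y := x / e; have [|] := leP 0 y;
  have [|] := leP 0 (y - 1); lra.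
Qed.

Lemma ramp_slope_le1 e x : ramp_slope e x <= 1.
Proof.
by rewrite /ramp_slope; set y := x / e; have [|] := leP 0 y;
  have [|] := leP 0 (y - 1); lra.
Qed.

Lemma ramp_slope_neg e x : 0 < e -> x <= 0 -> ramp_slope e x = 0.
Proof.
move=> e0 x0; have xe : x / e <= 0 by rewrite ler_pdivrMr// mul0r.
by rewrite /ramp_slope !max_l ?subrr//; lra.
Qed.

Lemma ramp_slope_pos e x : 0 < e -> e <= x -> ramp_slope e x = 1.
Proof.
move=> e0 ex; have xe : 1 <= x / e by rewrite ler_pdivlMr// mul1r.
by rewrite /ramp_slope !max_r; lra.
Qed.

Lemma C1_ramp e b : C1 (fun x => ramp e (x + b)).
Proof.
apply: C1_mul; first exact: C1_cst.
have -> : (fun x => possq ((x + b) / e) - possq ((x + b) / e - 1)) =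
   (fun x => possq (e^-1 * x + b / e) + (-1) * possq (e^-1 * x + (b / e - 1))).
  apply/funext => x; rewrite mulN1r; congr (possq _ - possq _); ring.
apply: C1_add; first by apply: C1_comp C1_possq; exact: C1_affine.
apply: C1_mul; first exact: C1_cst.
by apply: C1_comp C1_possq; exact: C1_affine.
Qed.

Lemma derive_ramp e b x : e != 0 ->
  'D_1 (fun x => ramp e (x + b)) x = ramp_slope e (x + b).
Proof.
move=> e0.
have H c : is_derive x 1 (fun x => possq ((x + b) / e - c))
    (2 * Num.max 0 ((x + b) / e - c) * e^-1).
  have dp : differentiable possq ((x + b) / e - c).
    by have [] := @C1_possq R.
  have da : is_derive x 1 (fun x : R => (x + b) / e - c) (e^-1).
    have -> : (fun x : R => (x + b) / e - c) = (fun x : R => e^-1 * x + (b / e - c)).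
      by apply/funext => y; ring.
    by apply: is_derive_eq; rewrite addr0 /GRing.scale/= mulr1 .
  have df : differentiable (fun x : R => (x + b) / e - c) x.
    by apply/derivable1_diffP; have [] := da.
  split.
    apply: diff_derivable.
    apply: (@differentiable_comp _ _ _ _ (fun x : R => (x + b) / e - c) possq x df dp).
  rewrite (derive_comp_real (1 : R) df dp); congr (_ * _).
    by have [_] := is_derive_possq ((x + b) / e - c).
  by have [] := da.
have H0 := H 0; have H1 := H 1.
have E : (fun x => ramp e (x + b)) =
  (fun x => e / 2 * (possq ((x + b) / e - 0) - possq ((x + b) / e - 1))).
  by apply/funext => y; rewrite subr0.
rewrite E.
have [_ ->] : is_derive x 1 (fun x => e / 2 * (possq ((x + b) / e - 0) -
    possq ((x + b) / e - 1))) (ramp_slope e (x + b)).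
  apply: is_derive_eq; rewrite /ramp_slope /GRing.scale/= !subr0.
  by field.
by [].
Qed.

(** A tent over the unit interval, vanishing near both ends; its slope tends to
    one on the left half and to minus one on the right half. *)
Definition tent e y : R :=
  ramp e (y - 2 * e) + (-2) * ramp e (y - 2^-1) + ramp e (y + (2 * e - 1)).

Definition tent_slope e y : R :=
  ramp_slope e (y - 2 * e) + (-2) * ramp_slope e (y - 2^-1)
  + ramp_slope e (y + (2 * e - 1)).

Lemma C1_tent e : C1 (tent e).
Proof.
apply: C1_add; last exact: C1_ramp.
apply: C1_add; first exact: C1_ramp.
by apply: C1_mul; [exact: C1_cst|exact: C1_ramp].
Qed.

Lemma derive_tent e y : e != 0 -> 'D_1 (tent e) y = tent_slope e y.
Proof.
move=> e0.
have D b : is_derive y 1 (fun x => ramp e (x + b)) (ramp_slope e (y + b)).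
  rewrite -derive_ramp//; apply/derivableP/diff_derivable.
  by have [] := C1_ramp e b.
have D1 := D (- (2 * e)); have D2 := D (- 2^-1); have D3 := D (2 * e - 1).
have [_ ->] : is_derive y 1 (tent e) (tent_slope e y).
  by apply: is_derive_eq; rewrite /tent_slope /GRing.scale/=; ring.
by [].
Qed.

Lemma tent_support e y : 0 < e <= 4^-1 -> ~~ (e < y < 1 - e) -> tent e y = 0.
Proof.
move=> /andP[e0 e4]; rewrite negb_and -!leNgt => /orP[ye|ye]; rewrite /tent.
  by rewrite !ramp_neg//; lra.
by rewrite !ramp_pos//; lra.
Qed.

Lemma tent_bounded e y : 0 < e <= 4^-1 -> `|tent e y| <= 2.
Proof.
move=> /[dup] /andP[e0 e4] ee.
have [/andP[y0 y1]|/(tent_support ee) ->] := boolP (e < y < 1 - e); last first.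
  by rewrite normr0.
have B x : x <= 1 -> 0 <= ramp e x <= 1.
  move=> x1; rewrite ramp_ge0//=; have [x0|x0] := leP 0 x.
    by rewrite (le_trans (ramp_le e0 x0)).
  by rewrite ramp_neg// ltW.
have /andP[h1 h2] : 0 <= ramp e (y - 2 * e) <= 1 by apply: B; lra.
have /andP[h3 h4] : 0 <= ramp e (y + (2 * e - 1)) <= 1 by apply: B; lra.
have h5 : ramp e (y - 2^-1) <= 2^-1.
  have [x0|x0] := leP 0 (y - 2^-1).
    by rewrite (le_trans (ramp_le e0 x0))//; lra.
  by rewrite ramp_neg//; lra.
have h6 := ramp_ge0 (y - 2^-1) e0.
by rewrite ler_norml /tent; lra.
Qed.

Lemma tent_slope_bounded e y : `|tent_slope e y| <= 2.
Proof.
have B x := ramp_slope_ge0 e x; have B' x := ramp_slope_le1 e x.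
have := B (y - 2 * e); have := B (y - 2^-1); have := B (y + (2 * e - 1)).
have := B' (y - 2 * e); have := B' (y - 2^-1); have := B' (y + (2 * e - 1)).
by rewrite ler_norml /tent_slope; lra.
Qed.

Lemma tent_slope_left e y : 0 < e <= 4^-1 -> 3 * e <= y <= 2^-1 -> tent_slope e y = 1.
Proof.
move=> /andP[e0 e4] /andP[h1 h2]; rewrite /tent_slope.
rewrite ramp_slope_pos//; last lra.
by rewrite !ramp_slope_neg//; lra.
Qed.

Lemma tent_slope_right e y : 0 < e -> 3 * e <= y -> 2^-1 + e <= y <= 1 - 2 * e ->
  tent_slope e y = -1.
Proof.
move=> e0 h /andP[h1 h2]; rewrite /tent_slope.
rewrite (ramp_slope_pos (x := y - 2 * e))//; last lra.
rewrite (ramp_slope_pos (x := y - 2^-1))//; last lra.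
by rewrite ramp_slope_neg//; lra.
Qed.

End cutoffs.

(** * Test fields *)

Section test_fields.
Context {R : realType} {d : nat}.
Local Notation V := 'rV[R]_d.
Local Notation leb := (lebesgue_rV R d).
Implicit Types (D E : set V) (phi psi : V -> V) (w : V -> R).

Lemma C1_coord (l : 'I_d) : C1 (fun x : V => x 0 l) /\
  forall v x, 'D_v (fun x : V => x 0 l) x = v 0 l.
Proof.
have E v x : 'D_v (fun x : V => x 0 l) x = v 0 l.
  have dx : derivable (id : V -> V) x v by exact: derivable_id.
  have := derive_mx dx.
  by move=> /matrixP/(_ 0 l); rewrite derive_id mxE.
split=> //; split=> [x|v]; first exact: differentiable_coord.
by rewrite (funext (E v)); exact: cst_continuous.
Qed.

Lemma continuous_measurable_rV (g : V -> R) : continuous g -> measurable_fun setT g.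
Proof.
move=> cg; apply: (measurability _ (RGenOpens.measurableE R)).
move=> _ [_ [a [b ->] <-]]; rewrite setTI; apply: open_measurable_rV.
by apply: open_comp; [move=> x _; exact: cg|exact: interval_open].
Qed.

Lemma continuous_divergence D phi : test_field D phi -> continuous (divergence phi).
Proof.
move=> [dphi cphi _ _]; rewrite /divergence.
apply: continuous_big => [|i _ x]; first exact: add_continuous.
have := @continuous_comp _ _ _ ('D_(delta_mx 0 i) phi) (fun x : V => x 0 i) x
  (@cphi _ x) (@coord_continuous _ _ _ _ _ _).
by apply.
Qed.

Lemma divergence_off_support phi x (K : set V) : compact K ->
  (forall y, ~ K y -> phi y = 0) -> ~ K x -> divergence phi x = 0.
Proof.
move=> cK K0 Kx; rewrite /divergence big1// => i _.
have oK : open (~` K) by apply: closed_openC; exact: compact_closed.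
rewrite (_ : 'D_(delta_mx 0 i) phi x = 0) ?mxE//.
rewrite (@near_eq_derive _ _ _ phi (cst 0)) ?derive_cst//.
by apply: filterS (open_nbhs_nbhs (conj oK Kx)) => y /K0.
Qed.

End test_fields.

(** * A test field for the two halves of a box *)

Section box_field.
Context {R : realType} {d : nat}.
Local Notation V := 'rV[R]_d.
Local Notation leb := (lebesgue_rV R d).
Variables (i : 'I_d) (a s : V).
Hypothesis s_gt0 : forall l, 0 < s 0 l.
Implicit Types (x : V) (e : R).

Definition box_coord (l : 'I_d) x : R := (x 0 l - a 0 l) / s 0 l.

Definition box_profile e (l : 'I_d) : R -> R := if l == i then tent e else bump e.

Definition box_potential e x : R := \prod_l box_profile e l (box_coord l x).

(** A field along direction [i], whose divergence tends to a multiple of the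
    difference of the indicators of the two halves of the box. The potential
    is a tent in direction [i] and a plateau in the others; the factor [2^-1]
    compensates the bound on the tent. *)
Definition box_field e x : V := (2^-1 * box_potential e x) *: delta_mx 0 i.

Lemma C1_box_coord l : C1 (box_coord l) /\
  forall v x, 'D_v (box_coord l) x = v 0 l / s 0 l.
Proof.
have [Cl Dl] := @C1_coord R d l.
have E : box_coord l = (fun x => (s 0 l)^-1 * x 0 l + - a 0 l / s 0 l).
  by apply/funext => x; rewrite /box_coord; ring.
rewrite E; split; first by apply: C1_add; [apply: C1_mul => //|]; exact: C1_cst.
move=> v x; have [_ ->] : is_derive x v
    (fun x : V => (s 0 l)^-1 * x 0 l + - a 0 l / s 0 l) ((s 0 l)^-1 * v 0 l + 0).
  apply: is_deriveD.
  apply: is_deriveZ; apply: DeriveDef; last exact: Dl.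
  by apply: diff_derivable; have [] := Cl.
by rewrite addr0 mulrC.
Qed.

Lemma C1_box_profile e l : C1 (box_profile e l).
Proof. by rewrite /box_profile; case: ifP => _; [exact: C1_tent|exact: C1_bump]. Qed.

Lemma C1_box_potential e : C1 (box_potential e).
Proof.
apply: C1_prod => l; apply: C1_comp (C1_box_profile e l).
by have [] := C1_box_coord l.
Qed.

Lemma derive_prod_eq0 (I : Type) (r : seq I) (P : pred I) (F : I -> V -> R) v x :
  (forall k, C1 (F k)) -> (forall k, P k -> 'D_v (F k) x = 0) ->
  'D_v (fun y => \prod_(k <- r | P k) F k y) x = 0.
Proof.
move=> CF F0; elim: r => [|k r IHr].
  by under eq_fun do rewrite big_nil; exact: derive_cst.
case Pk : (P k); last first.
  by under eq_fun do rewrite big_cons Pk.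
under eq_fun do rewrite big_cons Pk.
have Cr : C1 (fun y => \prod_(k <- r | P k) F k y).
  under eq_fun do rewrite -big_filter; exact: C1_prod.
rewrite deriveM; [|by apply: diff_derivable; have [] := CF k|
  by apply: diff_derivable; have [] := Cr].
by rewrite IHr F0// !scaler0 addr0.
Qed.

Lemma derive_box_potential e x : 0 < e ->
  'D_(delta_mx 0 i) (box_potential e) x =
  tent_slope e (box_coord i x) / s 0 i * \prod_(l | l != i) bump e (box_coord l x).
Proof.
move=> e0.
have CP l : C1 (fun x => box_profile e l (box_coord l x)).
  by apply: C1_comp (C1_box_profile e l); have [] := C1_box_coord l.
have DP v l y : 'D_v (fun x => box_profile e l (box_coord l x)) y =
    'D_1 (box_profile e l) (box_coord l y) * (v 0 l / s 0 l).
  have [[dc _] Dc] := C1_box_coord l; rewrite -(Dc v y).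
  by apply: derive_comp_real => //; have [] := C1_box_profile e l.
have -> : box_potential e = (fun x => box_profile e i (box_coord i x) *
    \prod_(l | l != i) box_profile e l (box_coord l x)).
  by apply/funext => y; rewrite /box_potential (bigD1 i).
have Cr : C1 (fun y => \prod_(l | l != i) box_profile e l (box_coord l y)).
  by under eq_fun do rewrite -big_filter; exact: C1_prod.
rewrite deriveM; [|by apply: diff_derivable; have [] := CP i|
  by apply: diff_derivable; have [] := Cr].
rewrite derive_prod_eq0//; last first.
  by move=> l /negPf li; rewrite DP mxE li andbF mul0r mulr0.
rewrite scaler0 add0r /GRing.scale/= mulrC DP mxE !eqxx /= mul1r.
rewrite /box_profile eqxx derive_tent ?gt_eqF//; congr (_ * _).
by apply: eq_bigr => l /negPf ->.
Qed.

Lemma divergence_box_field e x : 0 < e -> divergence (box_field e) x =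
  (2 * s 0 i)^-1 * (tent_slope e (box_coord i x) *
    \prod_(l | l != i) bump e (box_coord l x)).
Proof.
move=> e0; have C2 : C1 (fun x => 2^-1 * box_potential e x).
  by apply: C1_mul; [exact: C1_cst|exact: C1_box_potential].
have [_ E] := C1_scale (delta_mx 0 i : V) C2.
rewrite /divergence (bigD1 i)//= E big1 ?addr0; last first.
  by move=> l /negPf li; rewrite E !mxE li andbF mulr0.
rewrite !mxE !eqxx mulr1.
have -> : 'D_(delta_mx 0 i) (fun x => 2^-1 * box_potential e x) x =
   2^-1 * 'D_(delta_mx 0 i) (box_potential e) x.
  by apply: deriveZ; apply: diff_derivable; have [] := C1_box_potential e.
rewrite derive_box_potential//.
by rewrite invfM; ring.
Qed.

Lemma box_profile_support e l x : 0 < e <= 4^-1 ->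
  ~~ (e < box_coord l x < 1 - e) -> box_profile e l (box_coord l x) = 0.
Proof.
move=> /[dup] /andP[e0 _] ee ne; rewrite /box_profile; case: ifP => _.
  exact: tent_support.
exact: bump_support.
Qed.

Lemma box_potential_bounded e x : 0 < e <= 4^-1 -> `|box_potential e x| <= 2.
Proof.
move=> ee; rewrite /box_potential (bigD1 i)//= normrM -[leRHS]mulr1.
rewrite ler_pM//; first by rewrite /box_profile eqxx; exact: tent_bounded.
rewrite normr_prod prodr_ile1// => l li; rewrite normr_ge0 /box_profile (negPf li).
by rewrite ger0_norm ?bump_ge0 ?bump_le1.
Qed.

Lemma closed_box_closed (b t : V) : closed (closed_box b t).
Proof.
have -> : closed_box b t = \bigcap_(l in [set: 'I_d])
    ((fun x : V => x 0 l) @^-1` [set r | b 0 l <= r] `&`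
     (fun x : V => x 0 l) @^-1` [set r | r <= b 0 l + t 0 l]).
  apply/seteqP; split=> x /= xB l; first by have /andP[? ?] := xB l.
  by have [/= -> ->] := xB l I.
apply: closed_bigI => l _; apply: closedI; apply: closed_comp.
- by move=> x _; exact: coord_continuous.
- exact: closed_ge.
- by move=> x _; exact: coord_continuous.
- exact: closed_le.
Qed.

Lemma closed_box_compact (b t : V) : compact (closed_box b t).
Proof.
apply: bounded_closed_compact; last exact: closed_box_closed.
exists (\big[Num.max/0]_(l < d) (`|b 0 l| + `|t 0 l|)); split; first exact: num_real.
move=> M bM x xB /=; rewrite /Num.Def.normr /= mx_normrE.
apply: bigmax_le.
  by apply: le_trans (ltW bM); exact: bigmax_ge_id.
move=> [z l] _; rewrite ord1 /=; apply: le_trans (ltW bM).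
apply: le_trans (le_bigmax _ (fun l : 'I_d => `|b 0 l| + `|t 0 l|) l).
have := xB l; have := ler_norm (b 0 l); have := ler_norm (t 0 l).
have := ler_norm (- b 0 l); have := ler_norm (- t 0 l); rewrite !normrN.
by rewrite ler_norml; lra.
Qed.

Lemma test_field_box_field e : 0 < e <= 4^-1 ->
  test_field (open_box a s) (box_field e).
Proof.
move=> /[dup] /andP[e0 e4] ee.
have C2 : C1 (fun x => 2^-1 * box_potential e x).
  by apply: C1_mul; [exact: C1_cst|exact: C1_box_potential].
have [[df cf] _] := C1_scale (delta_mx 0 i : V) C2.
split => //.
  pose b : V := \row_l (a 0 l + e * s 0 l).
  pose t : V := \row_l ((1 - 2 * e) * s 0 l).
  exists (closed_box b t); split; first exact: closed_box_compact.
    move=> x xB l; have := xB l; have := s_gt0 l; rewrite !mxE => sl /andP[h1 h2].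
    by apply/andP; split; nra.
  move=> x xB; have [l /negP nl] := (existsNP _).2 xB.
  rewrite /box_field /box_potential (bigD1 l)//= box_profile_support ?mul0r ?mulr0 ?scale0r//.
  apply: contra nl; rewrite /box_coord !mxE; have := s_gt0 l => sl.
  by rewrite ltr_pdivlMr// ltr_pdivrMr// => /andP[h1 h2]; apply/andP; split; nra.
move=> x; rewrite (bigD1 i)//= big1 ?addr0; last first.
  by move=> l /negPf li; rewrite !mxE li andbF mulr0 expr0n.
rewrite !mxE !eqxx mulr1 -real_normK ?num_real// expr_le1// normrM.
have := box_potential_bounded x ee; rewrite gtr0_norm ?invr_gt0//; lra.
Qed.

Lemma divergence_box_field_bounded e x : 0 < e ->
  `|divergence (box_field e) x| <= (s 0 i)^-1.
Proof.
move=> e0; rewrite divergence_box_field// normrM gtr0_norm; last first.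
  by rewrite invr_gt0 mulr_gt0.
rewrite ler_pdivrMl ?mulr_gt0// -mulrA divff ?mulr1 ?gt_eqF// normrM.
rewrite -[leRHS]mulr1 ler_pM ?tent_slope_bounded//.
rewrite normr_prod prodr_ile1// => l _; rewrite normr_ge0 /=.
by rewrite ger0_norm ?bump_ge0 ?bump_le1.
Qed.

(** The offset keeps the width below a quarter, as the support of the tent
    requires. *)
Definition width (n : nat) : R := (n.+4%:R)^-1.

Lemma width_bounds n : 0 < width n <= 4^-1.
Proof. by rewrite /width invr_gt0 ltr0n /= lef_pV2 ?posrE ?ltr0n// ler_nat. Qed.

Lemma near_width (e : R) : 0 < e -> \forall n \near \oo, width n <= e.
Proof.
move=> e0; have := near_infty_natSinv_lt (PosNum e0).
apply: filterS => n /= /ltW; apply: le_trans.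
by rewrite /width lef_pV2 ?posrE ?ltr0n// ler_nat; do 3 apply: leqW.
Qed.

Lemma near_bumps x : (forall l, l != i -> 0 < box_coord l x < 1) ->
  \forall n \near \oo, \prod_(l | l != i) bump (width n) (box_coord l x) = 1.
Proof.
move=> x01.
have : \forall n \near \oo, forall l, l != i -> bump (width n) (box_coord l x) = 1.
  apply: filter_forall => l; case: (eqVneq l i) => [->|li].
    exact: nearW.
  have /andP[h1 h2] := x01 l li.
  have h3 : 0 < 1 - box_coord l x by rewrite subr_gt0.
  near=> n => _; apply: bump_plateau.
    by have /andP[] := width_bounds n.
  have w1 : width n <= box_coord l x / 2.
    by near: n; apply: near_width; rewrite divr_gt0.
  have w2 : width n <= (1 - box_coord l x) / 2.
    by near: n; apply: near_width; rewrite divr_gt0.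
  by lra.
by apply: filterS => n B; apply: big1 => l; exact: B.
Unshelve. all: by end_near. Qed.

(** Pointwise the divergence is eventually constant: an interior point of a half
    leaves the transition zones of the cut-off functions. *)
Lemma near_divergence_lower x : open_box a (halve i s) x ->
  \forall n \near \oo, divergence (box_field (width n)) x = (2 * s 0 i)^-1.
Proof.
move=> xB.
have x01 l : l != i -> 0 < box_coord l x < 1.
  move=> /negPf li; have := xB l; rewrite mxE li /box_coord => h.
  by rewrite divr_gt0 ?ltr_pdivrMr//; have := s_gt0 l; lra.
have /andP[h1 h2] : 0 < box_coord i x < 2^-1.
  have := xB i; rewrite mxE eqxx /box_coord => h; have := s_gt0 i.
  by rewrite divr_gt0 ?ltr_pdivrMr//; lra.
near=> n; have /andP[e0 e4] := width_bounds n.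
rewrite divergence_box_field//.
have -> : \prod_(l | l != i) bump (width n) (box_coord l x) = 1.
  by near: n; exact: near_bumps.
rewrite tent_slope_left ?mulr1 ?width_bounds//.
have : width n <= box_coord i x / 3 by near: n; apply: near_width; rewrite divr_gt0.
by lra.
Unshelve. all: by end_near. Qed.

Lemma near_divergence_upper x : open_box (midpoint i a s) (halve i s) x ->
  \forall n \near \oo, divergence (box_field (width n)) x = - (2 * s 0 i)^-1.
Proof.
move=> xB.
have x01 l : l != i -> 0 < box_coord l x < 1.
  move=> /negPf li; have := xB l; rewrite !mxE li /box_coord => h.
  by rewrite divr_gt0 ?ltr_pdivrMr//; have := s_gt0 l; lra.
have /andP[h1 h2] : 2^-1 < box_coord i x < 1.
  have := xB i; rewrite !mxE eqxx /box_coord => h; have := s_gt0 i => si.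
  by rewrite ltr_pdivlMr// ltr_pdivrMr//; lra.
near=> n; have /andP[e0 e4] := width_bounds n.
rewrite divergence_box_field//.
have -> : \prod_(l | l != i) bump (width n) (box_coord l x) = 1.
  by near: n; exact: near_bumps.
have w1 : width n <= box_coord i x / 3 by near: n; apply: near_width; rewrite divr_gt0//; lra.
have w2 : width n <= box_coord i x - 2^-1 by near: n; apply: near_width; lra.
have w3 : width n <= (1 - box_coord i x) / 2 by near: n; apply: near_width; lra.
by rewrite tent_slope_right ?mulr1 ?mulrN1//; lra.
Unshelve. all: by end_near. Qed.

End box_field.

(** * Total variation *)

Section total_variation.
Context {R : realType} {d : nat}.
Local Notation V := 'rV[R]_d.
Local Notation leb := (lebesgue_rV R d).
Implicit Types (D E : set V) (phi psi : V -> V) (w v : V -> R).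

Lemma test_fieldS D E phi : D `<=` E -> test_field D phi -> test_field E phi.
Proof.
move=> DE [dphi cphi [K [cK KD K0]] bphi]; split=> //; exists K; split=> //.
exact: subset_trans DE.
Qed.

Lemma test_field0 D : test_field D (fun=> 0).
Proof.
split=> [x|v|| x].
- exact: differentiable_cst.
- have -> : 'D_v (fun=> 0 : V) = (fun _ : V => 0 : V).
    by apply/funext => x; exact: derive_cst.
  by move=> x; exact: cst_continuous.
- by exists set0; split=> //; exact: compact0.
- by rewrite big1// => l _; rewrite mxE expr0n.
Qed.

Lemma divergence_cst0 x : divergence (fun=> 0 : V) x = 0.
Proof. by rewrite /divergence big1// => l _; rewrite derive_cst mxE. Qed.

Lemma divergenceN D phi x : test_field D phi ->
  divergence (fun y => - phi y) x = - divergence phi x.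
Proof.
move=> [dphi _ _ _]; rewrite /divergence -sumrN; apply: eq_bigr => l _.
by rewrite (deriveN (@diff_derivable _ _ _ _ _ _ (dphi x))) mxE.
Qed.

Lemma test_fieldN D phi : test_field D phi -> test_field D (fun x => - phi x).
Proof.
move=> [dphi cphi [K [cK KD K0]] bphi]; split.
- by move=> x; apply: differentiableN.
- move=> v; have -> : 'D_v (fun x => - phi x) = (fun x => - 'D_v phi x).
    by apply/funext => x; rewrite (deriveN (@diff_derivable _ _ _ _ _ _ (dphi x))).
  by move=> x; apply: (@continuousN _ _ _ ('D_v phi)); exact: cphi.
- by exists K; split=> // x /K0 ->; rewrite oppr0.
- by move=> x; under eq_bigr do rewrite mxE sqrrN; exact: bphi.
Qed.

Lemma divergenceD D E phi psi x : test_field D phi -> test_field E psi ->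
  divergence (fun y => phi y + psi y) x = divergence phi x + divergence psi x.
Proof.
move=> [dphi _ _ _] [dpsi _ _ _]; rewrite /divergence -big_split /=.
apply: eq_bigr => l _; rewrite (deriveD (@diff_derivable _ _ _ _ _ _ (dphi x))
  (@diff_derivable _ _ _ _ _ _ (dpsi x))) mxE//.
Qed.

(** At every point one of the two fields vanishes, so that the bound on the
    pointwise norm is kept. *)
Lemma test_fieldD D1 D2 E phi psi : D1 `<=` E -> D2 `<=` E -> D1 `&` D2 = set0 ->
  test_field D1 phi -> test_field D2 psi -> test_field E (fun x => phi x + psi x).
Proof.
move=> D1E D2E D12 [dphi cphi [K [cK KD K0]] bphi] [dpsi cpsi [L [cL LD L0]] bpsi].
split.
- by move=> x; apply: differentiableD.
- move=> v; have -> : 'D_v (fun x => phi x + psi x) = (fun x => 'D_v phi x + 'D_v psi x).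
    apply/funext => x; rewrite (deriveD (@diff_derivable _ _ _ _ _ _ (dphi x))
      (@diff_derivable _ _ _ _ _ _ (dpsi x)))//.
  by move=> x; apply: (@continuousD _ _ _ ('D_v phi) ('D_v psi)); [exact: cphi|exact: cpsi].
- exists (K `|` L); split; first exact: compactU.
    by move=> x [/KD/D1E|/LD/D2E].
  by move=> x KLx; rewrite K0 ?L0 ?addr0// => ?; apply: KLx; [right|left].
- move=> x; have [Kx|/K0 ->] := pselect (K x); last first.
    by under eq_bigr do rewrite mxE [X in X + _]mxE add0r; exact: bpsi.
  have Lx : ~ L x by move=> Lx; suff : set0 x by []; rewrite -D12; split; [exact: KD|exact: LD].
  by rewrite (L0 _ Lx) addr0; exact: bphi.
Qed.

Lemma divergence_out D phi x : test_field D phi -> ~ D x -> divergence phi x = 0.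
Proof.
move=> [_ _ [K [cK KD K0]] _] Dx.
by apply: (divergence_off_support cK K0) => /KD.
Qed.

Lemma divergence_bounded D phi : test_field D phi ->
  exists2 M, 0 <= M & forall x, `|divergence phi x| <= M.
Proof.
move=> tphi; have cdiv := continuous_divergence tphi.
case: (tphi) => _ _ [K [cK KD K0]] _.
have /compact_bounded [M [Mr KM]] : compact (divergence phi @` K).
  by apply: continuous_compact => //; exact: continuous_subspaceT.
exists (`|M| + 1) => [|x]; first exact: addr_ge0.
have [Kx|Kx] := pselect (K x); last first.
  by rewrite (divergence_off_support cK K0 Kx) normr0 addr_ge0.
apply: KM; last by exists x.
by rewrite (le_lt_trans (ler_norm _))// ltrDl.
Qed.

Lemma measurable_divergence D phi E : test_field D phi ->
  measurable_fun E (divergence phi).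
Proof.
move=> /continuous_divergence /continuous_measurable_rV.
by apply: measurable_funS.
Qed.

Lemma integrable_mul_divergence D E phi w : measurable E -> test_field D phi ->
  leb.-integrable E (EFin \o w) ->
  leb.-integrable E (EFin \o (fun x => w x * divergence phi x)).
Proof.
move=> mE tphi iw; have [M M0 Mphi] := divergence_bounded tphi.
apply: (@integrableMl _ _ _ leb E mE _ (divergence phi) iw).
  exact: measurable_divergence tphi.
exists M; split; first exact: num_real.
by move=> r Mr x _; exact: le_trans (Mphi x) (ltW Mr).
Qed.

Lemma Rintegral_divergenceS D E phi w : D `<=` E -> measurable D -> test_field D phi ->
  \int[leb]_(x in E) (w x * divergence phi x) =
  \int[leb]_(x in D) (w x * divergence phi x).
Proof.
move=> DE mD tphi; rewrite -[in RHS](setIidr DE) Rintegral_mkcondr.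
apply: eq_Rintegral => x xE; rewrite patchE; case: ifPn => // /negP xD.
by rewrite (divergence_out tphi) ?mulr0// => Dx; apply: xD; exact: mem_set.
Qed.

Lemma TV_ub D phi w : test_field D phi ->
  ((\int[leb]_(x in D) (w x * divergence phi x))%:E <= TV D w)%E.
Proof. by move=> tphi; apply: ereal_sup_ubound; exists phi. Qed.

Lemma TV_ge0 D w : (0 <= TV D w)%E.
Proof.
apply: le_trans (TV_ub w (test_field0 D)).
rewrite (_ : Rintegral _ _ _ = 0)// /Rintegral integral0_eq// => x _.
by rewrite divergence_cst0 mulr0.
Qed.

Lemma TV_lb D phi w : measurable D -> leb.-integrable D (EFin \o w) -> test_field D phi ->
  ((- \int[leb]_(x in D) (w x * divergence phi x))%:E <= TV D w)%E.
Proof.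
move=> mD iw tphi; apply: le_trans (TV_ub w (test_fieldN tphi)).
rewrite lee_fin -mulN1r -RintegralZl//; last exact: integrable_mul_divergence tphi iw.
rewrite le_eqVlt; apply/orP; left; apply/eqP; apply: eq_Rintegral => x _.
by rewrite (divergenceN _ tphi); ring.
Qed.

Lemma le_TV D E w : D `<=` E -> measurable D -> (TV D w <= TV E w)%E.
Proof.
move=> DE mD; apply: ge_ereal_sup => _ [phi tphi <-].
by rewrite -(Rintegral_divergenceS w DE mD tphi); apply: TV_ub; exact: test_fieldS tphi.
Qed.

(** Almost optimal fields on the two disjoint sets add up to a field on [E]. *)
Lemma TV_superadditive D1 D2 E w : measurable D1 -> measurable D2 -> measurable E ->
  D1 `<=` E -> D2 `<=` E -> D1 `&` D2 = set0 -> leb.-integrable E (EFin \o w) ->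
  (TV D1 w + TV D2 w <= TV E w)%E.
Proof.
move=> mD1 mD2 mE D1E D2E D12 iw.
have [->|Efin] := eqVneq (TV E w) +oo%E; first exact: leey.
have fin D : D `<=` E -> measurable D -> TV D w \is a fin_num.
  move=> DE mD; rewrite ge0_fin_numE ?TV_ge0// (le_lt_trans (le_TV w DE mD))//.
  by rewrite ltey.
rewrite -leeBrDr ?fin//; apply: ge_ereal_sup => _ [phi tphi <-].
rewrite leeBrDr ?fin// addeC -leeBrDr//; apply: ge_ereal_sup => _ [psi tpsi <-].
rewrite leeBrDr// -EFinD.
apply: le_trans (TV_ub w (test_fieldD D1E D2E D12 tphi tpsi)).
rewrite lee_fin -(Rintegral_divergenceS w D1E mD1 tphi)
  -(Rintegral_divergenceS w D2E mD2 tpsi).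
rewrite -RintegralD//; [|exact: integrable_mul_divergence tpsi iw|
  exact: integrable_mul_divergence tphi iw].
rewrite le_eqVlt; apply/orP; left; apply/eqP; apply: eq_Rintegral => x _.
by rewrite (divergenceD _ tphi tpsi); ring.
Qed.

Lemma TV_sub_le D w v : measurable D -> leb.-integrable D (EFin \o w) ->
  leb.-integrable D (EFin \o v) ->
  (TV D (fun x => w x - v x)%R <= TV D w + TV D v)%E.
Proof.
move=> mD iw iv; apply: ge_ereal_sup => _ [phi tphi <-].
have iwp := integrable_mul_divergence mD tphi iw.
have ivp := integrable_mul_divergence mD tphi iv.
have -> : \int[leb]_(x in D) ((w x - v x) * divergence phi x) =
    \int[leb]_(x in D) (w x * divergence phi x) +
    - \int[leb]_(x in D) (v x * divergence phi x).
  by rewrite -RintegralB//; apply: eq_Rintegral => x _; rewrite mulrBl.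
by rewrite EFinD leeD// ?TV_lb// TV_ub.
Qed.

(** The fields [box_field] are admissible for the variation, and their
    divergences converge boundedly to [(2 * s 0 i)^-1] on the lower half and to
    its opposite on the upper half. *)
Lemma diff_halves_le_TV (a s : V) i w : (forall l, 0 < s 0 l) ->
  leb.-integrable (open_box a s) (EFin \o w) ->
  ((`| \int[leb]_(x in open_box a (halve i s)) w x -
       \int[leb]_(x in open_box (midpoint i a s) (halve i s)) w x |)%:E <=
   (2 * s 0 i)%:E * TV (open_box a s) w)%E.
Proof.
move=> s_gt0 iw; set B := open_box a s.
have s0 l : 0 <= s 0 l by exact: ltW.
set B1 := open_box a (halve i s); set B2 := open_box (midpoint i a s) (halve i s).
have mB : measurable B by exact: measurable_open_box.
have mB1 : measurable B1 by exact: measurable_open_box.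
have mB2 : measurable B2 by exact: measurable_open_box.
have B1B : B1 `<=` B by exact: sub_lower_half.
have B2B : B2 `<=` B by exact: sub_upper_half.
have tphi n := test_field_box_field i a s_gt0 (@width_bounds R n).
pose c := (2 * s 0 i)^-1.
have c0 : 0 < c by rewrite /c invr_gt0 mulr_gt0.
(* the limit of the divergences *)
pose sigma x : R := c * (\1_B1 x - \1_B2 x).
pose dv n x := divergence (box_field i a s (width n)) x.
pose f_ n x : \bar R := (w x * dv n x)%:E.
pose f x : \bar R := (w x * sigma x)%:E.
pose g x : \bar R := (`|w x| * (s 0 i)^-1)%:E.
have mw : measurable_fun B w by apply/measurable_EFinP; exact: measurable_int iw.
have msigma : measurable_fun B sigma.
  apply: measurable_funM; first exact: measurable_cst.
  by apply: measurable_funB; exact: measurable_indic.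
have ig : leb.-integrable B g.
  apply: (@integrableMl _ _ _ leb B mB (EFin \o (fun x => `|w x|)) (cst (s 0 i)^-1)).
  - exact: integrable_norm.
  - exact: measurable_cst.
  - exists (s 0 i)^-1; split=> [|M ltM x _]; first exact: num_real.
    by rewrite /= gtr0_norm ?invr_gt0// ltW.
have fB1 x : B1 x -> sigma x = c.
  move=> xB1; have xB2 : ~ B2 x.
    move=> xB2; suff : set0 x by [].
    by rewrite -(disjoint_halves i a s); split.
  by rewrite /sigma !indicE mem_set// memNset// subr0 mulr1.
have fB2 x : B2 x -> sigma x = - c.
  move=> xB2; have xB1 : ~ B1 x.
    move=> xB1; suff : set0 x by [].
    by rewrite -(disjoint_halves i a s); split.
  by rewrite /sigma !indicE memNset// mem_set// sub0r mulrN1.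
have [|||||_ _ cv] := @dominated_convergence _ _ _ leb B mB f_ f g.
- by move=> n; apply/measurable_EFinP/measurable_funM => //;
    exact: measurable_divergence (tphi n).
- exact/measurable_EFinP/measurable_funM.
- apply: (negligibleS _ (null_between_halves i a s0)) => x /= nx.
  have xB : B x by apply: contrapT => nB; apply: nx => /nB.
  split=> // xB12; apply: nx => _; case: xB12 => [xB1|xB2].
    apply: cvg_near_cst; have := near_divergence_lower s_gt0 xB1.
    by apply: filterS => n; rewrite /f_ /f /dv => ->; rewrite fB1.
  apply: cvg_near_cst; have := near_divergence_upper s_gt0 xB2.
  by apply: filterS => n; rewrite /f_ /f /dv => ->; rewrite fB2.
- exact: ig.
- apply: aeW => x n _; rewrite lee_fin normrM ler_wpM2l//.
  by apply: divergence_box_field_bounded; have /andP[] := @width_bounds R n.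
have iB1 : leb.-integrable B1 (EFin \o w) by exact: integrableS iw.
have iB2 : leb.-integrable B2 (EFin \o w) by exact: integrableS iw.
have isig : leb.-integrable B (EFin \o (fun x => w x * sigma x)).
  apply: (@integrableMl _ _ _ leb B mB _ sigma iw) => //.
  exists (2 * c); split=> [|M ltM x _]; first exact: num_real.
  apply: le_trans (ltW ltM); rewrite /sigma /= normrM gtr0_norm// mulrC ler_pM2r//.
  by rewrite (le_trans (ler_normB _ _))// !indicE; case: (x \in B1); case: (x \in B2); rewrite ?normr1 ?normr0; lra.
have If : (\int[leb]_(x in B) f x)%E =
    (c * (\int[leb]_(x in B1) w x - \int[leb]_(x in B2) w x))%:E.
  rewrite -[LHS]fineK; last exact: (integrable_fin_num mB isig).
  congr EFin; rewrite -/(Rintegral _ _ _) (Rintegral_halves i s0 isig).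
  rewrite mulrBr -RintegralZl// -mulNr -RintegralZl//.
  congr (_ + _); apply: eq_Rintegral => x /set_mem xB.
    by rewrite fB1// mulrC.
  by rewrite fB2// mulrC.
rewrite If in cv.
have fin n : (\int[leb]_(x in B) f_ n x)%E = (\int[leb]_(x in B) (w x * dv n x))%:E.
  rewrite -[LHS]fineK//; apply: (integrable_fin_num mB).
  exact: integrable_mul_divergence (tphi n) iw.
set L := _ - _ in cv *.
have le1 : ((c * L)%:E <= TV B w)%E.
  apply: (cvge_to_le cv); apply: nearW => n; rewrite /= fin.
  exact: TV_ub (tphi n).
have le2 : ((- (c * L))%:E <= TV B w)%E.
  rewrite EFinN; apply: (cvge_to_le (cvgeN cv)); apply: nearW => n; rewrite /= fin.
  by rewrite -EFinN; exact: TV_lb (tphi n).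
move: le1 le2; have := TV_ge0 B w; case: (TV B w) => [r _|_ _ _|//].
  rewrite -EFinM !lee_fin => h1 h2; have cs : 2 * s 0 i * c = 1.
    by rewrite /c divff// gt_eqF// mulr_gt0.
  have E : L = 2 * s 0 i * (c * L) by rewrite mulrA cs mul1r.
  rewrite E normrM gtr0_norm ?mulr_gt0// ler_pM2l ?mulr_gt0// ler_norml lerNl.
  by rewrite h1 h2.
by rewrite mulry gtr0_sg ?mulr_gt0// mul1e leey.
Qed.

End total_variation.

(** * Repeated halving of a box *)

Section dyadic_cells.
Context {R : realType} {d : nat}.
Local Notation V := 'rV[R]_d.
Local Notation leb := (lebesgue_rV R d).
Implicit Types (a b s : V) (i l : 'I_d) (ds : seq 'I_d).

(** Only lower corners are listed: after the same halvings all cells have the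
    same sides, given by [cell_sides]. *)
Fixpoint cells ds a s : seq V :=
  if ds is i :: ds' then cells ds' a (halve i s) ++ cells ds' (midpoint i a s) (halve i s)
  else [:: a].

Fixpoint cell_sides ds s : V :=
  if ds is i :: ds' then cell_sides ds' (halve i s) else s.

Lemma halve_gt0 i s : (forall l, 0 < s 0 l) -> forall l, 0 < halve i s 0 l.
Proof. by move=> s0 l; rewrite mxE; case: ifP => // _; rewrite divr_gt0. Qed.

Lemma cell_sides_gt0 ds s : (forall l, 0 < s 0 l) -> forall l, 0 < cell_sides ds s 0 l.
Proof. by elim: ds s => [|i ds IH] s s0 //=; apply: IH; exact: halve_gt0. Qed.

Lemma cells_sub ds a s b : (forall l, 0 < s 0 l) -> b \in cells ds a s ->
  open_box b (cell_sides ds s) `<=` open_box a s.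
Proof.
elim: ds a s => [|i ds IH] a s s0 /=; first by rewrite inE => /eqP ->.
have h0 := halve_gt0 i s0; have s0' l : 0 <= s 0 l by exact: ltW.
rewrite mem_cat => /orP[] /IH h; apply: (subset_trans (h h0)).
  exact: sub_lower_half.
exact: sub_upper_half.
Qed.

Lemma cells_disjoint ds a s b b' x : (forall l, 0 < s 0 l) ->
  b \in cells ds a s -> b' \in cells ds a s ->
  open_box b (cell_sides ds s) x -> open_box b' (cell_sides ds s) x -> b = b'.
Proof.
elim: ds a s => [|i ds IH] a s s0 /=; first by rewrite !inE => /eqP -> /eqP ->.
have h0 := halve_gt0 i s0.
rewrite !mem_cat => /orP[] bc /orP[] b'c bx b'x; try exact: (IH _ _ h0 bc b'c).
- suff : set0 x by [].
  rewrite -(disjoint_halves i a s).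
  by split; [exact: cells_sub h0 bc _ bx|exact: cells_sub h0 b'c _ b'x].
- suff : set0 x by [].
  rewrite -(disjoint_halves i a s).
  by split; [exact: cells_sub h0 b'c _ b'x|exact: cells_sub h0 bc _ bx].
Qed.

Lemma cells_cat_sub ds1 ds2 a s b : (forall l, 0 < s 0 l) ->
  b \in cells (ds1 ++ ds2) a s -> exists2 b', b' \in cells ds1 a s &
  open_box b (cell_sides (ds1 ++ ds2) s) `<=` open_box b' (cell_sides ds1 s).
Proof.
elim: ds1 a s => [|i ds IH] a s s0 /=.
  by move=> bc; exists a; [rewrite inE|exact: cells_sub].
have h0 := halve_gt0 i s0.
by rewrite mem_cat => /orP[] /(IH _ _ h0)[b' b'c h]; exists b' => //;
  rewrite mem_cat b'c ?orbT.
Qed.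

Lemma cells_cover ds a s : (forall l, 0 < s 0 l) ->
  leb.-negligible (open_box a s `\`
    [set x | exists2 b, b \in cells ds a s & open_box b (cell_sides ds s) x]).
Proof.
elim: ds a s => [|i ds IH] a s s0 /=.
  apply: negligibleS (negligible_set0 _) => x [xB nx]; apply: nx.
  by exists a => //; rewrite inE.
have h0 := halve_gt0 i s0; have s0' l : 0 <= s 0 l by exact: ltW.
apply: (negligibleS _ (negligibleU (null_between_halves i a s0')
  (negligibleU (IH a _ h0) (IH (midpoint i a s) _ h0)))) => x [xB nx].
have [x1|x1] := pselect (open_box a (halve i s) x).
  right; left; split=> // -[b bc bx]; apply: nx; exists b => //.
  by rewrite mem_cat bc.
have [x2|x2] := pselect (open_box (midpoint i a s) (halve i s) x).
  right; right; split=> // -[b bc bx]; apply: nx; exists b => //.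
  by rewrite mem_cat bc orbT.
by left; split=> // -[].
Qed.

Lemma integrable_sub_box a s a' s' (w : V -> R) : open_box a' s' `<=` open_box a s ->
  leb.-integrable (open_box a s) (EFin \o w) ->
  leb.-integrable (open_box a' s') (EFin \o w).
Proof.
by move=> sub; apply: integrableS => //; exact: measurable_open_box.
Qed.

Lemma Rintegral_cells ds a s (g : V -> R) : (forall l, 0 < s 0 l) ->
  leb.-integrable (open_box a s) (EFin \o g) ->
  \int[leb]_(x in open_box a s) g x =
  \sum_(b <- cells ds a s) \int[leb]_(x in open_box b (cell_sides ds s)) g x.
Proof.
elim: ds a s => [|i ds IH] a s s0 ig /=; first by rewrite big_seq1.
have h0 := halve_gt0 i s0; have s0' l : 0 <= s 0 l by exact: ltW.
rewrite (Rintegral_halves i s0' ig) big_cat /=; congr (_ + _); apply: IH => //.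
  by apply: integrable_sub_box ig; exact: sub_lower_half.
by apply: integrable_sub_box ig; exact: sub_upper_half.
Qed.

Lemma TV_split_halves i a s (w : V -> R) (t : R) : (forall l, 0 < s 0 l) ->
  leb.-integrable (open_box a s) (EFin \o w) ->
  (TV (open_box a s) w <= t%:E)%E ->
  exists t1 t2 : R, [/\ (TV (open_box a (halve i s)) w <= t1%:E)%E,
    (TV (open_box (midpoint i a s) (halve i s)) w <= t2%:E)%E & t1 + t2 <= t].
Proof.
move=> s0 iw tw; have s0' l : 0 <= s 0 l by exact: ltW.
have := TV_superadditive (measurable_open_box a (halve i s))
  (measurable_open_box (midpoint i a s) (halve i s)) (measurable_open_box a s)
  (sub_lower_half s0') (sub_upper_half s0') (disjoint_halves i a s) iw.
move=> /le_trans/(_ tw).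
have := TV_ge0 (open_box a (halve i s)) w.
have := TV_ge0 (open_box (midpoint i a s) (halve i s)) w.
case: (TV (open_box a (halve i s)) w) => [t1| |] //;
  case: (TV (open_box (midpoint i a s) (halve i s)) w) => [t2| |] // _ _.
by rewrite -EFinD lee_fin => h; exists t1, t2.
Qed.

Lemma sum_halve i s : \sum_l halve i s 0 l = \sum_l s 0 l - s 0 i / 2.
Proof.
rewrite (bigD1 i)//= [in RHS](bigD1 i)//= mxE eqxx.
rewrite (eq_bigr (fun l => s 0 l)); last by move=> l /negPf li; rewrite mxE li.
by field.
Qed.

(** Halving side [i] adds at most [2 * s 0 i * t] to the sum of the absolute
    integrals, and this is exactly what the bound [4 * (\sum_l s 0 l) * t]
    loses when the side is halved. The variations on the two halves add up to
    at most [t], so that the number of cells does not matter. *)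
Lemma sum_cells_le_TV ds a s (w : V -> R) (t : R) : (forall l, 0 < s 0 l) ->
  leb.-integrable (open_box a s) (EFin \o w) ->
  (TV (open_box a s) w <= t%:E)%E ->
  \sum_(b <- cells ds a s) `|\int[leb]_(x in open_box b (cell_sides ds s)) w x| <=
  `|\int[leb]_(x in open_box a s) w x| + 4 * (\sum_l s 0 l) * t.
Proof.
elim: ds a s t => [|i ds IH] a s t s0 iw tw /=.
  rewrite big_seq1 lerDl !mulr_ge0//; first by apply: sumr_ge0 => l _; exact: ltW.
  by rewrite -lee_fin (le_trans (TV_ge0 _ _) tw).
have h0 := halve_gt0 i s0; have s0' l : 0 <= s 0 l by exact: ltW.
have [t1 [t2 [tw1 tw2 t12]]] := TV_split_halves i s0 iw tw.
have iw1 : leb.-integrable (open_box a (halve i s)) (EFin \o w).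
  by apply: integrable_sub_box iw; exact: sub_lower_half.
have iw2 : leb.-integrable (open_box (midpoint i a s) (halve i s)) (EFin \o w).
  by apply: integrable_sub_box iw; exact: sub_upper_half.
have H1 := IH _ _ _ h0 iw1 tw1; have H2 := IH _ _ _ h0 iw2 tw2.
have H3 : `|\int[leb]_(x in open_box a (halve i s)) w x -
    \int[leb]_(x in open_box (midpoint i a s) (halve i s)) w x| <= 2 * s 0 i * t.
  rewrite -lee_fin (le_trans (diff_halves_le_TV i s0 iw))// (EFinM (2 * s 0 i) t) lee_pmul2l//.
  by rewrite lte_fin mulr_gt0.
rewrite big_cat /= (Rintegral_halves i s0' iw); move: H1 H2 H3.
rewrite sum_halve; set S := \sum_l _.
set I1 := \int[leb]_(x in open_box a (halve i s)) w x.
set I2 := \int[leb]_(x in open_box (midpoint i a s) (halve i s)) w x.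
set S1 := \sum_(_ <- cells ds a _) _; set S2 := \sum_(_ <- cells ds (midpoint _ _ _) _) _.
move=> H1 H2 H3.
(* the left-hand side is the larger of the two terms on the right *)
have H4 : `|I1| + `|I2| <= `|I1 + I2| + `|I1 - I2|.
  have := ler_norm (I1 + I2); have := ler_norm (- (I1 + I2)).
  have := ler_norm (I1 - I2); have := ler_norm (- (I1 - I2)); rewrite !normrN.
  by have [|] := ger0P I1; have [|] := ger0P I2; lra.
have S0 : 0 <= S - s 0 i / 2.
  by rewrite /S -(sum_halve i); apply: sumr_ge0 => l _; exact: ltW.
have : (S - s 0 i / 2) * (t1 + t2) <= (S - s 0 i / 2) * t by exact: ler_wpM2l.
lra.
Qed.

(** A round halves every side once, so that cells keep the proportions of the
    box and their diameters tend to zero. *)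
Definition rounds n : seq 'I_d := flatten (nseq n (enum 'I_d)).

Lemma rounds_add n m : rounds (n + m) = rounds n ++ rounds m.
Proof. by rewrite /rounds nseqD flatten_cat. Qed.

Lemma cell_sides_count ds s l : cell_sides ds s 0 l = s 0 l * 2^-1 ^+ count_mem l ds.
Proof.
elim: ds s => [|i ds IH] s /=; first by rewrite expr0 mulr1.
rewrite IH mxE eq_sym; case: eqP => _ /=; last by rewrite add0n.
by rewrite add1n exprS mulrA.
Qed.

Lemma cell_sides_rounds n s : cell_sides (rounds n) s = 2^-1 ^+ n *: s.
Proof.
apply/rowP => l; rewrite cell_sides_count mxE mulrC; congr (_ ^+ _ * _).
rewrite /rounds; elim: n => //= n IH; rewrite count_cat IH -add1n; congr (_ + _)%N.
by rewrite count_uniq_mem ?enum_uniq// mem_enum.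
Qed.

End dyadic_cells.

(** * Density of the unions of cells *)

Section density.
Context {R : realType} {d : nat}.
Local Notation V := 'rV[R]_d.
Local Notation leb := (lebesgue_rV R d).
Variables (a s : V).
Hypothesis s_gt0 : forall l, 0 < s 0 l.
Local Notation B := (open_box a s).
Local Notation cell n b := (open_box b (cell_sides (@rounds d n) s)).

Let mB : measurable B. Proof. exact: measurable_open_box. Qed.

Let mcell n b : measurable (cell n b). Proof. exact: measurable_open_box. Qed.

Let s_ge0 l : 0 <= s 0 l. Proof. exact: ltW. Qed.

Definition sym_diff (A S : set V) := (A `\` S) `|` (S `\` A).

Definition adapted n (S : set V) := forall b, b \in cells (@rounds d n) a s ->
  cell n b `<=` S \/ cell n b `<=` ~` S.

(** Any measurable [S] that does not cut a cell is accepted, and the error is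
    measured inside the box only; thus complements are immediate. *)
Definition approximable (A : set V) := measurable A /\
  forall e : R, 0 < e -> exists n S, [/\ measurable S, adapted n S &
    (leb (B `&` sym_diff A S) < e%:E)%E].

Lemma adapted_leq n m S : (n <= m)%N -> adapted n S -> adapted m S.
Proof.
move=> nm aS b; rewrite -(subnKC nm) rounds_add => /(cells_cat_sub s_gt0)[b' b'c bb'].
by case: (aS b' b'c) => h; [left|right]; exact: subset_trans h.
Qed.

Lemma adaptedU n S T : adapted n S -> adapted n T -> adapted n (S `|` T).
Proof.
move=> aS aT b bc; case: (aS b bc) => h; first by left => x /h; left.
case: (aT b bc) => h'; first by left => x /h'; right.
by right => x bx [|]; [exact: h|exact: h'].
Qed.

Lemma adaptedC n S : adapted n S -> adapted n (~` S).
Proof.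
by move=> aS b bc; case: (aS b bc) => h; [right|left] => // x bx; apply; exact: h.
Qed.

Lemma measurable_sym_diff A S : measurable A -> measurable S -> measurable (sym_diff A S).
Proof. by move=> mA mS; apply: measurableU; exact: measurableD. Qed.

Lemma approximable0 : approximable set0.
Proof.
split=> // e e0; exists 0%N, set0; split=> //; first by move=> b _; right=> x _ [].
by rewrite /sym_diff setD0 setU0 setI0 measure0 lte_fin.
Qed.

Lemma approximableC A : approximable A -> approximable (~` A).
Proof.
move=> [mA hA]; split; first exact: measurableC.
move=> e /hA [n [S [mS aS lS]]]; exists n, (~` S); split.
- exact: measurableC.
- exact: adaptedC.
- rewrite (_ : sym_diff (~` A) (~` S) = sym_diff A S)//.
  rewrite /sym_diff !setDE !setCK setUC [in RHS]setUC.
  apply/seteqP; split=> x [[p q]|[p q]]; by [left|right].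
Qed.

Lemma leb_box_fin (A : set V) : measurable A -> (leb (B `&` A) < +oo)%E.
Proof.
move=> mA; apply: le_lt_trans (lebesgue_open_box_lty a s_ge0).
apply: le_measure; rewrite ?inE; [exact: (measurableI _ _ mB mA)|exact: mB|].
by move=> x [].
Qed.

Lemma approximableU A1 A2 : approximable A1 -> approximable A2 -> approximable (A1 `|` A2).
Proof.
move=> [mA1 h1] [mA2 h2]; split; first exact: measurableU.
move=> e e0; have e20 : 0 < e / 2 by rewrite divr_gt0.
have [n1 [S1 [mS1 aS1 l1]]] := h1 _ e20; have [n2 [S2 [mS2 aS2 l2]]] := h2 _ e20.
exists (maxn n1 n2), (S1 `|` S2); split; first exact: measurableU.
  apply: adaptedU; first exact: (adapted_leq (leq_maxl _ _) aS1).
  exact: (adapted_leq (leq_maxr _ _) aS2).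
apply: (@le_lt_trans _ _ (leb (B `&` sym_diff A1 S1) + leb (B `&` sym_diff A2 S2))%E).
  apply: le_trans (measureU2 _ _ _).
  - apply: le_measure; rewrite ?inE.
    + by apply: measurableI => //; apply: measurable_sym_diff; exact: measurableU.
    + by apply: measurableU; apply: measurableI => //; exact: measurable_sym_diff.
    + rewrite -setIUr; apply: setIS => x.
      by move=> [[[Ax|Ax] /not_orP[Sx1 Sx2]]|[[Sx|Sx] /not_orP[Ax1 Ax2]]];
        [left; left|right; left|left; right|right; right].
  - by apply: measurableI => //; exact: measurable_sym_diff.
  - by apply: measurableI => //; exact: measurable_sym_diff.
by rewrite [e]splitr EFinD lteD.
Qed.

(** Finite unions suffice: what a countable union adds to them inside the box
    decreases to a null set, and the box has finite volume. *)
Lemma approximable_bigcup (A : set V) (F : nat -> set V) : measurable A ->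
  (forall k, approximable (F k)) -> \bigcup_k F k `<=` A ->
  leb.-negligible (B `&` (A `\` \bigcup_k F k)) -> approximable A.
Proof.
move=> mA hF FA N0; split=> // e e0.
pose G n := \big[setU/set0]_(k < n) F k.
have mG n : approximable (G n).
  by rewrite /G; elim/big_ind: _ => //; [exact: approximable0|exact: approximableU].
have GA n : G n `<=` A.
  by apply: subset_trans FA; rewrite /G -bigcup_mkord; apply: bigcup_sub => k _; exact: bigcup_sup.
pose D n := B `&` (A `\` G n).
have mD n : measurable (D n).
  by apply: measurableI => //; apply: measurableD => //; exact: (mG n).1.
have capD : \bigcap_n D n = B `&` (A `\` \bigcup_k F k).
  apply/seteqP; split=> [x Dx|x [Bx [Ax Fx]] n _].
    have [Bx [Ax _]] := Dx 0%N I; split=> //; split=> // -[k _ Fkx].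
    have [_ [_]] := Dx k.+1 I; apply; rewrite /G -bigcup_mkord.
    by exists k => //=.
  split=> //; split=> //; rewrite /G -bigcup_mkord => -[k _ Fkx].
  by apply: Fx; exists k.
have mcapD : measurable (\bigcap_n D n) by exact: bigcapT_measurable.
have cvD : leb \o D @ \oo --> 0%E.
  have <- : leb (\bigcap_n D n) = 0%E.
    by apply: measure_negligible => //; rewrite capD.
  apply: nonincreasing_cvg_mu => //.
    by apply: leb_box_fin; apply: measurableD => //; exact: (mG 0%N).1.
  apply/nonincreasing_seqP => n; apply/subsetPset; apply: setIS => x [Ax Gx].
  by split=> // Gnx; apply: Gx; rewrite /G big_ord_recr; left.
have e20 : 0 < e / 2 by rewrite divr_gt0.
have [n _ /(_ n (leqnn n)) Dn] : \forall n \near \oo, (leb (D n) < (e / 2)%:E)%E.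
  have e2E : (0 < (e / 2)%:E)%E by rewrite lte_fin.
  exact: (cvD _ (open_ereal_lt' e2E)).
have [m [S [mS aS lS]]] := (mG n).2 _ e20.
exists m, S; split=> //.
apply: (@le_lt_trans _ _ (leb (D n) + leb (B `&` sym_diff (G n) S))%E).
  apply: le_trans (measureU2 _ _ _) => //.
  - apply: le_measure; rewrite ?inE.
    + by apply: measurableI => //; exact: measurable_sym_diff.
    + apply: measurableU => //; apply: measurableI => //.
      by apply: measurable_sym_diff => //; exact: (mG n).1.
    + rewrite -setIUr; apply: setIS => x [[Ax Sx]|[Sx Ax]].
        by have [Gx|Gx] := pselect (G n x); [right; left|left].
      by right; right; split=> // /GA.
  - apply: measurableI => //.
    by apply: measurable_sym_diff => //; exact: (mG n).1.
by rewrite [e]splitr EFinD lteD.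
Qed.

Lemma sigma_algebra_approximable : sigma_algebra setT approximable.
Proof.
split; [exact: approximable0|by move=> A; rewrite setTD; exact: approximableC|].
move=> F hF; apply: (approximable_bigcup _ hF) => //.
  by apply: bigcupT_measurable => k; exact: (hF k).1.
by rewrite setDv setI0; exact: negligible_set0.
Qed.

(** The cells contained in an open set exhaust it, up to the faces of all the
    cells, since their diameters tend to zero. *)
Lemma open_approximable (A : set V) : open A -> approximable A.
Proof.
move=> oA; have mA : measurable A by exact: open_measurable_rV.
pose F n := [set x | exists2 b, b \in cells (@rounds d n) a s & cell n b x /\ cell n b `<=` A].
have FA : \bigcup_k F k `<=` A by move=> x [k _ [b _ [bx]]]; apply.
have FE n : F n = \bigcup_(b in [set b | b \in cells (@rounds d n) a s /\ cell n b `<=` A]) cell n b.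
  by apply/seteqP; split=> x => [[b bc [bx bA]]|[b [bc bA] bx]]; exists b.
have mF n : measurable (F n).
  rewrite FE; apply: fin_bigcup_measurable => //.
  by apply: (@sub_finite_set _ _ [set` cells (@rounds d n) a s]) => [b []|]//.
apply: (approximable_bigcup mA _ FA) => [n|].
  split=> // e e0; exists n, (F n); split=> //.
    move=> b bc; have [bA|bA] := pselect (cell n b `<=` A).
      by left => x bx; exists b.
    right => x bx [b' b'c [b'x b'A]]; apply: bA.
    by rewrite (cells_disjoint s_gt0 bc b'c bx b'x).
  by rewrite /sym_diff !setDv setU0 setI0 measure0 lte_fin.
apply: (negligibleS _ (negligible_bigcup (fun n => cells_cover (@rounds d n) a s_gt0))).
move=> x [Bx [Ax nFx]]; apply: contrapT => nx.
have cov n : exists2 b, b \in cells (@rounds d n) a s & cell n b x.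
  by apply: contrapT => h; apply: nx; exists n.
have /nbhs_ballP[e /= e0 eA] := open_nbhs_nbhs (conj oA Ax).
have [n hn] : exists n, forall l, 2^-1 ^+ n * s 0 l < e.
  have h : \forall n \near \oo, forall l : 'I_d, 2^-1 ^+ n * s 0 l < e.
    apply: filter_forall => l.
    have c0 : (2^-1 ^+ n * s 0 l) @[n --> \oo] --> (0 : R).
      rewrite -[X in _ --> X](mul0r (s 0 l)); apply: cvgMr_tmp.
      by apply: cvg_expr; rewrite gtr0_norm ?invr_gt0// invf_lt1// ltr1n.
    exact: (cvgr_lt _ c0).
  by case: h => n _ /(_ n (leqnn n)) h; exists n.
apply: nFx; exists n => //; have [b bc bx] := cov n; exists b => //; split=> // y byy.
apply: eA; rewrite -ball_normE /ball_ /= /Num.Def.normr /= mx_normrE.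
apply/bigmax_ltP; split=> // -[z l] _; rewrite ord1 !mxE /=.
apply: le_lt_trans (hn l); have := bx l; have := byy l.
by rewrite cell_sides_rounds !mxE ler_norml; lra.
Qed.

Lemma measurable_approximable (A : set V) : measurable A -> approximable A.
Proof.
apply: smallest_sub; first exact: sigma_algebra_approximable.
by move=> S /= oS; exact: open_approximable.
Qed.

End density.

(** * An estimate of Poincare type *)

Section poincare.
Context {R : realType} {d : nat}.
Local Notation V := 'rV[R]_d.
Local Notation leb := (lebesgue_rV R d).
Implicit Types (a s : V) (w : V -> R) (t M : R).

Lemma indic_in (S : set V) x : S x -> \1_S x = 1 :> R.
Proof. by move=> Sx; rewrite indicE mem_set. Qed.

Lemma indic_out (S : set V) x : ~ S x -> \1_S x = 0 :> R.
Proof. by move=> Sx; rewrite indicE memNset. Qed.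

Lemma Rintegral_sign (D S : set V) w : measurable D -> leb.-integrable D (EFin \o w) ->
  D `<=` S \/ D `<=` ~` S ->
  `|\int[leb]_(x in D) (w x * (2 * \1_S x - 1))| = `|\int[leb]_(x in D) w x|.
Proof.
move=> mD iw [DS|DS].
  by congr `| _ |; apply: eq_Rintegral => x /set_mem/DS xS;
    rewrite indic_in//; ring.
rewrite -[RHS]normrN -[in RHS]mulN1r -RintegralZl//; congr `| _ |.
apply: eq_Rintegral => x /set_mem/DS xS.
by rewrite indic_out//; ring.
Qed.

(** Up to a small error the sign of [w] is constant on each cell of a fine
    subdivision, whence the norm in [L^1] is almost a sum of absolute integrals
    over cells; [sum_cells_le_TV] bounds such a sum whatever the subdivision. *)
Lemma poincare_box a s w M t : (forall l, 0 < s 0 l) ->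
  leb.-integrable (open_box a s) (EFin \o w) ->
  0 <= M -> {ae leb, forall x, open_box a s x -> `|w x| <= M} ->
  (TV (open_box a s) w <= t%:E)%E ->
  \int[leb]_(x in open_box a s) `|w x| <=
  `|\int[leb]_(x in open_box a s) w x| + 4 * (\sum_l s 0 l) * t.
Proof.
move=> s0 iw M0 wM tw; set B := open_box a s.
have mB : measurable B by exact: measurable_open_box.
have mw : measurable_fun B w by apply/measurable_EFinP; exact: measurable_int iw.
set A := B `&` w @^-1` `]0, +oo[.
have mA : measurable A by apply: mw.
have [_ hA] := measurable_approximable a s0 mA.
apply/ler_addgt0Pr => e e0.
(* [M] may vanish, hence the additional one in the denominator *)
have e10 : 0 < e / (2 * M + 1) by rewrite divr_gt0// ltr_wpDl// mulr_ge0.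
have [n [S [mS aS lS]]] := hA _ e10.
have mD : measurable (sym_diff A S) by exact: measurable_sym_diff.
have iabs : leb.-integrable B (EFin \o (fun x => `|w x|)) by exact: integrable_norm.
have isg : leb.-integrable B (EFin \o (fun x => w x * (2 * \1_S x - 1))).
  apply: (@integrableMl _ _ _ leb B mB _ (fun x => 2 * \1_S x - 1) iw).
    apply: measurable_funB; last exact: measurable_cst.
    apply: measurable_funM; first exact: measurable_cst.
    exact: measurable_indic.
  exists 1; split=> [|r lr x _]; first exact: num_real.
  apply: le_trans (ltW lr); rewrite /=.
  by have [Sx|Sx] := pselect (S x); [rewrite indic_in|rewrite indic_out];
    rewrite // ler_norml; lra.
(* [2 * \1_S - 1] is a sign that is constant on cells, wrong only on the
   symmetric difference *)
have E1 : \int[leb]_(x in B) `|w x| - \int[leb]_(x in B) (w x * (2 * \1_S x - 1)) =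
    2 * \int[leb]_(x in B `&` sym_diff A S) `|w x|.
  rewrite -RintegralB// Rintegral_mkcondr -RintegralZl//; last first.
    rewrite (_ : EFin \o _ = (EFin \o (fun x => `|w x|)) \_ (sym_diff A S)).
      apply/integrable_restrict => //.
      by apply: (integrableS _ _ _ iabs) => //; exact: measurableI.
    by apply/funext => x /=; rewrite /patch; case: ifP.
  apply: eq_Rintegral => x /set_mem Bx; rewrite patchE -[point]/(0 : R).
  have Aw : A x <-> 0 < w x.
    by rewrite /A /= in_itv/= andbT; split=> [[]|].
  have [Sx|Sx] := pselect (S x).
    rewrite indic_in//; have [w0|w0] := ltP 0 (w x).
      rewrite gtr0_norm// memNset /=; first by lra.
      by case=> [[_]|[_]]; [exact|move/Aw : w0].
    rewrite ler0_norm// mem_set /=; first by lra.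
    by right; split=> // /Aw; rewrite ltNge w0.
  rewrite indic_out//; have [w0|w0] := ltP 0 (w x).
    by rewrite gtr0_norm// mem_set /=; [lra|left; split=> //; exact/Aw].
  rewrite ler0_norm// memNset /=; first by lra.
  by case=> [[/Aw]|[]//]; rewrite ltNge w0.
have E2 : \int[leb]_(x in B `&` sym_diff A S) `|w x| <= M * (e / (2 * M + 1)).
  have mBD : measurable (B `&` sym_diff A S) by exact: measurableI.
  rewrite -lee_fin /Rintegral fineK; last first.
    by apply: integrable_fin_num => //; apply: integrableS iabs.
  apply: (@le_trans _ _ (M%:E * leb (B `&` sym_diff A S))%E).
    apply: (@integral_le_bound _ _ _ leb _ (EFin \o w)) => //.
      by apply: measurable_int; apply: (integrableS _ _ _ iw).
    by apply: filterS wM => x /= h [Bx _]; rewrite lee_fin; exact: h.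
  by rewrite EFinM lee_wpmul2l// ltW.
have E3 : \int[leb]_(x in B) (w x * (2 * \1_S x - 1)) <=
    `|\int[leb]_(x in B) w x| + 4 * (\sum_l s 0 l) * t.
  apply: le_trans (sum_cells_le_TV (@rounds d n) s0 iw tw).
  rewrite (Rintegral_cells (@rounds d n) s0 isg) (le_trans (ler_norm _))//.
  apply: le_trans (ler_norm_sum _ _ _) _; rewrite !big_seq; apply: ler_sum => b bc.
  have ib := integrable_sub_box (cells_sub s0 bc) iw.
  by rewrite (Rintegral_sign (measurable_open_box _ _) ib (aS b bc)).
have E4 : 2 * (M * (e / (2 * M + 1))) <= e.
  rewrite !mulrA ler_pdivrMr; first by nra.
  by rewrite ltr_wpDl// mulr_ge0.
by move: E1 E2 E3 E4; lra.
Qed.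

(** [poincare_box] on every cell: the variations on the cells add up to at most
    [t], and the constant shrinks with the cells. *)
Lemma poincare_cells ds a s w M t : (forall l, 0 < s 0 l) ->
  leb.-integrable (open_box a s) (EFin \o w) ->
  0 <= M -> {ae leb, forall x, open_box a s x -> `|w x| <= M} ->
  (TV (open_box a s) w <= t%:E)%E ->
  \int[leb]_(x in open_box a s) `|w x| <=
  \sum_(b <- cells ds a s) `|\int[leb]_(x in open_box b (cell_sides ds s)) w x|
  + 4 * (\sum_l cell_sides ds s 0 l) * t.
Proof.
elim: ds a s t => [|i ds IH] a s t s0 iw M0 wM tw /=.
  by rewrite big_seq1; exact: poincare_box wM tw.
have h0 := halve_gt0 i s0; have s0' l : 0 <= s 0 l by exact: ltW.
have [t1 [t2 [tw1 tw2 t12]]] := TV_split_halves i s0 iw tw.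
have iw1 := integrable_sub_box (sub_lower_half s0') iw.
have iw2 := integrable_sub_box (sub_upper_half s0') iw.
have wM1 : {ae leb, forall x, open_box a (halve i s) x -> `|w x| <= M}.
  by apply: filterS wM => x h /(sub_lower_half s0'); exact: h.
have wM2 : {ae leb, forall x, open_box (midpoint i a s) (halve i s) x -> `|w x| <= M}.
  by apply: filterS wM => x h /(sub_upper_half s0'); exact: h.
have H1 := IH _ _ _ h0 (iw1 i) M0 wM1 tw1.
have H2 := IH _ _ _ h0 (iw2 i) M0 wM2 tw2.
rewrite big_cat /= (@Rintegral_halves _ _ i _ _ s0'); last first.
  by apply: integrable_norm.
set S := \sum_l cell_sides ds _ _ _ in H1 H2 *.
have S0 : 0 <= S by apply: sumr_ge0 => l _; apply/ltW/cell_sides_gt0.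
have : S * (t1 + t2) <= S * t by exact: ler_wpM2l.
by move: H1 H2; lra.
Qed.

Lemma cube_partition_boxes (Omega : set V) h N (Q : 'I_N -> set V) :
  cube_partition Omega h Q -> exists a s : 'I_N -> V,
  [/\ forall k l, 0 < s k 0 l <= h, forall k, open_box (a k) (s k) `<=` Q k &
      forall k, Q k `<=` closed_box (a k) (s k)].
Proof.
move=> [_ _ _ [s [s0 _ cQ]]].
have [a aQ] := choice cQ.
exists a, (fun k => \row__ s k); split=> [k l|k x xB|k x xQ l].
- by rewrite mxE.
- by have [h1 _] := aQ k; apply: h1 => l; have := xB l; rewrite mxE.
- by have [_ h2] := aQ k; have := h2 _ xQ l; rewrite mxE.
Qed.

Lemma cube_partition_null (Omega : set V) h N (Q : 'I_N -> set V) (a s : 'I_N -> V) :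
  cube_partition Omega h Q -> (forall k l, 0 < s k 0 l <= h) ->
  (forall k, Q k `<=` closed_box (a k) (s k)) ->
  leb.-negligible (Omega `\` \bigcup_k open_box (a k) (s k)).
Proof.
move=> [_ _ QO _] s0 Qc; apply: (@negligibleS _ _ _ _
  (\bigcup_k (closed_box (a k) (s k) `\` open_box (a k) (s k)))).
  move=> x [Ox nx]; rewrite -QO in Ox; have [k _ Qx] := Ox.
  by exists k => //; split; [exact: Qc|move=> xB; apply: nx; exists k].
apply: negligible_bigcup_fin => k; apply: null_box_boundary => l.
by have /andP[/ltW] := s0 k l.
Qed.

(** Every cube is cut until the constants of [poincare_cells] add up to at most
    [r]; the integrals are those over the resulting cells. That the family of
    boxes depends on [r] only makes this a compactness estimate. *)
Lemma L1_le_integrals_TV (Omega : set V) h N (Q : 'I_N -> set V) (r : R) :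
  measurable Omega -> cube_partition Omega h Q -> 0 < h -> 0 < r ->
  exists Ks : seq (V * V),
   (forall K, K \in Ks -> open_box K.1 K.2 `<=` Omega) /\
   forall w M t, leb.-integrable Omega (EFin \o w) -> 0 <= M ->
     {ae leb, forall x, Omega x -> `|w x| <= M} -> (TV Omega w <= t%:E)%E ->
   \int[leb]_(x in Omega) `|w x| <=
     \sum_(K <- Ks) `|\int[leb]_(x in open_box K.1 K.2) w x| + r * t.
Proof.
move=> mO Qp h0 r0; have [a [s [s0 aQ Qc]]] := cube_partition_boxes Qp.
have s0' k l : 0 < s k 0 l by have /andP[] := s0 k l.
have QO k : Q k `<=` Omega by have [_ _ <- _] := Qp; exact: bigcup_sup.
have aO k : open_box (a k) (s k) `<=` Omega by exact: subset_trans (QO k).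
have [n hn] : exists n, N%:R * (4 * (2^-1 ^+ n * (d%:R * h))) <= r.
  have c0 : (N%:R * (4 * (2^-1 ^+ n * (d%:R * h)))) @[n --> \oo] --> (0 : R).
    rewrite -[X in _ --> X](mulr0 N%:R); apply: cvgMl_tmp.
    rewrite -[X in _ --> X](mulr0 4); apply: cvgMl_tmp.
    rewrite -[X in _ --> X](mul0r (d%:R * h)); apply: cvgMr_tmp.
    by apply: cvg_expr; rewrite gtr0_norm ?invr_gt0// invf_lt1// ltr1n.
  by have [n _ /(_ n (leqnn n)) /ltW H] := cvgr_lt _ c0 r r0; exists n.
pose ds := @rounds d n.
pose Kk (k : 'I_N) := [seq (b, cell_sides ds (s k)) | b <- cells ds (a k) (s k)].
exists (flatten [seq Kk k | k <- enum 'I_N]); split.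
  move=> K /flatten_mapP[k _ /mapP[b bc ->]] /=.
  apply: subset_trans (aO k); exact: cells_sub.
move=> w M t iw M0 wM tw.
have t0 : 0 <= t by rewrite -lee_fin (le_trans (TV_ge0 _ _) tw).
have iabs : leb.-integrable Omega (EFin \o (fun x => `|w x|)) by exact: integrable_norm.
have -> : \int[leb]_(x in Omega) `|w x| =
    \sum_k \int[leb]_(x in open_box (a k) (s k)) `|w x|.
  pose F k := open_box (a k) (s k).
  have mF k : measurable (F k) by exact: measurable_open_box.
  have FE : \bigcup_k F k = \big[setU/set0]_(k <- enum 'I_N) F k.
    rewrite -bigcup_seq; apply/seteqP; split=> x [k _ Fk]; exists k => //=.
    by rewrite mem_enum.
  have mUF : measurable (\bigcup_k F k) by rewrite FE; exact: bigsetU_measurable.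
  have UFO : \bigcup_k F k `<=` Omega by move=> x [k _ /aO].
  have mN : measurable (Omega `\` \bigcup_k F k) by exact: measurableD.
  have N0 := measure_negligible mN (cube_partition_null Qp s0 Qc).
  rewrite {1}/Rintegral (negligible_integral mN mO iabs N0) setDD setIidr//.
  have tF : trivIset setT F.
    move=> k l _ _ [x [xk xl]]; case: Qp => _ tQ _ _.
    by apply: (tQ k l) => //; exists x; split; exact: aQ.
  have fin k : (\int[leb]_(x in F k) (`|w x|)%:E)%E \is a fin_num.
    apply: integrable_fin_num => //; exact: (integrableS mO (mF k) (aO k) iabs).
  rewrite FE ge0_integral_bigsetU ?enum_uniq//.
  - by rewrite -sum_fine ?big_enum// => k _; exact: fin.
  - exact: sub_trivIset tF.
  - rewrite -FE; apply: measurable_int.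
    exact: (integrableS mO mUF UFO iabs).
  - by move=> x _; rewrite /= lee_fin.
rewrite big_flatten /= big_map big_enum /=.
apply: (@le_trans _ _ (\sum_k (\sum_(K <- Kk k) `|\int[leb]_(x in open_box K.1 K.2) w x| +
    4 * (2^-1 ^+ n * (d%:R * h)) * t))).
  apply: ler_sum => k _; rewrite big_map.
  have iwk : leb.-integrable (open_box (a k) (s k)) (EFin \o w).
    by apply: (integrableS _ _ _ iw) => //; exact: measurable_open_box.
  have wMk : {ae leb, forall x, open_box (a k) (s k) x -> `|w x| <= M}.
    by apply: filterS wM => x H /aO; exact: H.
  have twk : (TV (open_box (a k) (s k)) w <= t%:E)%E.
    by apply: le_trans tw; apply: le_TV => //; exact: measurable_open_box.
  apply: le_trans (poincare_cells ds (s0' k) iwk M0 wMk twk) _.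
  rewrite lerD2l ler_wpM2r// ler_wpM2l//.
  under eq_bigr do rewrite cell_sides_rounds mxE.
  rewrite -mulr_sumr ler_wpM2l ?exprn_ge0//.
  apply: (@le_trans _ _ (\sum_(l < d) h)).
    by apply: ler_sum => l _; have /andP[] := s0 k l.
  by rewrite sumr_const card_ord mulr_natl.
rewrite big_split /= lerD2l sumr_const card_ord -[X in X <= _]mulr_natl.
by rewrite (mulrA N%:R _ t) ler_wpM2r.
Qed.

End poincare.

(** * The space of square-integrable functions *)

Section lebesgue_on.
Context {R : realType} {d : nat} {Omega : set 'rV[R]_d} {oO : open Omega}.
Local Notation V := 'rV[R]_d.
Local Notation leb := (lebesgue_rV R d).
Local Notation mu := (lebesgue_on oO).
Local Notation H := (L2 (lebesgue_on oO)).
Implicit Types (f g : H).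

Lemma measurable_Omega : measurable Omega.
Proof. exact: open_measurable_rV. Qed.
Let mO := measurable_Omega.

Lemma lebesgue_onC : mu (~` Omega) = 0%E.
Proof. by rewrite /lebesgue_on /= /mrestr setICl measure0. Qed.

Lemma ae_lebesgue_on (P : V -> Prop) :
  {ae leb, forall x, Omega x -> P x} <-> {ae mu, forall x, P x}.
Proof.
split=> -[N [mN N0 hN]].
  exists (N `|` ~` Omega); split.
  - by apply: measurableU => //; exact: measurableC.
  - rewrite /lebesgue_on /= /mrestr setIUl setICl setU0.
    apply/eqP; rewrite -measure_le0 -N0; apply: le_measure; rewrite ?inE//.
    exact: measurableI.
  - move=> x nP; have [Ox|Ox] := pselect (Omega x); last by right.
    by left; apply: hN => /= h; apply: nP; exact: h.
exists (N `&` Omega); split => //; first exact: measurableI.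
move=> x /= /not_implyP[Ox nP]; split=> //; exact: hN.
Qed.

Lemma ge0_integral_lebesgue_on (h : V -> \bar R) : measurable_fun setT h ->
  (forall x, 0 <= h x)%E -> (\int[mu]_x h x = \int[leb]_(x in Omega) h x)%E.
Proof.
move=> mh h0; rewrite (@ge0_negligible_integral _ _ _ _ setT (~` Omega))//.
- rewrite setTD setCK; apply: eq_measure_integral => A mA AO.
  by rewrite /lebesgue_on /= /mrestr setIidl.
- exact: measurableC.
- exact: lebesgue_onC.
Qed.

Lemma integrable_lebesgue_on (h : V -> R) : measurable_fun setT h ->
  leb.-integrable Omega (EFin \o h) <-> mu.-integrable setT (EFin \o h).
Proof.
move=> mh.
have E : (\int[mu]_x `|(EFin \o h) x| = \int[leb]_(x in Omega) `|(EFin \o h) x|)%E.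
  apply: ge0_integral_lebesgue_on => // .
  by apply: measurableT_comp => //; exact/measurable_EFinP.
split=> /integrableP[_ hoo]; apply/integrableP; split.
- exact/measurable_EFinP.
- by rewrite E.
- by apply: measurable_funTS; exact/measurable_EFinP.
- by rewrite -E.
Qed.

Lemma L2_measurable f : measurable_fun setT f.
Proof. by rewrite /L2_fun. Qed.

Lemma L2_Lfun f : (f : V -> R) \in Lfun mu 2%:E.
Proof. exact: LfunP. Qed.

Lemma L2_norm_EFin f : (`|f|)%:E = 'N[mu]_2%:E [EFin \o f]%E.
Proof.
rewrite L2_normE fineK// ge0_fin_numE ?Lnorm_ge0//.
by have := L2_Lfun f; rewrite inE => /andP[_]; rewrite inE.
Qed.

Lemma L2_norm_sqr f : (`|f| ^+ 2)%:E = (\int[leb]_(x in Omega) (f x ^+ 2)%:E)%E.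
Proof.
rewrite -ge0_integral_lebesgue_on; last 2 first.
- by apply/measurable_EFinP/measurable_funX; exact: L2_measurable.
- by move=> x; rewrite lee_fin sqr_ge0.
have := @powR_Lnorm _ _ _ mu (EFin \o f) 2 (lt0r_neq0 (ltr0n _ 2)).
rewrite -L2_norm_EFin /= powR_mulrn// => ->.
apply: eq_integral => x _; rewrite powR_mulrn//.
by rewrite real_normK ?num_real.
Qed.

Lemma L2_mul_integrable f g : leb.-integrable Omega (EFin \o (fun x => f x * g x)).
Proof.
apply/integrable_lebesgue_on.
  by apply: measurable_funM; exact: L2_measurable.
apply/Lfun1_integrable; exact: (Lfun2_mul_Lfun1 (L2_Lfun f) (L2_Lfun g)).
Qed.

Lemma cauchy_schwarz f g : \int[leb]_(x in Omega) `|f x * g x| <= `|f| * `|g|.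
Proof.
have iabs : leb.-integrable Omega (EFin \o (fun x => `|f x * g x|)).
  exact: (integrable_norm (L2_mul_integrable f g)).
rewrite -lee_fin /Rintegral fineK; last exact: integrable_fin_num.
rewrite -ge0_integral_lebesgue_on; last 2 first.
- apply/measurable_EFinP; apply: measurableT_comp => //.
  by apply: measurable_funM; exact: L2_measurable.
- by move=> x; rewrite lee_fin.
have two : (2^-1 + 2^-1 = 1 :> R)%R by rewrite [RHS]splitr !div1r.
have := hoelder mu (L2_measurable f) (L2_measurable g) (ltr0n _ 2) (ltr0n _ 2) two.
by rewrite Lnorm1 EFinM !L2_norm_EFin.
Qed.

Lemma L2_of_bounded (h : V -> R) M : leb.-integrable Omega (EFin \o (cst 1 : V -> R)) ->
  measurable_fun setT h -> (forall x, `|h x| <= M) ->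
  exists f, (f : V -> R) = h %[ae mu].
Proof.
move=> i1 mh hM.
have M0 : 0 <= M by exact: le_trans (hM 0).
have hL : h \in Lfun mu 2%:E.
  rewrite inE; apply/andP; split; rewrite inE//=.
  rewrite /finite_norm unlock; apply: poweR_lty.
  apply: (@le_lt_trans _ _ (\int[mu]_x (M ^+ 2)%:E)%E).
    apply: ge0_le_integral => //.
    - by move=> x _; exact: poweR_ge0.
    - apply: (measurableT_comp (measurable_poweR _)).
      by apply: measurableT_comp => //; exact: measurableT_comp.
    - move=> x _ /=; rewrite powR_mulrn// lee_fin -[leRHS]real_normK ?num_real//.
      rewrite (ger0_norm M0).
      by rewrite ler_sqr ?nnegrE.
  rewrite integral_cst// lte_mul_pinfty ?lee_fin ?sqr_ge0//.
  have : mu.-integrable setT (EFin \o (cst 1 : V -> R)).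
    exact/integrable_lebesgue_on.
  move=> /integrableP[_]; rewrite (_ : (fun x => _) = cst 1%E); last first.
    by apply/funext => x /=; rewrite normr1.
  by rewrite integral_cst// mul1e.
exists (L2_class (Lfun_Sub (lee1n 2) hL)).
exact: L2_classE.
Qed.

Lemma L2_sub_ae f g : {ae mu, forall x, (f - g : H) x = f x - g x}.
Proof.
have -> : f - g = f + (-1) *: g by rewrite scaleN1r.
have h1 := L2_addE f ((-1) *: g); have h2 := L2_scaleE (-1) g.
by apply: filterS2 h1 h2 => x /(_ I) -> /(_ I) ->; rewrite mulN1r.
Qed.

Lemma L2_lin_ae (k : R) f g : {ae mu, forall x, (k *: f + g : H) x = k * f x + g x}.
Proof.
have h1 := L2_addE (k *: f) g; have h2 := L2_scaleE k f.
by apply: filterS2 h1 h2 => x /(_ I) -> /(_ I) ->.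
Qed.

(** The Cauchy-Schwarz inequality against the constant one, which is square
    integrable as the volume is finite. *)
Lemma L2_L1 : bounded_set Omega -> exists2 c, 0 <= c & forall f,
  leb.-integrable Omega (EFin \o f) /\ \int[leb]_(x in Omega) `|f x| <= c * `|f|.
Proof.
move=> bO.
have i1 : leb.-integrable Omega (EFin \o (cst 1 : V -> R)).
  apply: measurable_bounded_integrable => //; first exact: bounded_lebesgue_lty.
  exists 1; split=> [|r r1 x _]; first exact: num_real.
  by rewrite /= normr1 ltW.
have [one one1] : exists f : H, (f : V -> R) = (fun=> 1) %[ae mu].
  by apply: (@L2_of_bounded _ 1) => // x; rewrite normr1.
exists `|one| => // f.
have ae1 : {ae leb, forall x, Omega x -> f x * one x = f x}.
  by apply/ae_lebesgue_on; apply: filterS one1 => x /(_ I) ->; rewrite mulr1.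
have iF : leb.-integrable Omega (EFin \o f).
  apply/(integrable_lebesgue_on (L2_measurable f))/Lfun1_integrable.
  apply: Lfun_subset12 (L2_Lfun f); rewrite ge0_fin_numE//.
  by rewrite /lebesgue_on /= /mrestr setTI; exact: bounded_lebesgue_lty.
split=> //; rewrite mulrC; apply: le_trans (cauchy_schwarz f one).
rewrite le_eqVlt; apply/orP; left; apply/eqP; congr fine.
apply: ge0_ae_eq_integral => //.
- by apply: measurable_int (integrable_norm iF).
- by apply: measurable_int (integrable_norm (L2_mul_integrable f one)).
- by apply: filterS ae1 => x h Ox; rewrite h.
Qed.

End lebesgue_on.

(** * Convergence of sequences *)

Lemma cvg_norm_le (R : realType) (W W' : normedModType R) (x_ : nat -> W) (x : W) (y_ : nat -> W')
    (y : W') (K : R) : 0 <= K -> (forall n, `|x_ n - x| <= K * `|y_ n - y|) ->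
  y_ n @[n --> \oo] --> y -> x_ n @[n --> \oo] --> x.
Proof.
move=> K0 xy cy; have K1 : 0 < K + 1 by rewrite ltr_wpDl.
apply/cvgrPdist_le => e e0; near=> n; rewrite distrC (le_trans (xy n))//.
apply: (@le_trans _ _ ((K + 1) * `|y_ n - y|)); first by rewrite ler_wpM2r// lerDl.
rewrite -ler_pdivlMl// distrC; near: n.
have e1 : 0 < (K + 1)^-1 * e by rewrite mulr_gt0// invr_gt0.
by have /cvgrPdist_le := cy; apply.
Unshelve. all: by end_near. Qed.

(** An ultrafilter finer than [\oo] picks the limits. The indices beyond [j] at
    which the first [j.+1] sequences are close to their limits form a set of
    the ultrafilter, hence a nonempty one; this replaces a diagonal argument. *)
Lemma common_subsequence {R : realType} (I : countType) (g : I -> nat -> R) :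
  (forall i, exists M : R, forall n, `|g i n| <= M) ->
  exists n_ : nat -> nat, (forall j, (j <= n_ j)%N) /\
  exists l : I -> R, forall i, g i (n_ j) @[j --> \oo] --> l i.
Proof.
move=> bg.
have [G [UG ooG]] := @ultraFilterLemma nat \oo eventually_filter.
have GF : ProperFilter G by exact: ultra_proper.
have lim i : exists l, forall e : R, 0 < e -> G [set n | `|g i n - l| < e].
  have [M gM] := bg i.
  have cM : compact (`[- M, M]%classic : set R) by exact: segment_compact.
  have GM : (g i @ G) `[- M, M]%classic.
    apply: (@filterS _ G _ setT) => [n _|]; last exact: filterT.
    by have := gM n; rewrite ler_norml /= in_itv.
  have [l [_ cl]] := cM _ _ GM; exists l => e e0.
  have [//|nG] := in_ultra_setVsetC [set n | `|g i n - l| < e] UG.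
  have nl : nbhs l (ball l e) by exact: nbhsx_ballx.
  have nG' : G (g i @^-1` (~` ball l e)).
    apply: (@filterS _ G _ _ _ _ nG) => n /= h; apply: contra_not h.
    by rewrite -ball_normE /ball_ /= distrC.
  by have [y []] := cl (~` ball l e) (ball l e) nG' nl.
have [l hl] := choice lim.
pose S j := [set n | (j <= n)%N /\ forall k : 'I_j.+1,
  if unpickle k is Some i then `|g i n - l i| < j.+1%:R^-1 else true].
have GS j : G (S j).
  apply: filterI; first by apply: ooG; exact: nbhs_infty_ge.
  apply: filter_forall => k.
  case: (unpickle k) => [i|]; last by apply: (filterS _ (@filterT _ G _)).
  by apply: hl; rewrite invr_gt0.
have [n_ hn] := choice (fun j => filter_ex (GS j)).
exists n_; split=> [j|]; first by have [] := hn j.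
exists l => i; apply/cvgrPdist_lt => e e0; near=> j.
have [_ /(_ (inord (pickle i)))] := hn j.
have ij : (pickle i <= j)%N by near: j; exact: nbhs_infty_ge.
rewrite inordK ?ltnS// pickleK distrC => /lt_trans; apply.
near: j; exact: (near_infty_natSinv_lt (PosNum e0)).
Unshelve. all: by end_near. Qed.

Section bounded_L1_cauchy.
Context d (T : measurableType d) (R : realType) (mu : {measure set T -> \bar R}).
Variables (D : set T) (mD : measurable D) (v : nat -> T -> R) (M : R).
Hypothesis mv : forall k, measurable_fun setT (v k).
Hypothesis vM : forall k x, `|v k x| <= M.

(** The sum of the absolute increments has a finite integral, so that it is
    finite and the sequence converges almost everywhere. Elsewhere the upper
    limit, clamped to the bound, is a measurable choice. *)
Lemma rapidly_cauchy_ae :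
  (forall k, (\int[mu]_(x in D) (`|v k.+1 x - v k x|)%:E <= (1 / (2 ^ k.+1)%:R)%:E)%E) ->
  exists w : T -> R, [/\ measurable_fun setT w, forall x, `|w x| <= M &
    {ae mu, forall x, D x -> v k x @[k --> \oo] --> w x}].
Proof.
move=> vk.
pose h k x : \bar R := (`|v k.+1 x - v k x|)%:E.
have mh k : measurable_fun D (h k).
  apply/measurable_EFinP; apply: measurable_funTS; apply: measurableT_comp => //.
  exact: measurable_funB.
have h0 k x : D x -> (0 <= h k x)%E by rewrite lee_fin.
have ih : (\int[mu]_(x in D) (\sum_(k <oo) h k x) < +oo)%E.
  rewrite integral_nneseries//.
  apply: (@le_lt_trans _ _ 1%:E); last exact: ltry.
  apply: le_trans (epsilon_trick0 xpredT (@ler01 R)).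
  apply: lee_nneseries => [k _ _|k _]; last exact: vk.
  by apply: integral_ge0 => x Dx; exact: h0.
have mS : measurable_fun D (fun x => (\sum_(k <oo) h k x)%E).
  by apply: ge0_emeasurable_sum => [k x Dx _|k _]; [exact: h0|exact: mh].
have S0 x : D x -> (0 <= \sum_(k <oo) h k x)%E.
  by move=> Dx; apply: nneseries_ge0 => k _ _; exact: h0.
have aeS : {ae mu, forall x, D x -> (\sum_(k <oo) h k x)%E \is a fin_num}.
  apply: integrable_ae => //; apply/integrableP; split => //.
  by under eq_integral => x /set_mem Dx do rewrite gee0_abs ?S0//.
pose clamp (r : R) := Num.max (- M) (Num.min M r).
pose w0 x := fine (limn_esup (fun k => (v k x)%:E)).
exists (fun x => clamp (w0 x)).
have mw0 : measurable_fun setT w0.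
  apply: measurableT_comp => //; apply: measurable_fun_limn_esup => k.
  exact/measurable_EFinP.
split.
- by apply: measurable_maxr => //; apply: measurable_minr.
- move=> x; have M0 : 0 <= M by exact: le_trans (vM 0%N x).
  rewrite /clamp ler_norml le_max lexx ge_max ge_min lexx /= andbT.
  by rewrite (le_trans _ M0)// oppr_le0.
apply: filterS aeS => x Sx Dx; have {}Sx := Sx Dx.
have cv : cvgn (v ^~ x).
  have -> : v ^~ x = (fun n => v 0%N x + series (telescope (v ^~ x)) n).
    by apply/funext => n; exact: eq_sum_telescope.
  apply: is_cvgD; first exact: is_cvg_cst.
  apply: normed_cvg; apply: nondecreasing_is_cvgn.
    apply/nondecreasing_seqP => n; rewrite /= !seriesEnat /= big_nat_recr//= lerDl.
    exact: normr_ge0.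
  exists (fine (\sum_(k <oo) h k x)%E) => _ [n _ <-].
  rewrite -lee_fin fineK// /= seriesEnat /= -sumEFin.
  by apply: (nneseries_lim_ge (P := xpredT)) => k _ _; exact: h0.
have /cvg_ex[l vl] := cv.
have lM : `|l| <= M.
  have vn : `|v k x| @[k --> \oo] --> `|l : R| by exact: cvg_norm vl.
  rewrite -(cvg_lim _ vn)//.
  apply: limr_le; first exact: cvgP vn.
  by apply: nearW => k; exact: vM.
have w0l : w0 x = l.
  rewrite /w0 (_ : limn_esup _ = l%:E)//.
  by apply: (cvg_limn_einf_sup _).2; apply: cvg_EFin; [exact: nearW|exact: vl].
rewrite w0l /clamp; move: lM; rewrite ler_norml => /andP[l1 l2].
by rewrite min_r// max_r.
Qed.

End bounded_L1_cauchy.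

(** * Compactness of bounded variation *)

Section BV_compactness.
Context {R : realType} {d : nat} {Omega : set 'rV[R]_d} {oO : open Omega}.
Local Notation V := 'rV[R]_d.
Local Notation leb := (lebesgue_rV R d).
Local Notation H := (L2 (lebesgue_on oO)).
Hypothesis bO : bounded_set Omega.
Implicit Types (f g w : H).

Let mO : measurable Omega. Proof. exact: measurable_Omega. Qed.

Let lebO : (leb Omega < +oo)%E. Proof. exact: bounded_lebesgue_lty. Qed.

Lemma integrable_Omega_cst (c : R) : leb.-integrable Omega (EFin \o (cst c : V -> R)).
Proof.
apply: measurable_bounded_integrable => //.
exists `|c|; split=> [|r r1 x _]; first exact: num_real.
by rewrite /= ltW.
Qed.

Lemma L2_integrable f : leb.-integrable Omega (EFin \o f).
Proof. by have [c _ /(_ f)[]] := L2_L1 (oO := oO) bO. Qed.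

Lemma integrable_sub (D : set V) (u v : V -> R) : measurable D ->
  leb.-integrable D (EFin \o u) -> leb.-integrable D (EFin \o v) ->
  leb.-integrable D (EFin \o (fun x => u x - v x)).
Proof. by move=> mD iu iv; exact: (integrableB mD iu iv). Qed.

Lemma L2_sub_ae_Omega f g : {ae leb, forall x, Omega x -> (f - g : H) x = f x - g x}.
Proof. by apply/(@ae_lebesgue_on _ _ _ oO); exact: L2_sub_ae. Qed.

(** Dominated convergence for the squared differences, the constants being
    integrable on a bounded set. *)
Lemma L2_dominated_cvg (f_ : nat -> H) f (M : R) :
  (forall n, {ae leb, forall x, Omega x -> `|f_ n x| <= M}) ->
  {ae leb, forall x, Omega x -> f_ n x @[n --> \oo] --> f x} ->
  f_ n @[n --> \oo] --> f.
Proof.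
move=> fM fcv.
pose h_ n x : \bar R := ((f_ n - f : H) x ^+ 2)%:E.
have aeE : {ae leb, forall x, Omega x -> forall n, (f_ n - f : H) x = f_ n x - f x}.
  have : {ae leb, forall x n, Omega x -> (f_ n - f : H) x = f_ n x - f x}.
    by apply: ae_foralln => n; exact: L2_sub_ae_Omega.
  by apply: filterS => x h Ox n; exact: h.
have aeM : {ae leb, forall x, Omega x -> forall n, `|f_ n x| <= M}.
  have : {ae leb, forall x n, Omega x -> `|f_ n x| <= M} by exact: ae_foralln.
  by apply: filterS => x h Ox n; exact: h.
have [|||||_ _ cv] := @dominated_convergence _ _ _ leb Omega mO h_ (cst 0%E)
    (cst ((2 * M) ^+ 2)%:E).
- move=> n; apply/measurable_EFinP; apply: measurable_funTS.
  by apply: measurable_funX; exact: L2_measurable.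
- exact: measurable_cst.
- apply: filterS2 aeE fcv => x hE hcv Ox.
  have E n : h_ n x = ((f_ n x - f x) ^+ 2)%:E by rewrite /h_ hE.
  rewrite (funext E); apply: cvg_EFin; first exact: nearW.
  have : (f_ n x - f x) ^+ 2 @[n --> \oo] --> ((f x - f x) ^+ 2 : R).
    by apply: cvgM; (apply: cvgB; [exact: hcv|exact: cvg_cst]).
  by rewrite subrr expr0n.
- exact: integrable_Omega_cst.
- apply: filterS2 (filterI aeE aeM) fcv => x [hE hM] hcv n Ox.
  rewrite /h_ hE// lee_fin ger0_norm ?sqr_ge0//.
  have fxM : `|f x| <= M.
    have vn : `|f_ n x| @[n --> \oo] --> `|f x| by apply: cvg_norm; exact: hcv.
    rewrite -(cvg_lim _ vn)//; apply: limr_le; first exact: cvgP vn.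
    by apply: nearW => k; exact: hM.
  have M0 : 0 <= M by exact: le_trans fxM.
  rewrite -real_normK ?num_real// ler_sqr ?nnegrE// ?mulr_ge0//.
  by rewrite (le_trans (ler_normB _ _))// mulr_natl mulr2n lerD// hM.
rewrite integral0 in cv.
apply/cvgrPdist_lt => e e0; near=> n.
rewrite distrC -[ltLHS]normr_id -[e]gtr0_norm// -ltr_sqr ?nnegrE// !real_normK ?num_real//.
rewrite -lte_fin L2_norm_sqr; near: n.
have e2 : (0 < (e ^+ 2)%:E)%E by rewrite lte_fin exprn_gt0.
exact: (cv _ (open_ereal_lt' e2)).
Unshelve. all: by end_near. Qed.

Lemma divergence_pairing_cvg (f_ : nat -> H) f phi : test_field Omega phi ->
  f_ n @[n --> \oo] --> f ->
  \int[leb]_(x in Omega) (f_ n x * divergence phi x) @[n --> \oo] -->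
  \int[leb]_(x in Omega) (f x * divergence phi x).
Proof.
move=> tphi fcv; have [M M0 phiM] := divergence_bounded tphi.
have [c c0 hc] := L2_L1 (oO := oO) bO.
have B n : `|\int[leb]_(x in Omega) (f_ n x * divergence phi x) -
    \int[leb]_(x in Omega) (f x * divergence phi x)| <= M * c * `|f_ n - f|.
  have ip g := integrable_mul_divergence mO tphi (L2_integrable g).
  have mp g : measurable_fun Omega (fun x => g x * divergence phi x).
    by apply/measurable_EFinP; exact: measurable_int (ip g).
  rewrite -RintegralB//; try exact: ip.
  have -> : \int[leb]_(x in Omega) (f_ n x * divergence phi x - f x * divergence phi x) =
     \int[leb]_(x in Omega) ((f_ n - f : H) x * divergence phi x).
    congr fine; apply: ae_eq_integral => //.
    - by apply/measurable_EFinP; apply: measurable_funB; exact: mp.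
    - exact: measurable_int (ip _).
    - apply: filterS (L2_sub_ae_Omega (f_ n) f) => x h Ox.
      by rewrite h// mulrBl.
  apply: le_trans (le_normr_Rintegral mO (ip _)) _.
  apply: (@le_trans _ _ (\int[leb]_(x in Omega) (M * `|(f_ n - f : H) x|))).
    apply: le_Rintegral => //.
    - exact: integrable_norm (ip _).
    - rewrite (_ : EFin \o _ = (fun x => M%:E * (`|(f_ n - f : H) x|)%:E)%E) //.
      by apply: integrableZl => //; exact: integrable_norm (L2_integrable _).
    - by move=> x _; rewrite normrM mulrC ler_wpM2r.
  rewrite RintegralZl//; last exact: integrable_norm (L2_integrable _).
  by rewrite -mulrA ler_wpM2l//; exact: (hc _).2.
by apply: (@cvg_norm_le _ R H _ _ _ _ _ (mulr_ge0 M0 c0) B fcv).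
Qed.

(** The variations of the differences are at most [2 * t], so that by
    [L1_le_integrals_TV] a subsequence along which countably many integrals
    converge is Cauchy in [L^1]. A rapidly Cauchy subsequence of it converges
    almost everywhere, and in [L^2] by the uniform bound. *)
Lemma BV_compact h N (Q : 'I_N -> set V) (W : nat -> H) (M t : R) :
  0 < h -> cube_partition Omega h Q -> 0 <= M ->
  (forall n, {ae leb, forall x, Omega x -> `|W n x| <= M}) ->
  (forall n, (TV Omega (W n) <= t%:E)%E) ->
  exists n_ : nat -> nat, (forall j, (j <= n_ j)%N) /\
  exists w : H, W (n_ j) @[j --> \oo] --> w /\
    {ae leb, forall x, Omega x -> W (n_ j) x @[j --> \oo] --> w x}.
Proof.
move=> h0 Qp M0 WM Wt.
have t0 : 0 <= t by rewrite -lee_fin (le_trans (TV_ge0 _ _) (Wt 0%N)).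
have /choice[Ks hKs] k := L1_le_integrals_TV mO Qp h0 (r := k.+1%:R^-1) ltac:(by rewrite invr_gt0).
have KO k K : K \in Ks k -> open_box K.1 K.2 `<=` Omega by exact: (hKs k).1.
pose I n (K : V * V) := \int[leb]_(x in open_box K.1 K.2) W n x.
have iK n k K : K \in Ks k -> leb.-integrable (open_box K.1 K.2) (EFin \o W n).
  move=> Kk; apply: (integrableS mO _ (KO _ _ Kk) (L2_integrable _)).
  exact: measurable_open_box.
have IM n k K : K \in Ks k -> `|I n K| <= M * fine (leb Omega).
  move=> Kk; have mK := measurable_open_box K.1 K.2.
  apply: le_trans (le_normr_Rintegral mK (iK n _ _ Kk)) _.
  have iN := integrable_norm (iK n _ _ Kk).
  rewrite -lee_fin /Rintegral fineK; last exact: integrable_fin_num.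
  rewrite EFinM fineK ?ge0_fin_numE//.
  apply: (@le_trans _ _ (M%:E * leb (open_box K.1 K.2))%E); last first.
    by rewrite lee_wpmul2l// le_measure ?inE//; exact: KO Kk.
  apply: (@integral_le_bound _ _ _ leb _ (EFin \o W n)) => //.
    exact: measurable_int (iK n _ _ Kk).
  by apply: filterS (WM n) => x /= hx xK; rewrite lee_fin; apply: hx; exact: KO Kk _ xK.
(* the integrals for all the accuracies, as one family indexed by pairs *)
pose g (ki : nat * nat) n := if (ki.2 < size (Ks ki.1))%N then I n (nth 0 (Ks ki.1) ki.2) else 0.
have [ki|n1 [n1j [l gl]]] := common_subsequence (g := g).
  exists (M * fine (leb Omega)) => n; rewrite /g; case: ifP => hi.
    by apply: IM (mem_nth 0 hi).
  by rewrite normr0 mulr_ge0// fine_ge0.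
pose v j := W (n1 j).
have vcauchy (e : R) : 0 < e -> exists N0 : nat, forall j k, (N0 <= j)%N -> (N0 <= k)%N ->
    \int[leb]_(x in Omega) `|v j x - v k x| <= e.
  move=> e0; have d0 : 0 < e / (4 * t + 2) by rewrite divr_gt0// ltr_wpDl// mulr_ge0.
  have [k _ /(_ k (leqnn k)) hk] := near_infty_natSinv_lt (PosNum d0).
  (* half of [e] is for the variation, the other half for the integrals *)
have kt : k.+1%:R^-1 * (2 * t) <= e / 2.
    apply: (@le_trans _ _ (e / (4 * t + 2) * (2 * t))).
      by rewrite ler_wpM2r ?mulr_ge0// ltW.
    rewrite mulrAC ler_pdivrMr; first by nra.
    by rewrite ltr_wpDl// mulr_ge0.
  set S := size (Ks k).
  have dS : 0 < e / (4 * S.+1%:R) by rewrite divr_gt0// mulr_gt0.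
  have [N0 _ hN0] : \forall j \near \oo, forall i : 'I_S,
      `|l (k, val i) - g (k, val i) (n1 j)| <= e / (4 * S.+1%:R).
    by apply: filter_forall => i; have /cvgrPdist_le := gl (k, val i); apply.
  exists N0 => j j' hj hj'.
  have iv n : leb.-integrable Omega (EFin \o v n) by exact: L2_integrable.
  have := (hKs k).2 (fun x => v j x - v j' x) (2 * M) (2 * t).
  move=> /(_ _ _ _ _)/le_trans -> //.
  - exact: integrable_sub.
  - by rewrite mulr_ge0.
  - apply: filterS2 (WM (n1 j)) (WM (n1 j')) => x h1 h2 Ox.
    by rewrite (le_trans (ler_normB _ _))// mulr_natl mulr2n lerD// ?h1 ?h2.
  - apply: le_trans (TV_sub_le mO (iv j) (iv j')) _.
    by rewrite mulr_natl mulr2n EFinD leeD// Wt.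
  rewrite [leRHS]splitr lerD// (big_nth 0) big_mkord.
  apply: (@le_trans _ _ (\sum_(i < S) (e / 2 / S.+1%:R))); last first.
    rewrite sumr_const card_ord -[X in X <= _]mulr_natr mulrAC ler_pdivrMr//.
    by rewrite ler_wpM2l ?ler_nat// divr_ge0// ltW.
  apply: ler_sum => i _; set K := nth _ _ _.
  have Kk : K \in Ks k by exact: mem_nth.
  have -> : \int[leb]_(x in open_box K.1 K.2) (v j x - v j' x) =
      I (n1 j) K - I (n1 j') K.
    by rewrite RintegralB//; [exact: measurable_open_box|exact: iK Kk|exact: iK Kk].
  have gE n : g (k, val i) n = I n K by rewrite /g /= ltn_ord.
  have := hN0 _ hj i; have := hN0 _ hj' i; rewrite !gE => h1 h2.
  rewrite -(subrKA (l (k, val i))) (le_trans (ler_normD _ _))//.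
  apply: le_trans (lerD (_ : _ <= e / (4 * S.+1%:R)) h1) _.
    by rewrite distrC.
  have : (0 : R) < S.+1%:R by [].
  set q := S.+1%:R => q0; rewrite le_eqVlt; apply/orP; left; apply/eqP; field.
  by rewrite gt_eqF.
have /choice[Nf hNf] k := vcauchy (1 / (2 ^ k.+1)%:R) ltac:(by rewrite divr_gt0// ltr0n expn_gt0).
(* increasing indices with [m k] beyond the Cauchy rank [Nf k] *)
pose m k := (\sum_(i < k.+1) (Nf i).+1)%N.
have mS k : (m k.+1 = m k + (Nf k.+1).+1)%N by rewrite /m big_ord_recr.
have mN k : (Nf k <= m k)%N by rewrite /m big_ord_recr /= (leq_trans (leqnSn _))// leq_addl.
have mk k : (k <= m k)%N.
  elim: k => [//|k IHk]; rewrite mS -addn1; apply: leq_add => //.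
(* bounded everywhere, and almost everywhere equal to the sequence *)
pose vc k (x : V) := Num.max (- M) (Num.min M (v (m k) x)).
have mvc k : measurable_fun setT (vc k).
  by apply: measurable_maxr => //; apply: measurable_minr.
have vcM k x : `|vc k x| <= M.
  rewrite /vc ler_norml le_max lexx ge_max ge_min lexx /= andbT.
  by rewrite (le_trans _ M0)// oppr_le0.
have vcE : {ae leb, forall x k, Omega x -> vc k x = v (m k) x}.
  apply: ae_foralln => k; apply: filterS (WM (n1 (m k))) => x hx Ox.
  have := hx Ox; rewrite ler_norml => /andP[l1 l2].
  by rewrite /vc min_r// max_r.
have [|w0 [mw0 w0M cw0]] := rapidly_cauchy_ae (mu := leb) mO mvc vcM.
  move=> k; have Nk : (Nf k <= m k.+1)%N by rewrite mS (leq_trans (mN k))// leq_addr.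
  have iv : leb.-integrable Omega (EFin \o (fun x => `|v (m k.+1) x - v (m k) x|)).
    apply: (@integrable_norm _ _ _ leb _ (fun x => v (m k.+1) x - v (m k) x)).
    by apply: integrable_sub => //; exact: L2_integrable.
  apply: le_trans (_ : (_ <= (\int[leb]_(x in Omega) `|v (m k.+1) x - v (m k) x|)%:E)%E) _.
    rewrite /Rintegral fineK; last exact: integrable_fin_num.
    rewrite le_eqVlt; apply/orP; left; apply/eqP; apply: ge0_ae_eq_integral => //.
    - apply/measurable_EFinP; apply: measurable_funTS; apply: measurableT_comp => //.
      exact: measurable_funB.
    - exact: measurable_int iv.
    - by apply: filterS vcE => x hx Ox; rewrite !hx.
  by rewrite lee_fin; apply: hNf.
have [w wE] : exists w : H, (w : V -> R) = w0 %[ae (lebesgue_on oO)].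
  exact: (L2_of_bounded (integrable_Omega_cst 1) mw0 w0M).
have cw : {ae leb, forall x, Omega x -> W (n1 (m k)) x @[k --> \oo] --> w x}.
  have wE' : {ae leb, forall x, Omega x -> w x = w0 x}.
    by apply/(@ae_lebesgue_on _ _ _ oO); apply: filterS wE => x; apply.
  apply: filterS3 cw0 wE' vcE => x h1 h2 h3 Ox; rewrite h2//.
  have -> : (fun k => W (n1 (m k)) x) = vc ^~ x by apply/funext => k; rewrite h3.
  exact: h1.
exists (n1 \o m); split=> [j|]; first by rewrite (leq_trans (mk j))// n1j.
exists w; split=> //; apply: (L2_dominated_cvg (M := M)) => // n.
Qed.

End BV_compactness.

(** * Duality and cell means *)

Section duality.
Context {R : realType} {d : nat} {Omega : set 'rV[R]_d} {oO : open Omega}.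
Local Notation V := 'rV[R]_d.
Local Notation leb := (lebesgue_rV R d).
Local Notation H := (L2 (lebesgue_on oO)).
Context {U : normedModType R}.
Variable emb : U -> H.
Hypothesis bO : bounded_set Omega.
Hypothesis emb_lin : linear emb.
Hypothesis emb_compact : compact_map emb.
Implicit Types (f g : H) (u v : U) (phi psi : dual_space U).

Let mO : measurable Omega. Proof. exact: measurable_Omega. Qed.

Lemma embZ (k : R) v : emb (k *: v) = k *: emb v.
Proof.
have e0 : emb 0 = 0.
  have := emb_lin 1 0 0; rewrite !scale1r addr0 => h.
  by apply: (@addrI _ (emb 0)); rewrite -h addr0.
by have := emb_lin k v 0; rewrite addr0 e0 addr0.
Qed.

Lemma embB u v : emb (u - v) = emb u - emb v.
Proof. by rewrite addrC -scaleN1r emb_lin scaleN1r addrC. Qed.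

(** A compact linear map sends the unit ball to a bounded set. *)
Lemma compact_map_bounded : exists2 E, 0 <= E & forall v, `|emb v| <= E * `|v|.
Proof.
have bB : bounded_set [set v : U | `|v| <= 1].
  by exists 1; split=> [|M M1 x /= x1]; [exact: num_real|exact: le_trans (ltW M1)].
have [M [Mr hM]] := compact_bounded (emb_compact bB).
exists (`|M| + 1) => [|v]; first exact: addr_ge0.
have [->|v0] := eqVneq v 0.
  by rewrite -(scale0r (0 : U)) embZ !scale0r !normr0 mulr0.
have nv : 0 < `|v| by rewrite normr_gt0.
have : `|emb (`|v|^-1 *: v)| <= `|M| + 1.
  apply: hM; first by rewrite (le_lt_trans (ler_norm _))// ltrDl.
  apply: subset_closure; exists (`|v|^-1 *: v) => //=.
  by rewrite normrZ normfV normr_id mulVf// gt_eqF.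
by rewrite embZ normrZ normfV normr_id ler_pdivrMl// mulrC.
Qed.

Lemma dual_le phi (k : R) : 0 <= k -> (forall v, `|phi v| <= k * `|v|) -> `|phi| <= k.
Proof.
move=> k0 hk; apply: sup_le_ub.
  by exists `|phi 0|, 0 => //=; rewrite normr0.
by move=> _ [u /= u1 <-]; rewrite (le_trans (hk u))// ler_piMr.
Qed.

Lemma emb_lin_ae (k : R) u v :
  {ae leb, forall x, Omega x -> emb (k *: u + v) x = k * emb u x + emb v x}.
Proof.
apply/(@ae_lebesgue_on _ _ _ oO); rewrite emb_lin; exact: L2_lin_ae.
Qed.

(** Continuity of the functional is the Cauchy-Schwarz inequality together with
    [compact_map_bounded]. *)
Lemma represents_L2 g : exists phi, represents emb g phi.
Proof.
have ig v : leb.-integrable Omega (EFin \o (fun x => g x * emb v x)).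
  exact: L2_mul_integrable.
pose F v : R^o := \int[leb]_(x in Omega) (g x * emb v x).
have linF : linear F.
  move=> k u v; rewrite /F /GRing.scale /= -RintegralZl// -RintegralD//; last first.
    rewrite (_ : EFin \o _ = (fun x => k%:E * (g x * emb u x)%:E)%E)//.
    exact: (integrableZl mO k (ig u)).
  congr fine; apply: ae_eq_integral => //.
  - exact: measurable_int (ig _).
  - apply/measurable_EFinP; apply: measurable_funD.
      apply: measurable_funM; first exact: measurable_cst.
      by apply/measurable_EFinP; exact: measurable_int (ig u).
    by apply/measurable_EFinP; exact: measurable_int (ig v).
  - by apply: filterS (emb_lin_ae k u v) => x h Ox; rewrite h//; congr EFin; ring.
pose L : {linear U -> R^o} :=
  HB.pack F (GRing.isLinear.Build R U R^o *:%R F linF).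
have [E E0 hE] := compact_map_bounded.
have bF v : `|F v| <= `|g| * E * `|v|.
  apply: le_trans (le_normr_Rintegral mO (ig v)) _.
  by rewrite (le_trans (cauchy_schwarz g (emb v)))// -mulrA ler_wpM2l.
have cF : continuous F.
  apply: (@bounded_linear_continuous _ _ _ L); apply/linear_boundedP.
  exists (`|g| * E); split=> [|r rE x]; first exact: num_real.
  by rewrite (le_trans (bF x))// ler_wpM2r// ltW.
have FP : F \in @dual_pred R U by apply/asboolP; split.
by exists (Dual FP) => v; split.
Qed.

Lemma represents_ae (g h : V -> R) phi : measurable_fun Omega h ->
  {ae leb, forall x, Omega x -> g x = h x} -> represents emb g phi -> represents emb h phi.
Proof.
move=> mh gh gphi v; have [ig Eg] := gphi v.
have mhv : measurable_fun Omega (fun x => h x * emb v x).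
  apply: measurable_funM => //; apply: measurable_funTS; exact: L2_measurable.
have E : {ae leb, forall x, Omega x -> (g x * emb v x)%:E = (h x * emb v x)%:E}.
  by apply: filterS gh => x H Ox; rewrite H.
split; last by rewrite Eg; congr fine; apply: ae_eq_integral => //;
  [exact: measurable_int ig|exact/measurable_EFinP].
apply/integrableP; split; first exact/measurable_EFinP.
have /integrableP[mg] := ig; apply: le_lt_trans.
rewrite le_eqVlt; apply/orP; left; apply/eqP; apply: ge0_ae_eq_integral => //.
- by apply: measurableT_comp => //; exact/measurable_EFinP.
- exact: measurableT_comp.
- by apply: filterS gh => x E' Ox /=; rewrite E'.
Qed.

Lemma represents_uniq (g : V -> R) phi psi :
  represents emb g phi -> represents emb g psi -> phi = psi.
Proof.
by move=> h1 h2; apply/val_inj/funext => v /=; rewrite (h1 v).2 (h2 v).2.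
Qed.

Lemma represents_sum (I : finType) (g : I -> V -> R) (phi : I -> dual_space U) (z : I -> R) :
  (forall i, represents emb (g i) (phi i)) ->
  represents emb (fun x => \sum_i z i * g i x) (\sum_i z i *: phi i).
Proof.
move=> h; pose P (G : V -> R) (psi : dual_space U) := represents emb G psi.
have -> : (fun x => \sum_i z i * g i x) = \sum_i (fun x => z i * g i x).
  by apply/funext => x; rewrite fct_sumE.
apply: (big_ind2 (fun G psi => represents emb G psi)).
- move=> v; split; last by rewrite /Rintegral integral0_eq// => x _; rewrite mul0r.
  apply: (eq_integrable mO (cst 0%E)); last exact: integrable0.
  by move=> x _; rewrite /= mul0r.
- move=> G1 psi1 G2 psi2 h1 h2 v; have [i1 e1] := h1 v; have [i2 e2] := h2 v.
  have E x : (G1 + G2) x * emb v x = G1 x * emb v x + G2 x * emb v x by rewrite mulrDl.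
  rewrite (funext E); split; first exact: (integrableD mO i1 i2).
  by rewrite RintegralD// -e1 -e2.
- move=> i _ v; have [ii ei] := h i v.
  have E x : z i * g i x * emb v x = z i * (g i x * emb v x) by rewrite mulrA.
  rewrite (funext E); split; first exact: (integrableZl mO (z i) ii).
  by rewrite RintegralZl// -ei.
Qed.

End duality.

Section cell_means.
Context {R : realType} {d : nat} {Omega : set 'rV[R]_d} {oO : open Omega}.
Local Notation V := 'rV[R]_d.
Local Notation leb := (lebesgue_rV R d).
Local Notation H := (L2 (lebesgue_on oO)).
Hypothesis bO : bounded_set Omega.
Variables (h : R) (N : nat) (Q : 'I_N -> set V).
Hypothesis Qp : cube_partition Omega h Q.
Implicit Types (f g : H) (i : 'I_N).

Let mO : measurable Omega. Proof. exact: measurable_Omega. Qed.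

Lemma measurable_cell i : measurable (Q i). Proof. by case: Qp. Qed.

Lemma sub_cell i : Q i `<=` Omega.
Proof. by have [_ _ <- _] := Qp; exact: bigcup_sup. Qed.

Lemma cell_nonempty i : Q i !=set0.
Proof.
have [a [s [s0 aQ _]]] := cube_partition_boxes Qp.
exists (\row_l (a i 0 l + s i 0 l / 2)); apply: aQ => l; rewrite !mxE.
by have /andP[sl _] := s0 i l; apply/andP; split; lra.
Qed.

Lemma indic_cell i k x : Q i x -> \1_(Q k) x = (k == i)%:R :> R.
Proof.
move=> Qx; case: eqP => [->|ki]; first by rewrite indicE mem_set.
rewrite indicE memNset// => Qkx; apply: ki; have [_ tQ _ _] := Qp.
by apply: tQ => //; exists x.
Qed.

Lemma step_fun_cell i x (c : 'I_N -> R) : Q i x -> \sum_k c k * \1_(Q k) x = c i.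
Proof.
move=> Qx; rewrite (bigD1 i)//= (indic_cell i Qx) eqxx mulr1 big1 ?addr0// => k ki.
by rewrite (indic_cell k Qx) (negPf ki) mulr0.
Qed.

Lemma cell_averageE i x (g : V -> R) : Q i x -> cell_average Q g x = cell_mean (Q i) g.
Proof. exact: step_fun_cell. Qed.

Lemma cell_mean_lin i (k : R) f g :
  cell_mean (Q i) (k *: f + g : H) = k * cell_mean (Q i) f + cell_mean (Q i) g.
Proof.
have mQ := measurable_cell i.
have iQ f' : leb.-integrable (Q i) (EFin \o (f' : H)).
  exact: (integrableS mO mQ (@sub_cell i) (L2_integrable bO f')).
rewrite /cell_mean mulrCA -mulrDr -[k * _]RintegralZl// -RintegralD//; last first.
  rewrite (_ : EFin \o _ = (fun x => k%:E * (f x)%:E)%E)//.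
  exact: (integrableZl mQ k (iQ f)).
congr (_ * fine _); apply: ae_eq_integral => //.
- exact: measurable_int (iQ _).
- apply/measurable_EFinP; apply: measurable_funD; last first.
    by apply/measurable_EFinP; exact: measurable_int (iQ _).
  apply: measurable_funM; first exact: measurable_cst.
  by apply/measurable_EFinP; exact: measurable_int (iQ _).
- have := (@ae_lebesgue_on _ _ _ oO _).2 (L2_lin_ae k f g).
  by apply: filterS => x E Qx; rewrite E//; exact: sub_cell Qx.
Qed.

Lemma cell_mean_bounded i : exists2 c, 0 <= c & forall f, `|cell_mean (Q i) f| <= c * `|f|.
Proof.
have [c c0 hc] := L2_L1 (oO := oO) bO.
have mQ := measurable_cell i.
exists (`|(fine (leb (Q i)))^-1| * c) => [|f]; first exact: mulr_ge0.
have [iF hF] := hc f.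
rewrite /cell_mean normrM -mulrA ler_wpM2l//; apply: le_trans hF.
have iQ : leb.-integrable (Q i) (EFin \o f).
  exact: (integrableS mO mQ (@sub_cell i) iF).
apply: le_trans (le_normr_Rintegral mQ iQ) _.
rewrite /Rintegral fine_le//.
- exact: (integrable_fin_num mQ (integrable_norm iQ)).
- exact: (integrable_fin_num mO (integrable_norm iF)).
- apply: ge0_subset_integral => //; last exact: sub_cell.
  exact: measurable_int (integrable_norm iF).
Qed.

End cell_means.

(** * The two problems *)

Section problem.
Context {R : realType} {d : nat} {Omega : set 'rV[R]_d} {oO : open Omega}.
Local Notation V := 'rV[R]_d.
Local Notation leb := (lebesgue_rV R d).
Local Notation H := (L2 (lebesgue_on oO)).
Context {U : completeNormedModType R}.
Variables (emb : U -> H) (A : {linear U -> dual_space U}) (B : {linear dual_space U -> U}).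
Variables (f : dual_space U) (C : set H).
Hypothesis bO : bounded_set Omega.
Hypothesis emb_lin : linear emb.
Hypothesis emb_compact : compact_map emb.
Hypotheses (AB : cancel A B) (BA : cancel B A) (cB : continuous B).
Hypotheses (C_bounded : bounded_set C) (C_closed : closed C) (C_convex : convex_set C).
Variables (wl wu : LfunType (lebesgue_on oO) (leey (1 : \bar R))).
Variables (h : R) (N : nat) (Q : 'I_N -> set V).
Hypotheses (h0 : 0 < h) (Qp : cube_partition Omega h Q).
Variables (ulc uuc wlc wuc : 'I_N -> R).

Let mO : measurable Omega. Proof. exact: measurable_Omega. Qed.

Lemma inverse_bounded : exists2 K, 0 <= K & forall phi, `|B phi| <= K * `|phi|.
Proof.
have /linear_boundedP[M [Mr hM]] := @continuous_linear_bounded _ _ _ 0 B (@cB 0).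
exists (`|M| + 1) => [|phi]; first exact: addr_ge0.
by apply: hM; rewrite (le_lt_trans (ler_norm _))// ltrDl.
Qed.

Lemma C_norm_le : exists2 K, 0 <= K & forall w, C w -> `|w| <= K.
Proof.
have [M [Mr hM]] := C_bounded.
exists (`|M| + 1) => [|w Cw]; first exact: addr_ge0.
by apply: hM => //; rewrite (le_lt_trans (ler_norm _))// ltrDl.
Qed.

Lemma linfty_bound (g : LfunType (lebesgue_on oO) (leey (1 : \bar R))) :
  exists2 M, 0 <= M & {ae leb, forall x, Omega x -> `|g x| <= M}.
Proof.
have : finite_norm (lebesgue_on oO) +oo%E g by exact: Lfunction_finite.
rewrite /finite_norm unlock; case: ifPn => [mu0 sup_fin|].
  have aeg := ess_sup_ge (lebesgue_on oO) (abse \o (EFin \o g)).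
  set e := ess_sup _ _ in sup_fin aeg.
  exists (Num.max 0 (fine e)); first by rewrite le_max lexx.
  apply/(@ae_lebesgue_on _ _ _ oO); apply: filterS aeg => x /=.
  move: sup_fin; case: e => [r _|//|_]; last by rewrite leNgt ltNyr.
  by rewrite lee_fin => le; rewrite le_max le orbT.
rewrite -leNgt => mu0 _; exists 0 => //.
apply/(@ae_lebesgue_on _ _ _ oO); exists setT; split=> //.
by apply/eqP; rewrite -measure_le0.
Qed.

Lemma control_bound : exists2 M, 0 <= M & forall w : V -> R,
  ae_le Omega wl w -> ae_le Omega w wu -> {ae leb, forall x, Omega x -> `|w x| <= M}.
Proof.
have [Ml Ml0 hl] := linfty_bound wl; have [Mu Mu0 hu] := linfty_bound wu.
exists (Ml + Mu) => [|w lw wuw]; first exact: addr_ge0.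
apply: filterS2 (filterI hl hu) (filterI lw wuw) => x [h1 h2] [h3 h4] Ox.
have := h1 Ox; have := h2 Ox; have := h3 Ox; have := h4 Ox; rewrite !ler_norml.
by lra.
Qed.

Lemma represents_cell i : exists phi, represents emb (\1_(Q i)) phi.
Proof.
have mQ := measurable_cell Qp i.
have m1 : measurable_fun setT (\1_(Q i) : V -> R) by exact: measurable_indic.
have b1 x : `|\1_(Q i) x| <= 1 :> R.
  by rewrite indicE; case: (x \in Q i); rewrite ?normr1 ?normr0.
have [g gE] : exists g : H, (g : V -> R) = \1_(Q i) %[ae (lebesgue_on oO)].
  exact: (L2_of_bounded (@integrable_Omega_cst _ _ _ oO bO 1) m1 b1).
have [phi hphi] := represents_L2 emb_lin emb_compact g.
exists phi; apply: represents_ae hphi; first exact: measurable_indic.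
by apply/(@ae_lebesgue_on _ _ _ oO); apply: filterS gE => x; apply.
Qed.

Definition cell_dual (i : 'I_N) : dual_space U := projT1 (cid (represents_cell i)).

Lemma cell_dualP i : represents emb (\1_(Q i)) (cell_dual i).
Proof. exact: projT2 (cid (represents_cell i)). Qed.

(** With the numbers [z] in place of the product, the equation is solved for the
    state in closed form. That the state is affine in [z] yields convexity,
    boundedness and convergence of the states. *)
Definition relaxed_state (z : 'rV[R]_N) : U := B (f - \sum_i z 0 i *: cell_dual i).

Lemma relaxed_stateP u (z : 'rV[R]_N) :
  solves emb A f u (fun x => \sum_(i < N) z 0 i * \1_(Q i) x) <-> u = relaxed_state z.
Proof.
have rz : represents emb (fun x => \sum_(i < N) z 0 i * \1_(Q i) x)
    (\sum_i z 0 i *: cell_dual i).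
  by apply: represents_sum => i; exact: cell_dualP.
split=> [[phi hphi Au]|->]; last by exists (\sum_i z 0 i *: cell_dual i); rewrite // BA subrK.
by rewrite /relaxed_state -(represents_uniq hphi rz) -Au addrK AB.
Qed.

Lemma relaxed_state_conv (l : R) z1 z2 :
  relaxed_state (l *: z1 + (1 - l) *: z2) =
  l *: relaxed_state z1 + (1 - l) *: relaxed_state z2.
Proof.
rewrite /relaxed_state -!linearZ -linearD; congr (B _).
rewrite !scalerBr addrACA -scalerDl subrKC scale1r -opprD; congr (_ - _).
rewrite !scaler_sumr -big_split; apply: eq_bigr => i _ /=.
by rewrite !mxE scalerDl !scalerA.
Qed.

(** The McCormick inequalities on the cell [i], for the mean [m] of the state,
    the mean [p] of the control and the relaxed product [z]. *)
Definition envelope i (m p z : R) :=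
  [/\ ulc i * p + m * wlc i - ulc i * wlc i <= z,
      uuc i * p + m * wuc i - uuc i * wuc i <= z,
      z <= uuc i * p + m * wlc i - uuc i * wlc i,
      z <= ulc i * p + m * wuc i - ulc i * wuc i &
      ulc i <= m <= uuc i].

(** All the inequalities are affine in [(m, p, z)]. *)
Lemma envelope_conv i (l m1 p1 z1 m2 p2 z2 : R) : 0 <= l <= 1 ->
  envelope i m1 p1 z1 -> envelope i m2 p2 z2 ->
  envelope i (l * m1 + (1 - l) * m2) (l * p1 + (1 - l) * p2) (l * z1 + (1 - l) * z2).
Proof.
move=> /andP[l0 l1'] [a1 a2 a3 a4 /andP[a5 a6]] [b1 b2 b3 b4 /andP[b5 b6]].
have l1 : 0 <= 1 - l by rewrite subr_ge0.
have := ler_wpM2l l0 a1; have := ler_wpM2l l0 a2; have := ler_wpM2l l0 a3.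
have := ler_wpM2l l0 a4; have := ler_wpM2l l0 a5; have := ler_wpM2l l0 a6.
have := ler_wpM2l l1 b1; have := ler_wpM2l l1 b2; have := ler_wpM2l l1 b3.
have := ler_wpM2l l1 b4; have := ler_wpM2l l1 b5; have := ler_wpM2l l1 b6.
move=> {a1 a2 a3 a4 a5 a6 b1 b2 b3 b4 b5 b6} b6 b5 b4 b3 b2 b1 a6 a5 a4 a3 a2 a1.
split; [lra|lra|lra|lra|]; apply/andP; split; lra.
Qed.

(** Each inequality expands the product of two nonnegative distances to the
    bounds. *)
Lemma envelope_mul i (m p : R) : ulc i <= m <= uuc i -> wlc i <= p <= wuc i ->
  envelope i m p (m * p).
Proof.
move=> /[dup] mb /andP[m1 m2] /andP[p1 p2]; split=> //.
- have : 0 <= (m - ulc i) * (p - wlc i) by rewrite mulr_ge0 ?subr_ge0.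
  by lra.
- have : 0 <= (uuc i - m) * (wuc i - p) by rewrite mulr_ge0 ?subr_ge0.
  by lra.
- have : 0 <= (uuc i - m) * (p - wlc i) by rewrite mulr_ge0 ?subr_ge0.
  by lra.
- have : 0 <= (m - ulc i) * (wuc i - p) by rewrite mulr_ge0 ?subr_ge0.
  by lra.
Qed.

Lemma envelope_closed i (m_ p_ z_ : nat -> R) (m p z : R) :
  m_ n @[n --> \oo] --> m -> p_ n @[n --> \oo] --> p -> z_ n @[n --> \oo] --> z ->
  (forall n, envelope i (m_ n) (p_ n) (z_ n)) -> envelope i m p z.
Proof.
move=> cm cp cz en.
have le (u_ v_ : nat -> R) (u v : R) : u_ n @[n --> \oo] --> u ->
    v_ n @[n --> \oo] --> v -> (forall n, u_ n <= v_ n) -> u <= v.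
  move=> cu cv uv; rewrite -(cvg_lim _ cu)// -(cvg_lim _ cv)//.
  by apply: ler_lim; [exact: cvgP cu|exact: cvgP cv|exact: nearW].
have lin (a b c : R) : a * p_ n + m_ n * b - c @[n --> \oo] --> a * p + m * b - c.
  apply: cvgB; last exact: cvg_cst.
  by apply: cvgD; [apply: cvgMl_tmp|apply: cvgMr_tmp].
have cc (c : R) : (fun _ : nat => c) n @[n --> \oo] --> c by exact: cvg_cst.
split.
- by apply: (le _ _ _ _ (lin _ _ _) cz) => n; case: (en n).
- by apply: (le _ _ _ _ (lin _ _ _) cz) => n; case: (en n).
- by apply: (le _ _ _ _ cz (lin _ _ _)) => n; case: (en n).
- by apply: (le _ _ _ _ cz (lin _ _ _)) => n; case: (en n).
- apply/andP; split.
    by apply: (le _ _ _ _ (cc _) cm) => n; case: (en n) => _ _ _ _ /andP[].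
  by apply: (le _ _ _ _ cm (cc _)) => n; case: (en n) => _ _ _ _ /andP[].
Qed.

Local Notation mccF := (mccormick_feasible emb A f C wl wu Q ulc uuc wlc wuc).

Lemma mccormick_feasibleP (u : U) (w : H) (z : 'rV[R]_N) : mccF (u, w, z) <->
  [/\ C w, ae_le Omega wl w, ae_le Omega w wu, u = relaxed_state z &
      forall i, envelope i (cell_mean (Q i) (emb u)) (cell_mean (Q i) w) (z 0 i)].
Proof.
split=> [[Cw lw wuw su hz]|[Cw lw wuw su hz]]; split => //.
- exact/relaxed_stateP.
- move=> i; have [x Qx] := cell_nonempty Qp i.
  by have := hz i x Qx; rewrite !(cell_averageE Qp _ Qx).
- exact/relaxed_stateP.
- by move=> i x Qx; rewrite !(cell_averageE Qp _ Qx); exact: hz.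
Qed.

Lemma cell_mean_conv i (l : R) (g1 g2 : H) :
  cell_mean (Q i) (l *: g1 + (1 - l) *: g2 : H) =
  l * cell_mean (Q i) g1 + (1 - l) * cell_mean (Q i) g2.
Proof.
have lin := cell_mean_lin (oO := oO) bO Qp i.
have cm0 : cell_mean (Q i) (0 : H) = 0.
  have := lin 1 0 0; rewrite scale1r addr0 mul1r => E.
  by apply: (@addrI _ (cell_mean (Q i) (0 : H))); rewrite -E addr0.
rewrite lin; congr (_ + _).
by rewrite -[(1 - l) *: g2]addr0 lin cm0 addr0.
Qed.

Lemma L2_conv_ae (l : R) (w1 w2 : H) : {ae leb, forall x, Omega x ->
  (l *: w1 + (1 - l) *: w2 : H) x = l * w1 x + (1 - l) * w2 x}.
Proof.
apply/(@ae_lebesgue_on _ _ _ oO).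
apply: filterS2 (L2_lin_ae l w1 ((1 - l) *: w2)) (L2_scaleE (1 - l) w2).
by move=> x -> /(_ I) ->.
Qed.

(** Apart from [C w], the constraints are affine in [(u, w, z)] jointly. *)
Lemma mccormick_convex : convex_set mccF.
Proof.
move=> [[u1 w1] z1] [[u2 w2] z2] l /set_mem/mccormick_feasibleP[C1 l1 r1 s1 e1].
move=> /set_mem/mccormick_feasibleP[C2 l2 r2 s2 e2]; apply/mem_set.
have l01 : 0 <= l%:num <= 1 by rewrite ge0 le1.
have lC := C_convex l (mem_set C1) (mem_set C2).
set k := l%:num in l01.
have E : conv l ((u1, w1, z1) : convex_lmodType (U * H * 'rV[R]_N)%type)
    ((u2, w2, z2) : convex_lmodType (U * H * 'rV[R]_N)%type) =
  (k *: u1 + (1 - k) *: u2, k *: w1 + (1 - k) *: w2, k *: z1 + (1 - k) *: z2) by [].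
rewrite E; apply/mccormick_feasibleP; split.
- exact: set_mem lC.
- apply: filterS2 (L2_conv_ae k w1 w2) (filterI l1 l2) => x hx [h1 h2] Ox.
  have /andP[k0 k1] := l01; rewrite hx//; have := h1 Ox; have := h2 Ox; nra.
- apply: filterS2 (L2_conv_ae k w1 w2) (filterI r1 r2) => x hx [h1 h2] Ox.
  have /andP[k0 k1] := l01; rewrite hx//; have := h1 Ox; have := h2 Ox; nra.
- by rewrite relaxed_state_conv s1 s2.
- move=> i; rewrite emb_lin (embZ emb_lin) !cell_mean_conv !mxE.
  exact: envelope_conv.
Qed.

(** The control is bounded since [C] is, the means of the state by their box
    constraint; then the inequalities bound [z], and [z] bounds the state. *)
Lemma mccormick_norm_le : exists2 K, 0 <= K & forall u w z, mccF (u, w, z) ->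
  [/\ `|u| <= K, `|w| <= K & forall i, `|z 0 i| <= K].
Proof.
have [KB KB0 hB] := inverse_bounded; have [KC KC0 hC] := C_norm_le.
have /choice[c hc] i : exists c, 0 <= c /\ forall g : H, `|cell_mean (Q i) g| <= c * `|g|.
  by have [c c0 hc] := cell_mean_bounded (oO := oO) bO Qp i; exists c.
(* crude bounds for the means and for the four affine expressions *)
pose ub i := `|ulc i| + `|uuc i|; pose wb i := `|wlc i| + `|wuc i|.
pose Kz i := ub i * (c i * KC) + ub i * wb i + ub i * wb i.
have ub0 i : 0 <= ub i by exact: addr_ge0.
have wb0 i : 0 <= wb i by exact: addr_ge0.
have Kz0 i : 0 <= Kz i.
  by rewrite !addr_ge0// !mulr_ge0//; have [] := hc i.
have S0 : 0 <= \sum_i Kz i by exact: sumr_ge0.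
pose Ku := KB * (`|f| + \sum_i Kz i * `|cell_dual i|).
have Ku0 : 0 <= Ku.
  by rewrite mulr_ge0// addr_ge0// sumr_ge0// => i _; rewrite mulr_ge0.
exists (Ku + KC + \sum_i Kz i) => [|u w z]; first by rewrite !addr_ge0.
move=> /mccormick_feasibleP[Cw _ _ su e].
have zK i : `|z 0 i| <= Kz i.
  have [e1 e2 e3 e4 /andP[m1 m2]] := e i.
  have pb : `|cell_mean (Q i) w| <= c i * KC.
    by have [ci0 hci] := hc i; rewrite (le_trans (hci w))// ler_wpM2l// hC.
  have mb : `|cell_mean (Q i) (emb u)| <= ub i.
    rewrite ler_norml /ub; have := ler_norm (uuc i); have := ler_norm (- ulc i).
    by rewrite normrN; have := normr_ge0 (uuc i); have := normr_ge0 (ulc i); lra.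
  have aff (a b m p : R) : `|a| <= ub i -> `|b| <= wb i -> `|m| <= ub i ->
      `|p| <= c i * KC -> `|a * p + m * b - a * b| <= Kz i.
    move=> ha hb hm hp; rewrite /Kz (le_trans (ler_normB _ _))// lerD//; last first.
      by rewrite normrM ler_pM.
    by rewrite (le_trans (ler_normD _ _))// !normrM lerD ?ler_pM.
  have ul1 : `|ulc i| <= ub i by rewrite lerDl.
  have uu1 : `|uuc i| <= ub i by rewrite lerDr.
  have wl1 : `|wlc i| <= wb i by rewrite lerDl.
  have := aff _ _ _ _ ul1 wl1 mb pb; have := aff _ _ _ _ uu1 wl1 mb pb.
  rewrite !ler_norml.
  by lra.
split.
- apply: (@le_trans _ _ Ku); last by rewrite -addrA lerDl addr_ge0.
  rewrite su (le_trans (hB _))// ler_wpM2l// (le_trans (ler_normB _ _))// lerD2l.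
  apply: le_trans (ler_norm_sum _ _ _) _; apply: ler_sum => i _.
  by rewrite normrZ ler_wpM2r.
- by apply: le_trans (hC _ Cw) _; rewrite -addrA addrCA lerDl addr_ge0.
- move=> i; apply: le_trans (zK i) _.
  apply: (@le_trans _ _ (\sum_i Kz i)); last by rewrite lerDr addr_ge0.
  by rewrite (bigD1 i)//= lerDl sumr_ge0.
Qed.

Lemma mccormick_bounded : bounded_set mccF.
Proof.
have [K K0 hK] := mccormick_norm_le.
exists K; split=> [|M KM [[u w] z] /hK[uK wK zK] /=]; first exact: num_real.
have {}KM := ltW KM.
rewrite !prod_normE /= !ge_max (le_trans uK KM) (le_trans wK KM) /=.
rewrite /Num.Def.normr /= mx_normrE; apply: bigmax_le => [|[a b] _ /=].
  exact: le_trans KM.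
by rewrite ord1 (le_trans (zK b)).
Qed.

Variables (alpha : R) (j : U * H -> R^o).
Hypothesis alpha0 : 0 < alpha.
Hypothesis j_lip : forall D, bounded_set D -> [lipschitz j p | p in D].

Local Notation mccJ := (@mccormick_objective R d Omega oO U j alpha N).

Lemma relaxed_state_cvg (z_ : nat -> 'rV[R]_N) (z : 'rV[R]_N) :
  (forall i, z_ n 0 i @[n --> \oo] --> z 0 i) ->
  relaxed_state (z_ n) @[n --> \oo] --> relaxed_state z.
Proof.
move=> cz; have E z' : relaxed_state z' = B f - \sum_i z' 0 i *: B (cell_dual i).
  by rewrite /relaxed_state linearB linear_sum; under eq_bigr do rewrite linearZ.
rewrite E; under eq_cvg do rewrite E.
apply: cvgB; first exact: cvg_cst.
apply: cvg_big => [|i _]; first exact: add_continuous.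
by apply: cvgZr_tmp; exact: cz.
Qed.

Lemma cell_mean_cvg i (g_ : nat -> H) (g : H) : g_ n @[n --> \oo] --> g ->
  cell_mean (Q i) (g_ n) @[n --> \oo] --> cell_mean (Q i) g.
Proof.
have [c c0 hc] := cell_mean_bounded (oO := oO) bO Qp i.
move=> cg; apply: (@cvg_norm_le _ R H _ _ _ _ c c0 _ cg) => n.
have -> : cell_mean (Q i) (g_ n) - cell_mean (Q i) g = cell_mean (Q i) (g_ n - g : H).
  rewrite addrC -mulN1r -(cell_mean_lin (oO := oO) bO Qp) addrC.
  by rewrite scaleN1r.
exact: hc.
Qed.

Lemma emb_cvg (u_ : nat -> U) (u : U) : u_ n @[n --> \oo] --> u ->
  emb (u_ n) @[n --> \oo] --> emb u.
Proof.
have [E E0 hE] := compact_map_bounded emb_lin emb_compact.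
move=> cu; apply: (@cvg_norm_le _ H U _ _ _ _ E E0 _ cu) => n.
by rewrite -(embB emb_lin).
Qed.

Lemma lipschitz_on_ball (K : R) : exists2 k, 0 <= k & forall p q : U * H,
  `|p| <= K -> `|q| <= K -> `|j p - j q| <= k * `|p - q|.
Proof.
have bK : bounded_set [set p : U * H | `|p| <= K].
  by exists K; split=> [|M KM p /= pK]; [exact: num_real|exact: le_trans (ltW KM)].
have [M [Mr hM]] := j_lip bK; exists (`|M| + 1) => [|p q pK qK]; first exact: addr_ge0.
have := hM (`|M| + 1) _ (p, q); apply; last by split.
by rewrite (le_lt_trans (ler_norm _))// ltrDl.
Qed.

(** Direct method. As [j] is bounded on the feasible set, the variations of a
    minimizing sequence are bounded and [BV_compact] applies to the controls;
    the vectors [z] converge along a further subsequence, and with them the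
    states. The variation of the limit is estimated field by field, each
    pairing with a divergence being continuous. *)
Lemma mccormick_minimizer : (exists2 p, mccF p & (mccJ p < +oo)%E) ->
  exists p, is_minimizer mccF mccJ p.
Proof.
move=> [p0 Fp0 Jp0].
have [K K0 hK] := mccormick_norm_le.
have [k k0 hk] := lipschitz_on_ball K.
have FK p : mccF p -> `|p.1| <= K.
  by case: p => [[u w] z] /hK[uK wK _] /=; rewrite prod_normE ge_max uK wK.
pose Jb := `|j 0| + k * K.
have jb p : mccF p -> `|j p.1| <= Jb.
  move=> /FK pK; rewrite -[j p.1](subrK (j 0)) addrC (le_trans (ler_normD _ _))//.
  rewrite lerD2l (le_trans (hk _ _ pK _)) ?normr0// subr0 ler_wpM2l//.
have Jlow p : mccF p -> ((- Jb)%:E <= mccJ p)%E.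
  move=> Fp; apply: (@le_trans _ _ (j p.1)%:E).
    by rewrite lee_fin; have := jb p Fp; rewrite ler_norml => /andP[].
  by rewrite /mccormick_objective /objective leeDl// mule_ge0 ?TV_ge0// lee_fin ltW.
pose m := inf_value mccF mccJ.
have mlow : ((- Jb)%:E <= m)%E by apply: le_ereal_inf_tmp => _ [p Fp <-]; exact: Jlow.
have mub : (m < +oo)%E by apply: le_lt_trans Jp0; apply: ereal_inf_lbound; exists p0.
have mfin : m \is a fin_num by rewrite fin_numE -ltey mub -ltNye (lt_le_trans _ mlow)// ltNyr.
pose r := fine m; have mr : m = r%:E by rewrite fineK.
have /choice[p_ hp] (n : nat) : exists p, mccF p /\ (mccJ p < (r + n.+1%:R^-1)%:E)%E.
  have [_ [p Fp <-] lt] := @lb_ereal_inf_adherent R (mccJ @` mccF) n.+1%:R^-1 ltac:(by rewrite invr_gt0) mfin.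
  by exists p; split=> //; rewrite EFinD -mr.
have pF n := (hp n).1.
pose u_ n := (p_ n).1.1; pose w_ n := (p_ n).1.2; pose z_ n := (p_ n).2.
have pE n : p_ n = (u_ n, w_ n, z_ n) by rewrite /u_ /w_ /z_; case: (p_ n) => [[]].
have TVw n : (TV Omega (w_ n) <= ((r + n.+1%:R^-1 - j (u_ n, w_ n)) / alpha)%:E)%E.
  rewrite EFinM lee_pdivlMr//; have := ltW (hp n).2; rewrite muleC.
  rewrite /mccormick_objective /objective pE /= => le.
  by rewrite EFinB leeBrDl.
have ai : 0 <= alpha^-1 by rewrite invr_ge0 ltW.
have TVt n : (TV Omega (w_ n) <= ((r + 1 + Jb) / alpha)%:E)%E.
  apply: le_trans (TVw n) _; rewrite lee_fin ler_wpM2r//.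
  apply: lerD; first by rewrite lerD2l invf_le1// ler1n.
  have := jb _ (pF n); rewrite pE /= ler_norml => /andP[? _]; lra.
have [M M0 hM] := control_bound.
have wM n : {ae leb, forall x, Omega x -> `|w_ n x| <= M}.
  by have := pF n; rewrite pE => /mccormick_feasibleP[_ l1 r1 _ _]; exact: hM.
have [n1 [n1j [w [cw aew]]]] := BV_compact bO h0 Qp M0 wM TVt.
have [i|n2 [n2j [l cl]]] := common_subsequence (g := fun (i : 'I_N) n => z_ (n1 n) 0 i).
  by exists K => n; have := pF (n1 n); rewrite pE => /hK[_ _].
pose s n := n1 (n2 n).
have n2oo : n2 @ \oo --> \oo.
  by apply/cvgnyPge => A0; near=> n; apply: leq_trans (n2j n); near: n; exact: nbhs_infty_ge.
have sj n : (n <= s n)%N by apply: leq_trans (n2j n) (n1j _).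
have cws : w_ (s n) @[n --> \oo] --> w by exact: cvg_comp n2oo cw.
have aews : {ae leb, forall x, Omega x -> w_ (s n) x @[n --> \oo] --> w x}.
  by apply: filterS aew => x hx Ox; exact: cvg_comp n2oo (hx Ox).
pose z : 'rV[R]_N := \row_i l i; pose u := relaxed_state z.
have cz i : z_ (s n) 0 i @[n --> \oo] --> z 0 i by rewrite mxE; exact: cl.
have cu : u_ (s n) @[n --> \oo] --> u.
  have E n : u_ (s n) = relaxed_state (z_ (s n)).
    by have := pF (s n); rewrite pE => /mccormick_feasibleP[].
  by under eq_cvg do rewrite E; exact: relaxed_state_cvg.
have Fp : mccF (u, w, z).
  apply/mccormick_feasibleP; split=> //.
  - apply: (closed_cvg C C_closed _ _ cws); apply: nearW => n.
    by have := pF (s n); rewrite pE => /mccormick_feasibleP[].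
  - have aeb : {ae leb, forall x n, Omega x -> wl x <= w_ (s n) x}.
      apply: ae_foralln => n; have := pF (s n).
      by rewrite pE => /mccormick_feasibleP[].
    apply: filterS2 aeb aews => x hb hx Ox; have cx := hx Ox.
    by rewrite -(cvg_lim _ cx)//; apply: limr_ge; [exact: cvgP cx|apply: nearW => n; exact: hb].
  - have aeb : {ae leb, forall x n, Omega x -> w_ (s n) x <= wu x}.
      apply: ae_foralln => n; have := pF (s n).
      by rewrite pE => /mccormick_feasibleP[].
    apply: filterS2 aeb aews => x hb hx Ox; have cx := hx Ox.
    by rewrite -(cvg_lim _ cx)//; apply: limr_le; [exact: cvgP cx|apply: nearW => n; exact: hb].
  - move=> i; apply: (envelope_closed _ _ (cz i)).
    + by apply: cell_mean_cvg; exact: emb_cvg cu.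
    + exact: cell_mean_cvg cws.
    + by move=> n; have := pF (s n); rewrite pE => /mccormick_feasibleP[].
exists (u, w, z); split=> // q Fq.
apply: (@le_trans _ _ m); last by apply: ereal_inf_lbound; exists q.
have cj : j (u_ (s n), w_ (s n)) @[n --> \oo] --> (j (u, w) : R).
  have cuw : (u_ (s n), w_ (s n)) @[n --> \oo] --> ((u, w) : U * H).
    exact: cvg_pair cu cws.
  apply: (@cvg_norm_le _ R _ _ _ _ _ k k0 _ cuw) => n; apply: hk.
    by have := FK _ (pF (s n)); rewrite pE.
  exact: FK Fp.
have TVp : (TV Omega w <= ((r - j (u, w)) / alpha)%:E)%E.
  apply: ge_ereal_sup => _ [phi tphi <-].
  have c1 := divergence_pairing_cvg bO tphi cws.
  rewrite lee_fin -(cvg_lim _ c1)//.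
  have c2 : (r + harmonic n - j (u_ (s n), w_ (s n))) / alpha @[n --> \oo] -->
      (r + 0 - j (u, w)) / alpha.
    apply: cvgMr_tmp; apply: cvgB; last exact: cj.
    by apply: cvgD; [exact: cvg_cst|exact: cvg_harmonic].
  rewrite -[r in leRHS]addr0 -(cvg_lim _ c2)//.
  apply: ler_lim; [exact: cvgP c1|exact: cvgP c2|apply: nearW => n].
  rewrite -lee_fin; apply: le_trans (TV_ub _ tphi) _; apply: le_trans (TVw _) _.
  rewrite lee_fin ler_wpM2r// lerD2r lerD2l /harmonic.
  by rewrite lef_pV2 ?posrE// ler_nat ltnS.
rewrite mr /mccormick_objective /objective /=.
apply: (@le_trans _ _ ((j (u, w))%:E + alpha%:E * ((r - j (u, w)) / alpha)%:E)%E).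
  by rewrite leeD2l// lee_wpmul2l// lee_fin ltW.
by rewrite -EFinM -EFinD lee_fin mulrC divfK ?gt_eqF// addrC subrK.
Unshelve. all: by end_near. Qed.

Variables (ul uu : H).
Hypothesis state_uniq : forall w : H, C w -> BV Omega w ->
  exists! u, state_eq emb A f u w.
Hypothesis bounds : forall (u : U) (w : H),
  BV Omega w -> C w -> state_eq emb A f u w ->
  [/\ ae_le Omega ul (emb u), ae_le Omega (emb u) uu,
      ae_le Omega wl w & ae_le Omega w wu].
Hypothesis averaged_uniq : forall w : V -> R,
  BV Omega w -> ae_le Omega wl w -> ae_le Omega w wu ->
  exists! u, averaged_eq emb A f Q u w.
Hypothesis cell_bounds : forall (w : H) (u : U),
  C w -> ae_le Omega wl w -> ae_le Omega w wu -> averaged_eq emb A f Q u w ->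
  forall i x, Q i x ->
    ulc i <= cell_average Q (emb u) x <= uuc i /\
    wlc i <= cell_average Q w x <= wuc i.

Local Notation ocpF := (ocp_feasible emb A f C).
Local Notation ocpJ := (objective j alpha).

(** The product of state and control is dominated by a fixed element of [L^2],
    so that the state equation bounds the state through the inverse of the
    operator. *)
Lemma ocp_norm_le : exists K, forall u w, ocpF (u, w) -> `|u| <= K /\ `|w| <= K.
Proof.
have [KB KB0 hB] := inverse_bounded; have [KC KC0 hC] := C_norm_le.
have [M M0 hM] := control_bound.
have [E E0 hE] := compact_map_bounded emb_lin emb_compact.
pose k := M * ((`|ul| + `|uu|) * E).
have k0 : 0 <= k by rewrite !mulr_ge0// addr_ge0.
exists (KB * (`|f| + k) + KC) => u w [/= Cw BVw /[dup] su [phi rphi Au]].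
have [lu uuu lw wuw] := bounds BVw Cw su.
split; last first.
  by apply: le_trans (hC _ Cw) _; rewrite lerDr mulr_ge0// addr_ge0.
apply: (@le_trans _ _ (KB * (`|f| + k))); last by rewrite lerDl.
rewrite -(AB u); apply: le_trans (hB _) _; rewrite ler_wpM2l//.
have -> : A u = f - phi by rewrite -Au addrK.
apply: le_trans (ler_normB _ _) _; rewrite lerD2l; apply: dual_le => // v.
have [iv ->] := rphi v; apply: le_trans (le_normr_Rintegral mO iv) _.
have iabs (g : H) : leb.-integrable Omega (EFin \o (fun x => `|g x * emb v x|)).
  exact: (integrable_norm (L2_mul_integrable g (emb v))).
have isum : leb.-integrable Omega
    (EFin \o (fun x => `|ul x * emb v x| + `|uu x * emb v x|)).
  by have := integrableD mO (iabs ul) (iabs uu); exact: eq_integrable.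
have iM : leb.-integrable Omega
    (EFin \o (fun x => M * (`|ul x * emb v x| + `|uu x * emb v x|))).
  by have := integrableZl mO M isum; exact: eq_integrable.
have le1 : \int[leb]_(x in Omega) `|emb u x * w x * emb v x| <=
    \int[leb]_(x in Omega) (M * (`|ul x * emb v x| + `|uu x * emb v x|)).
  have in1 := integrable_norm iv.
  apply: fine_le; [exact: integrable_fin_num in1|exact: integrable_fin_num iM|].
  apply: ae_ge0_le_integral => //.
  - exact: (measurable_int leb in1).
  - by move=> x _; rewrite lee_fin mulr_ge0// addr_ge0.
  - exact: (measurable_int leb iM).
  apply: filterS2 (filterI lu uuu) (hM _ lw wuw) => x [h1 h2] h3 Ox.
  rewrite lee_fin !normrM -mulrDl mulrA ler_wpM2r// mulrC ler_pM ?h3//.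
  rewrite ler_norml; have := h1 Ox; have := h2 Ox; have := ler_norm (uu x).
  have := ler_norm (- ul x); rewrite normrN.
  by have := normr_ge0 (ul x); have := normr_ge0 (uu x); lra.
apply: le_trans le1 _; rewrite RintegralZl// RintegralD//.
rewrite /k -!mulrA ler_wpM2l// mulrDl lerD//.
- by apply: le_trans (cauchy_schwarz _ _) _; rewrite ler_wpM2l.
- by apply: le_trans (cauchy_schwarz _ _) _; rewrite ler_wpM2l.
Qed.

Lemma lipschitz_fst_exists :
  exists Lu, lipschitz_fst j (ocpF `|` [set p | exists z, mccF (p, z)]) Lu.
Proof.
have [K1 hK1] := ocp_norm_le; have [K2 K20 hK2] := mccormick_norm_le.
pose K := Num.max K1 K2; have [k k0 hk] := lipschitz_on_ball K.
have SK u w : (ocpF `|` [set p | exists z, mccF (p, z)]) (u, w) -> `|(u, w)| <= K.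
  case=> [/hK1[uK wK]|[z /hK2[uK wK _]]]; rewrite prod_normE ge_max /=.
    by rewrite !le_max uK wK.
  by rewrite !le_max uK wK !orbT.
exists k; split=> // u1 u2 w /SK h1 /SK h2; apply: le_trans (hk _ _ h1 h2) _.
rewrite ler_wpM2l// prod_normE /= subrr normr0.
by rewrite ge_max lexx normr_ge0.
Qed.

(** On a cell both averages are constants; outside the cells both sides vanish. *)
Lemma cell_average_mul (g1 g2 : V -> R) x :
  cell_average Q g1 x * cell_average Q g2 x =
  \sum_(i < N) (cell_mean (Q i) g1 * cell_mean (Q i) g2) * \1_(Q i) x.
Proof.
have [[i Qx]|nQ] := pselect (exists i, Q i x).
  by rewrite !(cell_averageE Qp _ Qx) (step_fun_cell Qp _ Qx).
rewrite /cell_average big1 ?mul0r ?big1// => i _; rewrite indicE memNset ?mulr0//.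
- by move=> Qx; apply: nQ; exists i.
- by move=> Qx; apply: nQ; exists i.
Qed.

(** The control satisfies the almost everywhere bounds thanks to the state [u]
    of the original problem, although the point has another state. *)
Lemma averaged_feasible u uh w : ocpF (u, w) -> averaged_eq emb A f Q uh w ->
  mccF (uh, w, \row_i (cell_mean (Q i) (emb uh) * cell_mean (Q i) w)).
Proof.
move=> [/= Cw BVw su] auh; have [_ _ lw wuw] := bounds BVw Cw su.
apply/mccormick_feasibleP; split => //.
- apply/relaxed_stateP; rewrite /averaged_eq in auh.
  rewrite (_ : (fun x => _) =
    (fun x => cell_average Q (emb uh) x * cell_average Q w x))//.
  by apply/funext => x; rewrite cell_average_mul; under eq_bigr do rewrite mxE.
- move=> i; rewrite mxE; have [x Qx] := cell_nonempty Qp i.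
  have := cell_bounds Cw lw wuw auh Qx; rewrite !(cell_averageE Qp _ Qx).
  by case; exact: envelope_mul.
Qed.

Lemma BV_TV_fin w : BV Omega w -> TV Omega w \is a fin_num.
Proof. by move=> [_ TVw]; rewrite ge0_fin_numE// TV_ge0. Qed.

Lemma objectiveE (u : U) (w : H) : BV Omega w ->
  ocpJ (u, w) = (j (u, w) + alpha * fine (TV Omega w))%:E.
Proof.
by move=> /BV_TV_fin tv; rewrite /objective /= -[in LHS](fineK tv) -EFinM -EFinD.
Qed.

(** The control being kept, the total variations cancel. *)
Lemma objective_diff Lu u uh w :
  lipschitz_fst j (ocpF `|` [set p | exists z, mccF (p, z)]) Lu ->
  ocpF (u, w) -> averaged_eq emb A f Q uh w ->
  (`|ocpJ (uh, w) - ocpJ (u, w)| <= (Lu * `|u - uh|)%:E)%E.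
Proof.
move=> [Lu0 hL] /[dup] Fu [/= Cw BVw su] auh.
rewrite !objectiveE// -EFinB lee_fin opprD addrACA subrr addr0.
rewrite (distrC u); apply: hL; last by left.
by right; eexists; exact: averaged_feasible Fu auh.
Qed.

(** The minimal value of the original problem is attained at the control from
    which a feasible point of the relaxation is built. *)
Lemma inf_value_ge Lu ubar ubarh wbar :
  lipschitz_fst j (ocpF `|` [set p | exists z, mccF (p, z)]) Lu ->
  is_minimizer ocpF ocpJ (ubar, wbar) -> averaged_eq emb A f Q ubarh wbar ->
  (inf_value ocpF ocpJ >= inf_value mccF mccJ - (Lu * `|ubar - ubarh|)%:E)%E.
Proof.
move=> hL [Fu minu] auh; have [/= _ BVw _] := Fu.
apply: (@le_trans _ _ (ocpJ (ubar, wbar))); last first.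
  by apply: le_ereal_inf_tmp => _ [p Fp <-]; exact: minu.
rewrite EFinN leeBlDr//; apply: (@le_trans _ _ (ocpJ (ubarh, wbar))).
  by apply: ereal_inf_lbound; eexists; first exact: averaged_feasible Fu auh.
have := objective_diff hL Fu auh; rewrite !objectiveE// -EFinB -EFinD !lee_fin.
by rewrite ler_norml => /andP[_]; rewrite lerBlDl.
Qed.

(** Feasible points with finite objective come from admissible controls by
    solving both equations. *)
Lemma mccormick_feasible_fin w : C w -> BV Omega w ->
  exists2 p, mccF p & (mccJ p < +oo)%E.
Proof.
move=> Cw BVw; have [u [su _]] := state_uniq Cw BVw.
have [_ _ lw wuw] := bounds BVw Cw su.
have [uh [auh _]] := averaged_uniq BVw lw wuw.
have Fu : ocpF (u, w) by [].
eexists; first exact: averaged_feasible Fu auh.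
by rewrite /mccormick_objective /= objectiveE// ltry.
Qed.

End problem.

Theorem theorem2p8 (R : realType) (d : nat) (d0 : (0 < d)%N)
    (Omega : set 'rV[R]_d) (oO : open Omega) (hOmega : bounded_domain Omega)
    (U : completeNormedModType R) (U_refl : reflexive_space U)
    (emb : U -> L2 (lebesgue_on oO)) (emb_lin : linear emb)
    (emb_inj : injective emb) (emb_compact : compact_map emb)
    (* injectivity of the embedding of H = H^* into U^* *)
    (emb_dual_inj : forall g : L2 (lebesgue_on oO),
      represents emb g 0 -> g = 0)
    (A : {linear U -> dual_space U}) (A_cont : continuous A)
    (A_inv : exists B : {linear dual_space U -> U},
      [/\ cancel A B, cancel B A & continuous B])
    (f : dual_space U) (alpha : R) (alpha0 : 0 < alpha)
    (j : U * L2 (lebesgue_on oO) -> R^o)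
    (j_lip : forall B, bounded_set B -> [lipschitz j p | p in B])
    (C : set (L2 (lebesgue_on oO)))
    (C_nonempty : C !=set0) (C_bounded : bounded_set C)
    (C_closed : closed C) (C_convex : convex_set C)
    (prod_dual : forall (u : U) (w : 'rV[R]_d -> R), BV Omega w ->
      exists phi, represents emb (fun x => emb u x * w x) phi)
    (state_uniq : forall w : L2 (lebesgue_on oO), C w -> BV Omega w ->
      exists! u, state_eq emb A f u w)
    (ul uu : L2 (lebesgue_on oO)) (wl wu : LfunType (lebesgue_on oO) (leey (1 : \bar R)))
    (bounds : forall (u : U) (w : L2 (lebesgue_on oO)),
      BV Omega w -> C w -> state_eq emb A f u w ->
      [/\ ae_le Omega ul (emb u), ae_le Omega (emb u) uu,
          ae_le Omega wl w & ae_le Omega w wu])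
    (h : R) (h0 : 0 < h) (N : nat) (Q : 'I_N -> set 'rV[R]_d)
    (Q_part : cube_partition Omega h Q)
    (averaged_uniq : forall w : 'rV[R]_d -> R,
      BV Omega w -> ae_le Omega wl w -> ae_le Omega w wu ->
      exists! u, averaged_eq emb A f Q u w)
    (ulc uuc wlc wuc : 'I_N -> R)
    (cell_bounds : forall (w : L2 (lebesgue_on oO)) (u : U),
      C w -> ae_le Omega wl w -> ae_le Omega w wu -> averaged_eq emb A f Q u w ->
      forall i x, Q i x ->
        ulc i <= cell_average Q (emb u) x <= uuc i /\
        wlc i <= cell_average Q w x <= wuc i) :
  let ocpF := ocp_feasible emb A f C in
  let ocpJ := objective j alpha in
  let mccF := mccormick_feasible emb A f C wl wu Q ulc uuc wlc wuc in
  let mccJ := @mccormick_objective R d Omega oO U j alpha N in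
  [/\ convex_set mccF,
      bounded_set mccF &
      (exists w, C w /\ BV Omega w) -> exists p, is_minimizer mccF mccJ p] /\
  (* the state u of (OCP) need not satisfy the constraints of (McC_h) *)
  let S := ocpF `|` [set p | exists z, mccF (p, z)] in
  (exists Lu, lipschitz_fst j S Lu) /\
  forall Lu : R, lipschitz_fst j S Lu ->
    (forall (u uh : U) (w : L2 (lebesgue_on oO)),
      ocpF (u, w) -> averaged_eq emb A f Q uh w ->
      let zh := \row_i (cell_mean (Q i) (emb uh) * cell_mean (Q i) w) in
      mccF (uh, w, zh) /\
      (`| ocpJ (uh, w) - ocpJ (u, w) | <= (Lu * `|u - uh|)%:E)%E) /\
    (forall (ubar ubarh : U) (wbar : L2 (lebesgue_on oO)),
      is_minimizer ocpF ocpJ (ubar, wbar) -> averaged_eq emb A f Q ubarh wbar ->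
      (inf_value ocpF ocpJ >= inf_value mccF mccJ - (Lu * `|ubar - ubarh|)%:E)%E).
Proof.
have [_ _ _ bO] := hOmega; have [B [AB BA cB]] := A_inv.
split; first split.
- exact: (mccormick_convex bO emb_lin emb_compact AB BA C_convex Q_part).
- exact: (mccormick_bounded f bO emb_lin emb_compact AB BA cB C_bounded wl wu Q_part).
- move=> [w [Cw BVw]].
  apply: (mccormick_minimizer bO emb_lin emb_compact AB BA cB C_bounded C_closed
            h0 Q_part alpha0 j_lip).
  exact: (mccormick_feasible_fin bO emb_lin emb_compact AB BA Q_part alpha
            j state_uniq bounds averaged_uniq cell_bounds Cw BVw).
split.
  exact: (lipschitz_fst_exists bO emb_lin emb_compact AB BA cB C_bounded Q_part _ _ _ _ j_lip bounds).
move=> Lu hL; split=> [u uh w Fu auh|ubar ubarh wbar minu auh].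
  split.
    exact: (averaged_feasible bO emb_lin emb_compact AB BA Q_part bounds cell_bounds Fu auh).
  exact: (objective_diff bO emb_lin emb_compact AB BA Q_part alpha bounds cell_bounds hL Fu auh).
exact: (inf_value_ge bO emb_lin emb_compact AB BA Q_part bounds cell_bounds hL minu auh).
Qed.
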